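(* Let $(X(t))_{t\in\mathbb{R}}$ be a real-valued Gaussian process with mean function $f(t)=\mathbb{E}[X(t)]$, $t\ge 0$, where $f$ is a $C^\infty$ function, and suppose that the centered process $\overline{X}=X-\mathbb{E}[X]$ has stationary increments, with semi-variogram $V$. Let $\delta_n=n^{-\alpha}$ with $0<\alpha\le 1$ fixed. Assume: (i) $V$ is $C^\infty$ on $(0,+\infty)$; (ii) $V$ is $2D$ times differentiable on $\mathbb{R}$ for some integer $D\ge 0$, and there exist $C>0$ and $0<s<2$ such that for all $h\in\mathbb{R}$, $V^{(2D)}(h)=V^{(2D)}(0)+C(-1)^D|h|^s+r(h)$, with $r(h)=o(|h|^s)$ as $h\to 0$; if $\alpha<1$, assume in addition that there is a constant $K$ with $|r(h)|\le K|h|^s$ for all $|h|>1$; (iii) with $d=2$ if $s<3/2$ and $d=3$ if $s\ge 3/2$, there exist $\beta$ with $s-d<\beta<-1/2$ and a constant $K'$ such that $|r^{(d)}(h)|\le K'|h|^\beta$ for all $0<|h|<1$ if $\alpha=1$, and for all $h\ne 0$ if $\alpha<1$; (iv) $r(h)=o(|h|^{s+1/(2\alpha)})$ as $h\to0$. Let $a$ be a non-zero finitely supported real sequence with zero sum whose order $M=M(a)$ satisfies $M>D+s/2+1/4$. Define $$K^\alpha_{M,n}=\sup_{t\in[0,n^{1-\alpha}]}|f^{(M)}(t)|$$ and assume in addition that $K^\alpha_{M,n}=o\big(n^{-1/4}\delta_n^{D-M+s/2}\big)$ as $n\to\infty$. Then, with $C_{a,n}$ computed from the (non-centered) process $X$,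 as $n\to\infty$, $$\frac{C_{a,n}-C}{\sqrt{\mathrm{Var}(C_{a,n})}}\longrightarrow\mathcal{N}(0,1)\quad\text{in distribution}.$$
   Context: The semi-variogram is $V(h)=\frac12\mathbb{E}[(\overline X(t+h)-\overline X(t))^2]$, which does not depend on $t$ by stationarity of increments. A sequence $a$ is written $(a_0,\dots,a_{L-1})$ with $a_0\ne0$, $a_{L-1}\neq 0$; $L=L(a)$ is its length. Its order $M(a)$ is the integer such that $\sum_j a_j j^k=0$ for $0\le k<M(a)$ and $\sum_j a_j j^{M(a)}\ne 0$. The sequence $a^{2*}$ (indexed by $\mathbb{Z}$) is $a^{2*}_j=\sum_{k-l=j}a_k a_l$. The discrete $a$-differences of $X$ are $\Delta_{a,i}(X)=\sum_{j=0}^{L-1}a_jX((i+j)\delta_n)$, $i=1,\dots,n'$, with $n'=n-L+1$, and the quadratic $a$-variation is $V_{a,n}=\sum_{i=1}^{n'}(\Delta_{a,i}(X))^2$. For a finitely supported sequence $b$ indexed by $\mathbb{Z}$, $i\in\mathbb{Z}$, $\delta>0$, an integer $q\ge 1$ and a function $g$, $$R(i,\delta,q,g,b)=-\sum_j b_j j^q\int_0^1\frac{(1-\eta)^{q-1}}{(q-1)!}g((i+j\eta)\delta)\,d\eta,$$ and for $q=0$, $R(i,\delta,0,g,b)=-\sum_j b_j g((i+j)\delta)$. The estimator of $C$ is $$C_{a,n}=\frac{V_{a,n}}{n(-1)^D\delta_n^{2D+s}R(0,1,2D,|\cdot|^s,a^{2*})}$$ (the denominator is positive whenever $M(a)>D$).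 *)

(* Defs.v *)
From HB Require Import structures.
From mathcomp Require Import all_boot all_order all_algebra.
From mathcomp Require Import all_classical all_reals all_analysis.
Set Implicit Arguments.
Unset Strict Implicit.
Unset Printing Implicit Defensive.
Import Order.TTheory GRing.Theory Num.Theory.
Import numFieldTopology.Exports numFieldNormedType.Exports.
Local Open Scope classical_set_scope.
Local Open Scope ring_scope.

Section Smoothness.
Context {R : realType}.

Definition times_derivable (N : nat) (g : R -> R) : Prop :=
  forall (k : nat) (x : R), (k < N)%N -> derivable (derive1n k g) x 1.

(* [A] is meant to be open, so that derivatives at points of [A] only depend
   on the values of [g] on [A]. *)
Definition smooth_on (A : set R) (g : R -> R) : Prop :=
  forall (k : nat) (x : R), A x -> derivable (derive1n k g) x 1.

End Smoothness.

Section Processes.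
Context {d : measure_display} {T : measurableType d} {R : realType}.
Variable P : probability T R.

(* The library's [normal_prob m s] is not a point mass when [s = 0]; the
   degenerate Gaussian laws are the Dirac measures. *)
Definition gaussian_rv (Y : T -> R) : Prop :=
  exists m s : R, forall A : set R, measurable A ->
    P (Y @^-1` A) = if s == 0 then \d_m A else normal_prob m s A.

Definition gaussian_process (X : R -> {RV P >-> R}) : Prop :=
  forall (k : nat) (t c : 'I_k -> R),
    gaussian_rv (fun w => \sum_(i < k) c i * X (t i) w).

Definition centered (X : R -> {RV P >-> R}) (t : R) : T -> R :=
  fun w => X t w - fine 'E_P[X t].

(* The finite-dimensional laws of [(Y (t + h) - Y t)_h] do not depend on [t]. *)
Definition stationary_increments (Y : R -> T -> R) : Prop :=
  forall (k : nat) (h : 'I_k -> R) (t : R) (B : set (k.-tuple R)),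
    measurable B ->
    P [set w | [tuple Y (t + h i) w - Y t w | i < k] \in B] =
    P [set w | [tuple Y (h i) w - Y 0 w | i < k] \in B].

Definition is_semivariogram (Y : R -> T -> R) (V : R -> R) : Prop :=
  forall t h : R,
    (V h)%:E = (2^-1%:E * 'E_P[fun w => ((Y (t + h) w - Y t w) ^+ 2)%R])%E.

(* Pointwise convergence of the distribution functions at the continuity points
   of the limit distribution function. *)
Definition cvg_in_distribution (Y : nat -> T -> R)
    (mu : probability (measurableTypeR R) R) : Prop :=
  forall x : R, {for x, continuous (fun y : R => mu [set` `]-oo, y]])} ->
    P (Y n @^-1` [set` `]-oo, x]]) @[n --> \oo] --> mu [set` `]-oo, x]].

End Processes.

Section Differences.
Context {R : realType}.
Implicit Types (a : seq R) (b : int -> R) (g : R -> R).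

(* The sequence (a_0, ..., a_(L-1)) with nonzero end terms; L is [size a].
   The condition [a`_0 != 0] forces [a] to be nonempty. *)
Definition diff_seq a : Prop := a`_0 != 0 /\ a`_(size a).-1 != 0.

Definition has_order a (M : nat) : Prop :=
  (forall k : nat, (k < M)%N -> \sum_(j < size a) a`_j * j%:R ^+ k = 0) /\
  \sum_(j < size a) a`_j * j%:R ^+ M != 0.

Definition autoconv a (j : int) : R :=
  \sum_(k < size a) \sum_(l < size a | (k%:Z - l%:Z == j)%R) a`_k * a`_l.

(* The sums range over the finite support of the summand. *)
Definition remainder (i : int) (delta : R) (q : nat) g b : R :=
  if q is q'.+1 then
    - \sum_(j \in [set: int]) (b j * j%:~R ^+ q *
        \int[lebesgue_measure]_(eta in `[0, 1])
          ((1 - eta) ^+ q' / q'`!%:R * g ((i%:~R + j%:~R * eta) * delta)))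
  else - \sum_(j \in [set: int]) (b j * g ((i%:~R + j%:~R) * delta)).

Definition step (alpha : R) (n : nat) : R := n%:R `^ (- alpha).

End Differences.

Section Estimator.
Context {d : measure_display} {T : measurableType d} {R : realType}.
Context {P : probability T R}.
Variable X : R -> {RV P >-> R}.
Variables (a : seq R) (alpha : R).

Definition a_difference (n i : nat) : T -> R :=
  fun w => \sum_(j < size a) a`_j * X ((i + j)%:R * step alpha n) w.

(* [n.+1 - size a] is n' = n - L + 1, and 0 when n < L. *)
Definition a_variation (n : nat) : T -> R :=
  fun w => \sum_(1 <= i < (n.+1 - size a).+1) a_difference n i w ^+ 2.

Definition estimator (D : nat) (s : R) (n : nat) : T -> R :=
  fun w => a_variation n w /
    (n%:R * (-1) ^+ D * step alpha n `^ ((2 * D)%:R + s) *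
     remainder 0 1 (2 * D) (fun x => `|x| `^ s) (autoconv a)).

Definition normalized_estimator (D : nat) (s C : R) (n : nat) : T -> R :=
  fun w => (estimator D s n w - C) /
    Num.sqrt (fine 'V_P[estimator D s n]).

End Estimator.

Definition mean_sup {R : realType} (f : R -> R) (alpha : R) (M n : nat) : R :=
  sup [set `|derive1n M f t| | t in `[0, n%:R `^ (1 - alpha)]].

(* Main.v *)
(* A quadratic variation is the squared norm of a Gaussian vector [Y] of
   [a]-differences, up to a drift. If [G] is the covariance matrix of [Y], then
   E((|Y|^2 - tr G) F(|Y|^2)) = 2 E(Y^T G Y F'(|Y|^2)); since the variance of
   Y^T G Y is 2 tr G^4, the variable S = (|Y|^2 - tr G) / sqrt (2 tr G^2) satisfies
   |E (f'(S) - S f(S))| <= 2 sup |f'| rho / sqrt (2 tr G^2), where rho is the largest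
   absolute row sum of [G], and Stein's method yields a central limit theorem as soon
   as rho is negligible with respect to sqrt (tr G^2).

   The entries of [G] are second-order [a]-differences of [V]. Write
   V = polynomial + C (-1)^D W + Q with W^(2D) = |.|^s and Q^(2D) = r. Taylor
   expansions of [W] to order 2M and of [Q] to order 2D + 2 or 2D + 3, in which the
   vanishing moments of [a] cancel the polynomial parts, bound the covariance at lag k
   by a multiple of delta^(2D+s) k^(-kappa) with kappa > 1/2, so that
   rho = o(sqrt n delta^(2D+s)). On the other hand the variance of an [a]-difference is
   equivalent to a positive multiple of delta^(2D+s): by Cauchy-Schwarz the
   [a]-covariance of [W] is maximal at 0, and if it vanished there it would vanish
   identically, which a second difference at the extreme singularity of |.|^s
   excludes because s < 2. *)
Require Import Defs.
From HB Require Import structures.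
From mathcomp Require Import all_boot all_order all_algebra.
From mathcomp Require Import all_classical all_reals all_analysis.
From mathcomp Require Import measurable_realfun.
From mathcomp Require Import ring lra zify.
Set Implicit Arguments.
Unset Strict Implicit.
Unset Printing Implicit Defensive.
Import Order.TTheory GRing.Theory Num.Theory.
Import numFieldTopology.Exports numFieldNormedType.Exports.
Local Open Scope classical_set_scope.
Local Open Scope ring_scope.

(** * Real analysis and moments *)

(** Only linear combinations of the process have known laws, each normal or a point mass, and the
    vector of differences may be degenerate, so no joint density is available. Integration by parts
    is therefore extracted from the characteristic function alone: differentiating E cos(Z + tY) in
    t treats one cosine, product-to-sum formulas treat products of cosines, a limit of such products
    gives exp(-b |Y|^2), and uniform approximation by sums of exponentials reaches every F whose
    derivative vanishes far out. Stein's equation is accordingly solved for compactly supported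
    right-hand sides. Every error is measured against n^(1/2) delta^(2D+s), a lower bound up to a
    constant for sqrt (2 tr G^2). Row sums of k^(-kappa) are of order n^(1-kappa), whence kappa >
    1/2; this is what beta < -1/2 provides for Q and M > D + s/2 + 1/4 for W. In hypothesis (iv),
    delta^(1/(2 alpha)) = n^(-1/2) makes the bias, n times the error on one variance, negligible.
    The condition on the mean makes the sum of the squared drifts negligible at the same scale. *)

Section Calculus.
Context {R : realType}.
Implicit Types (f g F : R -> R) (x y a b c : R).

(** The rules below produce derivatives in the shape of the product and chain rules; this one lets
    the value be normalized afterwards. *)
Lemma drv_eq f x a b : is_derive x 1 f a -> a = b -> is_derive x 1 f b.
Proof. by move=> h <-. Qed.

Lemma eq_drv f g x a : f =1 g -> is_derive x 1 f a -> is_derive x 1 g a.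
Proof. by move=> /funext ->. Qed.

Lemma drv_cst c x : is_derive x 1 (fun=> c) 0.
Proof. exact: is_derive_cst. Qed.

Lemma drv_id x : is_derive x 1 (fun y => y) 1.
Proof. exact: is_derive_id. Qed.

Lemma drvD f g x a b : is_derive x 1 f a -> is_derive x 1 g b ->
  is_derive x 1 (fun y => f y + g y) (a + b).
Proof. by move=> h1 h2; exact: is_deriveD. Qed.

Lemma drvN f x a : is_derive x 1 f a -> is_derive x 1 (fun y => - f y) (- a).
Proof. by move=> h1; exact: is_deriveN. Qed.

Lemma drvB f g x a b : is_derive x 1 f a -> is_derive x 1 g b ->
  is_derive x 1 (fun y => f y - g y) (a - b).
Proof. by move=> h1 h2; exact: is_deriveB. Qed.

Lemma drvM f g x a b : is_derive x 1 f a -> is_derive x 1 g b ->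
  is_derive x 1 (fun y => f y * g y) (a * g x + f x * b).
Proof.
move=> h1 h2; apply: (drv_eq (is_deriveM h1 h2)).
by rewrite addrC; congr (_ + _); rewrite [LHS]mulrC.
Qed.

Lemma drvZ c f x a : is_derive x 1 f a -> is_derive x 1 (fun y => c * f y) (c * a).
Proof. by move=> h; apply: drv_eq (drvM (drv_cst c x) h) _; rewrite mul0r add0r. Qed.

Lemma drvX n f x a : is_derive x 1 f a ->
  is_derive x 1 (fun y => f y ^+ n) (n%:R * f x ^+ n.-1 * a).
Proof.
move=> h; elim: n => [|n IH]; first by rewrite !mul0r; exact: drv_cst.
apply: (eq_drv (f := fun y => f y * f y ^+ n)) => [y|]; first by rewrite exprS.
apply: drv_eq (drvM h IH) _.
case: n {IH} => [|n] /=; first by rewrite !mul0r mulr0 expr0 addr0 mulr1 !mul1r.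
by rewrite exprS -natr1; ring.
Qed.

Lemma drv_comp f g x a b : is_derive (g x) 1 f a -> is_derive x 1 g b ->
  is_derive x 1 (fun y => f (g y)) (a * b).
Proof. by move=> h1 h2; exact: is_derive1_comp. Qed.

Lemma drv_expR f x a : is_derive x 1 f a ->
  is_derive x 1 (fun y => expR (f y)) (expR (f x) * a).
Proof. exact: drv_comp. Qed.

Lemma drv_cos f x a : is_derive x 1 f a ->
  is_derive x 1 (fun y => cos (f y)) (- sin (f x) * a).
Proof. exact: drv_comp. Qed.

Lemma drv_sin f x a : is_derive x 1 f a ->
  is_derive x 1 (fun y => sin (f y)) (cos (f x) * a).
Proof. exact: drv_comp. Qed.

Lemma drv_continuous f x a : is_derive x 1 f a -> {for x, continuous f}.
Proof.
by move=> h; apply: differentiable_continuous; apply/derivable1_diffP; case: h.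
Qed.

Lemma drv_within f (A : set R) (f' : R -> R) :
  (forall x, A x -> is_derive x 1 f (f' x)) -> {within A, continuous f}.
Proof.
move=> h; apply: continuous_in_subspaceT => x /set_mem Ax.
exact: drv_continuous (h x Ax).
Qed.

Lemma drv_MVT f (f' : R -> R) a b : a <= b ->
  (forall x, a <= x <= b -> is_derive x 1 f (f' x)) ->
  exists2 c, a <= c <= b & f b - f a = f' c * (b - a).
Proof.
move=> ab h; have [x||c cab ->] := @MVT_segment R f f' a b ab.
- by rewrite in_itv/= => /andP[/ltW ax /ltW xb]; apply: h; rewrite ax xb.
- by apply: (drv_within (f' := f')) => x /=; rewrite in_itv/=; exact: h.
- by exists c => //; move: cab; rewrite in_itv.
Qed.

Lemma drv_lipschitz f (f' : R -> R) B a b : a <= b ->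
  (forall x, a <= x <= b -> is_derive x 1 f (f' x)) ->
  (forall x, a <= x <= b -> `|f' x| <= B) -> `|f b - f a| <= B * (b - a).
Proof.
move=> ab h hB; have [c cab ->] := drv_MVT ab h.
by rewrite normrM (ger0_norm (x := b - a)) ?subr_ge0// ler_wpM2r ?subr_ge0// hB.
Qed.

Lemma drv0_cst f : (forall x, is_derive x 1 f 0) -> forall x y, f x = f y.
Proof. by move=> h x y; apply: is_derive_0_is_cst. Qed.

Lemma drv_FTC2 F f a b : a < b -> (forall x, is_derive x 1 F (f x)) ->
  continuous f -> (\int[lebesgue_measure]_(x in `[a, b]) (f x)%:E = (F b - F a)%:E)%E.
Proof.
move=> ab h cf; rewrite (@continuous_FTC2 _ f F)//.
- exact: continuous_subspaceT.
- split=> [x _|| ]; first by case: (h x).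
    exact: cvg_at_right_filter (drv_continuous (h a)).
  exact: cvg_at_left_filter (drv_continuous (h b)).
- by move=> x _; rewrite derive1E; case: (h x).
Qed.

End Calculus.

(** * Means of random variables with finite moments *)

Section Mean.
Context {d : measure_display} {T : measurableType d} {R : realType}.
Variable P : probability T R.
Implicit Types (f g : T -> R).

Definition mean f : R := Rintegral P setT f.

(* All moments are finite; these functions form an algebra. *)
Definition tame f : Prop := measurable_fun setT f /\
  forall k : nat, P.-integrable setT (EFin \o (fun w => `|f w| ^+ k)).

Lemma tame_measurable f : tame f -> measurable_fun setT f.
Proof. by case. Qed.

Lemma integrable_dom f g : measurable_fun setT f ->
  (forall w, `|f w| <= g w) -> P.-integrable setT (EFin \o g) ->
  P.-integrable setT (EFin \o f).
Proof.
move=> mf fg ig; apply: (le_integrable _ _ _ ig) => //.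
  exact/measurable_EFinP.
by move=> w _ /=; rewrite lee_fin (le_trans (fg w))// ler_norm.
Qed.

Lemma integrableD_EFin f g : P.-integrable setT (EFin \o f) ->
  P.-integrable setT (EFin \o g) -> P.-integrable setT (EFin \o (fun w => f w + g w)).
Proof. by move=> h1 h2; have := integrableD measurableT h1 h2. Qed.

Lemma integrableZ_EFin c f : P.-integrable setT (EFin \o f) ->
  P.-integrable setT (EFin \o (fun w => c * f w)).
Proof. by move=> h; have := integrableZl measurableT c h. Qed.

Lemma tame_integrable f : tame f -> P.-integrable setT (EFin \o f).
Proof.
by move=> [mf /(_ 1%N) h]; apply: integrable_dom h => // w; rewrite expr1.
Qed.

Lemma eq_tame f g : f =1 g -> tame f -> tame g.
Proof. by move=> /funext ->. Qed.

Lemma tame_le f g : measurable_fun setT f -> (forall w, `|f w| <= `|g w|) ->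
  tame g -> tame f.
Proof.
move=> mf fg [mg tg]; split=> // k; apply: (@integrable_dom _ _ _ _ (tg k)).
  by apply: measurable_funX; exact: measurableT_comp.
by move=> w; rewrite normrX normr_id lerXn2r ?nnegrE.
Qed.

Lemma tame_cst c : tame (fun=> c).
Proof.
split=> [|k]; first exact: measurable_cst.
exact: finite_measure_integrable_cst.
Qed.

Lemma tame_bounded f C : measurable_fun setT f -> (forall w, `|f w| <= C) -> tame f.
Proof.
move=> mf fC; apply: (tame_le mf _ (tame_cst C)) => w.
by rewrite (le_trans (fC w))// ler_norm.
Qed.

Lemma expr_addr_le (x y : R) k : 0 <= x -> 0 <= y ->
  (x + y) ^+ k <= 2 ^+ k * (x ^+ k + y ^+ k).
Proof.
move=> x0 y0; wlog xy : x y x0 y0 / x <= y => [H|].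
  by have [/H->//|/ltW yx] := leP x y; rewrite addrC [X in _ * X]addrC H.
apply: (@le_trans _ _ ((2 * y) ^+ k)).
  by rewrite lerXn2r ?nnegrE ?addr_ge0 ?mulr_ge0//; lra.
by rewrite exprMn ler_wpM2l ?exprn_ge0// lerDr exprn_ge0.
Qed.

Lemma tameD f g : tame f -> tame g -> tame (fun w => f w + g w).
Proof.
move=> [mf tf] [mg tg]; split=> [|k]; first exact: measurable_funD.
apply: (@integrable_dom _ (fun w => 2 ^+ k * (`|f w| ^+ k + `|g w| ^+ k))).
- by apply: measurable_funX; apply: measurableT_comp => //; exact: measurable_funD.
- move=> w; rewrite normrX normr_id; apply: le_trans (expr_addr_le _ _ _) => //.
  by rewrite lerXn2r ?nnegrE ?addr_ge0// ler_normD.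
- by apply: integrableZ_EFin; exact: integrableD_EFin.
Qed.

Lemma tameM f g : tame f -> tame g -> tame (fun w => f w * g w).
Proof.
move=> [mf tf] [mg tg]; split=> [|k]; first exact: measurable_funM.
apply: (@integrable_dom _ (fun w => `|f w| ^+ (k + k) + `|g w| ^+ (k + k))).
- by apply: measurable_funX; apply: measurableT_comp => //; exact: measurable_funM.
- move=> w; rewrite normrX normr_id normrM exprMn !exprD.
  have := sqr_ge0 (`|f w| ^+ k - `|g w| ^+ k).
  have := exprn_ge0 k (normr_ge0 (f w)); have := exprn_ge0 k (normr_ge0 (g w)).
  by nra.
- exact: integrableD_EFin.
Qed.

Lemma tameZ c f : tame f -> tame (fun w => c * f w).
Proof. by move=> tf; apply: tameM => //; exact: tame_cst. Qed.

Lemma tameN f : tame f -> tame (fun w => - f w).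
Proof. by move=> /(tameZ (-1)); apply: eq_tame => w; rewrite mulN1r. Qed.

Lemma tameB f g : tame f -> tame g -> tame (fun w => f w - g w).
Proof. by move=> tf tg; apply: tameD => //; exact: tameN. Qed.

Lemma tameX f k : tame f -> tame (fun w => f w ^+ k).
Proof.
move=> tf; elim: k => [|k IH]; first exact: tame_cst.
by apply: eq_tame (tameM tf IH) => w; rewrite exprS.
Qed.

Lemma tame_norm f : tame f -> tame (fun w => `|f w|).
Proof.
move=> [mf tf]; apply: (@tame_le _ f) => //; first exact: measurableT_comp.
by move=> w; rewrite normr_id.
Qed.

Lemma tame_sum I (r : seq I) (Q : pred I) (F : I -> T -> R) :
  (forall i, tame (F i)) -> tame (fun w => \sum_(i <- r | Q i) F i w).
Proof.
move=> tF; elim: r => [|i r IH].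
  by apply: eq_tame (tame_cst 0) => w; rewrite big_nil.
case: (boolP (Q i)) => Qi; last first.
  by apply: eq_tame IH => w; rewrite big_cons (negbTE Qi).
by apply: eq_tame (tameD (tF i) IH) => w; rewrite big_cons Qi.
Qed.

Lemma tame_cos f : measurable_fun setT f -> tame (fun w => cos (f w)).
Proof.
move=> mf; apply: (@tame_bounded _ 1); last by move=> w; rewrite ler_norml cos_geN1 cos_le1.
apply: (measurableT_comp _ mf); apply: continuous_measurable_fun; exact: continuous_cos.
Qed.

Lemma tame_sin f : measurable_fun setT f -> tame (fun w => sin (f w)).
Proof.
move=> mf; apply: (@tame_bounded _ 1); last by move=> w; rewrite ler_norml sin_geN1 sin_le1.
apply: (measurableT_comp _ mf); apply: continuous_measurable_fun; exact: continuous_sin.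
Qed.

Lemma eq_mean f g : f =1 g -> mean f = mean g.
Proof. by move=> fg; congr mean; exact/funext. Qed.

Lemma mean_cst c : mean (fun=> c) = c.
Proof.
rewrite /mean Rintegral_cst// -[RHS]mulr1; congr (_ * _).
by rewrite -[RHS]/(fine 1%E); congr fine; exact: probability_setT.
Qed.

Lemma meanD f g : tame f -> tame g -> mean (fun w => f w + g w) = mean f + mean g.
Proof. by move=> tf tg; apply: RintegralD => //; exact: tame_integrable. Qed.

Lemma meanB f g : tame f -> tame g -> mean (fun w => f w - g w) = mean f - mean g.
Proof. by move=> tf tg; apply: RintegralB => //; exact: tame_integrable. Qed.

Lemma meanZ c f : tame f -> mean (fun w => c * f w) = c * mean f.
Proof. by move=> tf; apply: RintegralZl => //; exact: tame_integrable. Qed.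

Lemma meanN f : tame f -> mean (fun w => - f w) = - mean f.
Proof.
by move=> tf; rewrite -mulN1r -meanZ//; apply: eq_mean => w; rewrite mulN1r.
Qed.

Lemma mean_sum I (r : seq I) (Q : pred I) (F : I -> T -> R) :
  (forall i, tame (F i)) ->
  mean (fun w => \sum_(i <- r | Q i) F i w) = \sum_(i <- r | Q i) mean (F i).
Proof.
move=> tF; elim: r => [|i r IH].
  by rewrite big_nil -[RHS](mean_cst 0); apply: eq_mean => w; rewrite big_nil.
rewrite big_cons -IH; case: ifPn => Qi; last first.
  by apply: eq_mean => w; rewrite big_cons (negbTE Qi).
rewrite -meanD//; last exact: tame_sum.
by apply: eq_mean => w; rewrite big_cons Qi.
Qed.

Lemma mean_ge0 f : (forall w, 0 <= f w) -> 0 <= mean f.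
Proof. by move=> f0; apply: Rintegral_ge0. Qed.

Lemma le_mean f g : tame f -> tame g -> (forall w, f w <= g w) -> mean f <= mean g.
Proof. by move=> tf tg fg; apply: le_Rintegral => //; exact: tame_integrable. Qed.

Lemma norm_mean_le f g : tame f -> tame g -> (forall w, `|f w| <= g w) ->
  `|mean f| <= mean g.
Proof.
move=> tf tg fg; apply: le_trans (le_normr_Rintegral _ _) _ => //.
  exact: tame_integrable.
by apply: le_mean => //; exact: tame_norm.
Qed.

(** The mean of (t f + u g)^2 is a non-negative quadratic form in (t, u); the inequality says that
    its discriminant is not positive. *)
Lemma mean_CS f g : tame f -> tame g ->
  mean (fun w => f w * g w) ^+ 2 <= mean (fun w => f w ^+ 2) * mean (fun w => g w ^+ 2).
Proof.
move=> tf tg; have tfg := tameM tf tg.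
have tf2 := tameX 2 tf; have tg2 := tameX 2 tg.
have H (t u : R) : 0 <= t ^+ 2 * mean (fun w => f w ^+ 2) +
    2 * t * u * mean (fun w => f w * g w) + u ^+ 2 * mean (fun w => g w ^+ 2).
  rewrite -!meanZ// -!meanD;
    try by do ?[assumption | apply: tameD | apply: tameM | apply: tameX | apply: tame_cst].
  apply: mean_ge0 => w.
  rewrite (_ : _ + _ = (t * f w + u * g w) ^+ 2); last by ring.
  exact: sqr_ge0.
have a0 : 0 <= mean (fun w => f w ^+ 2) by apply: mean_ge0 => w; exact: sqr_ge0.
have b0 : 0 <= mean (fun w => g w ^+ 2) by apply: mean_ge0 => w; exact: sqr_ge0.
move: (mean (fun w => f w ^+ 2)) (mean (fun w => g w ^+ 2)) (mean (fun w => f w * g w)) a0 b0 H.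
move=> a b c a0 b0 H.
have [b1|b1] := eqVneq b 0; first last.
  have b2 : 0 < b by rewrite lt_def b1.
  have := H b (- c); rewrite (_ : _ + _ = b * (a * b - c ^+ 2)); last by ring.
  by rewrite pmulr_rge0// subr_ge0.
(* When [b] is 0 the form is affine in [u]; at this point its value is -(a + 2) c^2, which forces c
   = 0. *)
have := H c (- (a + 1)); rewrite b1 !mulr0 addr0.
rewrite (_ : _ + _ = - ((a + 2) * c ^+ 2)); last by ring.
by rewrite oppr_ge0 pmulr_rle0// ltr_wpDl.
Qed.

Lemma mean_cvg (f_ : nat -> T -> R) f g : (forall n, measurable_fun setT (f_ n)) ->
  measurable_fun setT f -> tame g -> (forall n w, `|f_ n w| <= g w) ->
  (forall w, f_ ^~ w @ \oo --> f w) -> mean (f_ n) @[n --> \oo] --> mean f.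
Proof.
move=> mf_ mf tg fg ff.
have /(_ (fun n => EFin \o f_ n) (EFin \o f) (EFin \o g)) [] :=
    @dominated_convergence _ _ _ P setT measurableT.
- by move=> n; exact/measurable_EFinP.
- exact/measurable_EFinP.
- by apply: aeW => w _; apply: cvg_EFin; [exact: nearW|exact: ff].
- exact: tame_integrable.
- by apply: aeW => w n _ /=; rewrite lee_fin.
move=> i1 _ i2; have i3 : (\int[P]_x (f_ n x)%:E)%E @[n --> \oo] --> (mean f)%:E.
  by rewrite fineK//; exact: integrable_fin_num.
exact: (fine_cvg i3).
Qed.

Lemma mean_derive (F F' : R -> T -> R) g (a : R) : (forall t, tame (F t)) ->
  (forall (t : R) w, is_derive t 1 (F^~ w) (F' t w)) -> tame g ->
  (forall t w, `|F' t w| <= g w) ->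
  is_derive a 1 (fun t => mean (F t)) (mean (F' a)).
Proof.
move=> tF dF tg F'g.
have g0 w : 0 <= g w by exact: le_trans (F'g a w).
(* The bound [g] is uniform in [t], so any neighbourhood of [a] would do. *)
have Ia : `]a - 1, a + 1[%classic a by rewrite /= in_itv/=; apply/andP; split; lra.
have := @cvg_differentiation_under_integral R _ T P F setT measurableT a (a - 1) (a + 1) Ia
 (fun t _ => tame_integrable (tF t)) (fun t w _ _ => @ex_derive _ _ _ _ _ _ _ (dF t w)) g g0 (tame_integrable tg).
have pE t w : partial1of2 F t w = F' t w.
  by rewrite /partial1of2 derive1E (@derive_val _ _ _ _ _ _ _ (dF t w)).
move=> /(_ _)-H.
have {}H : h^-1 *: (mean (F (h + a)) - mean (F a)) @[h --> 0^'] --> mean (F' a).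
  rewrite (_ : mean (F' a) = Rintegral P setT (fun y => partial1of2 F a y)).
    by apply: H => t w _ _; rewrite pE.
  by apply: eq_mean => w; rewrite pE.
have {}H : h^-1 *: (((fun t => mean (F t)) \o shift a) (h *: (1:R)) - mean (F a))
    @[h --> 0^'] --> mean (F' a).
  by under eq_fun do rewrite /= [_ *: 1]mulr1.
split; first by apply/cvg_ex; eexists; exact: H.
exact/cvg_lim.
Qed.

End Mean.

(** * The normal law: density, moments, characteristic function *)

Section Law.
Context {d : measure_display} {T : measurableType d} {R : realType}.
Variables (P : probability T R) (Q : probability (measurableTypeR R) R) (Y : T -> R).
Hypothesis mY : measurable_fun setT Y.
Hypothesis law : forall A : set R, measurable A -> P (Y @^-1` A) = Q A.

Let Y' : {RV P >-> measurableTypeR R} := @mfun_Sub _ _ _ (measurableTypeR R) Y (mem_set mY).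

Let integral_law (f : R -> \bar R) : measurable_fun setT f ->
  (forall x, (0 <= f x)%E) -> (\int[P]_w f (Y w) = \int[Q]_x f x)%E.
Proof.
move=> mf f0; have := @ge0_integral_distribution _ _ _ _ _ _ Y' f mf f0.
move=> <-; rewrite /=.
apply: (@eq_measure_integral _ (measurableTypeR R) R setT Q ).
by move=> A mA _; exact: (law mA).
Qed.

(** The change of variables is available for non-negative integrands; this lemma uses it for |g|^k,
    the next one for the positive and negative parts of [g]. *)
Lemma tame_law (g : R -> R) : tame Q g -> tame P (g \o Y).
Proof.
move=> [mg tg]; split=> [|k]; first exact: measurableT_comp.
apply/integrableP; split.
  apply/measurable_EFinP; apply: measurable_funX; apply: measurableT_comp => //.
  exact: measurableT_comp.
have mk : measurable_fun setT (fun x : R => `|g x| ^+ k).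
  by apply: measurable_funX; exact: measurableT_comp.
rewrite (@integral_law (fun x => `|(`|g x| ^+ k)%:E|)%E)//.
  by case/integrableP : (tg k).
by apply: measurableT_comp => //; exact/measurable_EFinP.
Qed.

Lemma mean_law (g : R -> R) : tame Q g -> mean P (g \o Y) = mean Q g.
Proof.
move=> tg; have [mg _] := tg.
congr fine; rewrite integralE [RHS]integralE; congr (_ - _)%E.
  rewrite -integral_law//; first by apply: eq_integral => w _; rewrite !funeposE.
  by apply: measurable_funepos; exact/measurable_EFinP.
rewrite -integral_law//; first by apply: eq_integral => w _; rewrite !funenegE.
by apply: measurable_funeneg; exact/measurable_EFinP.
Qed.

End Law.

Section Density.
Context {R : realType} (m s : R).
Local Notation mu := (@lebesgue_measure R).

(** The normal law is dominated by Lebesgue measure, and its Radon-Nikodym derivative equals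
    [normal_pdf] almost everywhere because both have the same integral over every measurable set. *)
Lemma ge0_integral_normal_prob (f : R -> \bar R) : measurable_fun setT f ->
  (forall x, (0 <= f x)%E) ->
  (\int[normal_prob m s]_x f x = \int[mu]_x (f x * (normal_pdf m s x)%:E))%E.
Proof.
move=> mf f0; have dom := normal_prob_dominates m s.
rewrite -(Radon_Nikodym_SigmaFinite.change_of_variables dom)//.
have ig := Radon_Nikodym_SigmaFinite.f_integrable dom.
have mpdf : measurable_fun setT (fun x => (normal_pdf m s x)%:E).
  by apply/measurable_EFinP; exact: measurable_normal_pdf.
apply: ae_eq_integral => //.
- by apply: emeasurable_funM => //; exact: (measurable_int _ ig).
- exact: emeasurable_funM.
- apply: ae_eqe_mul2l; apply: integral_ae_eq => // E _ mE.
  by rewrite -Radon_Nikodym_SigmaFinite.f_integral.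
Qed.

End Density.

Section Normal.
Context {R : realType} (m s : R).
Hypothesis s0 : s != 0.
Local Notation mu := (@lebesgue_measure R).
Local Notation N := (normal_prob m s).
Local Notation p := (normal_pdf m s).

Lemma normal_pdf_expE (x : R) :
  p x = (Num.sqrt (s ^+ 2 * pi *+ 2))^-1 * expR (- (x - m) ^+ 2 / (s ^+ 2 *+ 2)).
Proof. by rewrite normal_pdfE. Qed.

Lemma drv_normal_pdf (x : R) : is_derive x 1 p (- (x - m) / s ^+ 2 * p x).
Proof.
apply: (eq_drv (fun y => esym (normal_pdf_expE y))).
have dx : is_derive x (1 : R) (fun y : R => - (y - m) ^+ 2 / (s ^+ 2 *+ 2))
    (- (2%:R * (x - m) ^+ 1 * (1 - 0)) * (s ^+ 2 *+ 2)^-1 + - (x - m) ^+ 2 * 0).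
  apply: drvM.
  apply: drvN; apply: (drvX 2).
apply: drv_eq (drvZ _ (drv_expR dx)) _.
rewrite normal_pdf_expE -(mulr_natl (s ^+ 2) 2); move: (Num.sqrt _)^-1 => c.
by field.
Qed.

Lemma integrable_normal (f : R -> R) : measurable_fun setT f ->
  (\int[N]_x `|f x|%:E < +oo)%E -> mu.-integrable setT (EFin \o (fun x => f x * p x)).
Proof.
move=> mf; rewrite ge0_integral_normal_prob//; last first.
  by apply/measurable_EFinP; exact: measurableT_comp.
move=> h; apply/integrableP; split.
  apply/measurable_EFinP; apply: measurable_funM => //; exact: measurable_normal_pdf.
apply: le_lt_trans h; rewrite le_eqVlt; apply/orP; left; apply/eqP.
apply: eq_integral => x _ /=.
by rewrite normrM (ger0_norm (normal_pdf_ge0 m s x)) EFinM.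
Qed.

Lemma mean_normal (f : R -> R) : tame N f -> mean N f = Rintegral mu setT (fun x => f x * p x).
Proof.
move=> [mf _]; congr fine; rewrite integralE [RHS]integralE.
have p0 := normal_pdf_ge0 m s.
rewrite !ge0_integral_normal_prob//; last 2 first.
- by apply: measurable_funeneg; exact/measurable_EFinP.
- by apply: measurable_funepos; exact/measurable_EFinP.
congr (_ - _)%E; apply: eq_integral => x _.
  by rewrite !funeposE maxe_pMl ?lee_fin ?fin_numE// mul0e.
by rewrite !funenegE EFinM -mulNe maxe_pMl ?lee_fin ?fin_numE// mul0e.
Qed.

Lemma normal_mgf t : (\int[N]_x (expR (t * (x - m)))%:E < +oo)%E.
Proof.
rewrite ge0_integral_normal_prob//; last first.
  apply/measurable_EFinP; apply: measurableT_comp => //; apply: measurable_funM => //.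
  exact: measurable_funB.
(* Completing the square: the exponential shifts the mean of the density to m + s^2 t, up to a
   constant factor. *)
rewrite (_ : (\int[_]_x _ = \int[mu]_x ((expR (s ^+ 2 * t ^+ 2 / 2))%:E *
    (normal_pdf (m + s ^+ 2 * t) s x)%:E))%E); last first.
  apply: eq_integral => x _; rewrite -!EFinM; congr EFin.
  rewrite !normal_pdfE// mulrCA [RHS]mulrCA; congr (_ * _).
  rewrite /normal_fun -!expRD; congr expR; rewrite -(mulr_natl (s ^+ 2) 2).
  by field.
rewrite ge0_integralZl//.
- by rewrite integral_normal_pdf mule1 ltry.
- by apply/measurable_EFinP; exact: measurable_normal_pdf.
- by move=> x _; rewrite lee_fin normal_pdf_ge0.
Qed.

(** |y|^k is at most k! (exp y + exp (-y)), and both exponentials have finite mean. *)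
Lemma tame_normal_center : tame N (fun x => x - m).
Proof.
have mc : measurable_fun setT (fun x : R => x - m) by exact: measurable_funB.
split=> // k; have me (t : R) : N.-integrable setT (EFin \o (fun x => expR (t * (x - m)))).
  apply/integrableP; split.
    by apply/measurable_EFinP; apply: measurableT_comp => //; exact: measurable_funM.
  under eq_integral do rewrite /= ger0_norm ?expR_ge0//.
  exact: normal_mgf.
have h := integrableZ_EFin k`!%:R (integrableD_EFin (me 1) (me (-1))).
apply: integrable_dom h.
- by apply: measurable_funX; exact: measurableT_comp.
- move=> x; rewrite mulN1r mul1r normrX normr_id.
  apply: (@le_trans _ _ (k`!%:R * expR `|x - m|)).
    rewrite mulrC -ler_pdivrMr ?ltr0n ?fact_gt0//.
    case: k => [|k]; first by rewrite expr0 divr1 -expR0 ler_expR.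
    have := expR_ge1Dxn k (normr_ge0 (x - m)); lra.
  rewrite ler_wpM2l//; have := expR_ge0 (x - m); have := expR_ge0 (- (x - m)).
  by case: (ger0P (x - m)) => _; lra.
Qed.

(** Meant for the boundary terms of an integration by parts over [m - (n + 1), m + (n + 1)]. *)
Lemma cvg_normal_tail (c : R) (u v : nat -> R) : 0 <= c ->
  (forall n, `|v n - m| = n.+1%:R) -> (forall n, `|u n| <= c * expR n.+1%:R) ->
  u n * p (v n) @[n --> \oo] --> 0.
Proof.
move=> c0 hv hu; apply/cvgr0Pnorm_le => e e0.
(* With N = n + 1, (N - 2 s^2)^2 >= 0 gives N - N^2 / (2 s^2) <= -N + 2 s^2; this is the origin of
   exp (2 s^2). *)
pose K := c * ((Num.sqrt (s ^+ 2 * pi *+ 2))^-1 * expR (2 * s ^+ 2)).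
have K0 : 0 <= K.
  by rewrite !mulr_ge0 ?invr_ge0 ?sqrtr_ge0 ?expR_ge0.
have cv : K * expR (- n%:R) @[n --> \oo] --> K * 0.
  by apply: cvgMr; exact: cvgn_expR.
rewrite mulr0 in cv; have /cvgr0Pnorm_le/(_ e e0) := cv.
apply: filterS => n; apply: le_trans; rewrite normrM.
rewrite (ger0_norm (normal_pdf_ge0 _ _ _)) (ger0_norm (mulr_ge0 K0 (expR_ge0 _))).
apply: (@le_trans _ _ (c * expR n.+1%:R * p (v n))).
  by rewrite ler_wpM2r ?normal_pdf_ge0.
rewrite normal_pdf_expE -!mulrA ler_wpM2l// mulrCA ler_wpM2l ?invr_ge0 ?sqrtr_ge0//.
rewrite -!expRD ler_expR -(real_normK (num_real (v n - m))) hv.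
have s2 : 0 < s ^+ 2 by rewrite exprn_even_gt0.
have : 0 <= (n.+1%:R - 2 * s ^+ 2) ^+ 2 / (s ^+ 2 *+ 2).
  by rewrite divr_ge0 ?sqr_ge0// mulrn_wge0// ltW.
rewrite -(mulr_natl (s ^+ 2) 2) sqrrB; have -> : (n.+1%:R ^+ 2 - n.+1%:R * (2 * s ^+ 2) *+ 2 + (2 * s ^+ 2) ^+ 2) / (2%:R * s ^+ 2) = n.+1%:R ^+ 2 / (2%:R * s ^+ 2) - 2 * n.+1%:R + 2 * s ^+ 2.
  by field.
rewrite mulNr -(natr1 n); lra.
Qed.

(** The derivative of s^2 g p is h p, so the integral of h p over a growing interval is a boundary
    term. It tends to 0 by the growth condition on [g], and to the mean of [h] by dominated
    convergence. *)
Lemma normal_ibp (g g' : R -> R) (c : R) : 0 <= c -> (forall x : R, is_derive x 1 g (g' x)) ->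
  continuous g' -> (forall x, `|g x| <= c * expR `|x - m|) -> tame N g -> tame N g' ->
  mean N (fun x => (x - m) * g x) = s ^+ 2 * mean N g'.
Proof.
move=> c0 dg cg' gc tg tg'; pose h x := s ^+ 2 * g' x - (x - m) * g x.
have tc := tame_normal_center.
have th : tame N h by rewrite /h; apply: tameB; [exact: tameZ|exact: tameM].
suff h0 : mean N h = 0.
  by apply/eqP; rewrite eq_sym -subr_eq0 -meanZ// -meanB ?h0//; [exact: tameZ|exact: tameM].
have cg : continuous g by move=> x; exact: (drv_continuous (dg x)).
pose H x := s ^+ 2 * g x * p x.
have dH (x : R) : is_derive x 1 H (h x * p x).
  rewrite /H; apply: drv_eq (drvM (drvZ (s ^+ 2) (dg x)) (drv_normal_pdf x)) _.
  by rewrite /h; field.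
have chp : continuous (fun x => h x * p x).
  move=> x; apply: cvgM; last exact: continuous_normal_pdf.
  apply: cvgB; first by apply: cvgM; [exact: cvg_cst|exact: cg'].
  apply: cvgM; last exact: cg.
  by apply: cvgB; [exact: cvg_id|exact: cvg_cst].
have int : mu.-integrable setT (EFin \o (fun x => h x * p x)).
  apply: integrable_normal; first exact: tame_measurable th.
  by have /integrableP[] := tame_integrable th.
rewrite mean_normal//.
pose A n := `[m - n.+1%:R, m + n.+1%:R]%classic.
have FTC n : (\int[mu]_(x in A n) (h x * p x)%:E)%E = (H (m + n.+1%:R) - H (m - n.+1%:R))%:E.
  by apply: drv_FTC2 => //; have := ltr0Sn R n; lra.
have cv1 : (\int[mu]_(x in A n) (h x * p x)%:E)%E @[n --> \oo] -->
    (\int[mu]_x (h x * p x)%:E)%E.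
  under eq_fun do rewrite integral_mkcond.
  have [] // := @dominated_convergence _ _ _ mu setT measurableT
    (fun n => ((fun x => (h x * p x)%:E) \_ (A n))) (fun x => (h x * p x)%:E)
    (fun x => `|(h x * p x)%:E|%E).
  - move=> n; apply/(measurable_restrictT _ _).1; first exact: measurable_itv.
    by apply: measurable_funTS; exact: (measurable_int _ int).
  - exact: (measurable_int _ int).
  - apply: aeW => x _; apply: cvg_near_cst.
    near=> n; rewrite patchE; case: ifPn => //; rewrite notin_setE /A /= in_itv/= => /negP.
    rewrite -ler_distlC distrC; have le1 : `|x - m| <= n%:R by near: n; exact: nbhs_infty_ger.
    by rewrite (le_trans le1)// ler_nat.
  - exact: integrable_abse.
  - apply: aeW => x n _; rewrite patchE; case: ifPn => //= _.
    by rewrite normr0 lee_fin.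
have cv2 : H (m + n.+1%:R) - H (m - n.+1%:R) @[n --> \oo] --> 0 - 0.
  have C0 : 0 <= s ^+ 2 * c by rewrite mulr_ge0 ?sqr_ge0.
  have N1 n : `|m + n.+1%:R - m| = n.+1%:R by rewrite addrAC subrr add0r ger0_norm.
  have N2 n : `|m - n.+1%:R - m| = n.+1%:R by rewrite addrAC subrr add0r normrN ger0_norm.
  by apply: cvgB; apply: (cvg_normal_tail C0) => // n;
    rewrite normrM (ger0_norm (sqr_ge0 s)) -mulrA ler_wpM2l ?sqr_ge0//;
    apply: le_trans (gc _) _; rewrite ?N1 ?N2.
rewrite subr0 in cv2; rewrite /Rintegral.
have cv3 : (\int[mu]_(x in A n) (h x * p x)%:E)%E @[n --> \oo] --> 0%:E.
  have -> : (fun n => (\int[mu]_(x in A n) (h x * p x)%:E)%E) =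
    (fun n => (H (m + n.+1%:R) - H (m - n.+1%:R))%:E) by apply/funext => n; exact: FTC.
  by apply: cvg_EFin; [exact: nearW|exact: cv2].
by rewrite (cvg_unique _ cv1 cv3).
Unshelve. all: by end_near. Qed.

End Normal.

Ltac tame_tac := repeat (first [ assumption | solve [auto] | apply: tame_cst | apply: tameB |
  apply: tameD | apply: tameN | apply: tameM | apply: tameX | apply: tame_norm |
  (apply: tame_sum; intro) ]).

Section NormalMoments.
Context {R : realType} (m s : R).
Hypothesis s0 : s != 0.
Local Notation N := (normal_prob m s).

Lemma exprn_le_expR (y : R) k : 0 <= y -> y ^+ k <= k`!%:R * expR y.
Proof.
move=> y0; rewrite mulrC -ler_pdivrMr ?ltr0n ?fact_gt0//.
case: k => [|k]; first by rewrite expr0 divr1 -expR0 ler_expR.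
have := expR_ge1Dxn k y0; lra.
Qed.

Let tc := tame_normal_center m s0.

Let drvc (x : R) : is_derive x 1 (fun y => y - m) 1.
Proof. by apply: drv_eq (drvB (drv_id x) (drv_cst m x)) _; rewrite subr0. Qed.

(** Integration by parts against (x - m)^k. For k = 0 the factor [k%:R] annihilates the term in
    which [k.-1] is truncated. *)
Lemma normal_moment_rec k :
  mean N (fun x => (x - m) ^+ k.+1) = s ^+ 2 * (k%:R * mean N (fun x => (x - m) ^+ k.-1)).
Proof.
rewrite -meanZ; last exact: tameX.
transitivity (mean N (fun x => (x - m) * (x - m) ^+ k)).
  by apply: eq_mean => x; rewrite exprS.
apply: (@normal_ibp _ m _ s0 (fun x => (x - m) ^+ k) (fun x => k%:R * (x - m) ^+ k.-1) k`!%:R).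
- by [].
- by move=> x; apply: drv_eq (drvX k (drvc x)) _; rewrite mulr1.
- by move=> x; exact: drv_continuous (drvZ k%:R (drvX k.-1 (drvc x))).
- by move=> x; rewrite normrX; exact: exprn_le_expR.
- exact: tameX.
- by apply: tameZ; exact: tameX.
Qed.

Lemma normal_mean : mean N (fun x => x - m) = 0.
Proof.
have := normal_moment_rec 0; rewrite mul0r mulr0 => <-.
by apply: eq_mean => x; rewrite expr1.
Qed.

Lemma normal_moment2 : mean N (fun x => (x - m) ^+ 2) = s ^+ 2.
Proof.
rewrite normal_moment_rec mul1r (_ : mean _ _ = 1) ?mulr1//.
by rewrite -[RHS](mean_cst N).
Qed.

Lemma normal_moment3 : mean N (fun x => (x - m) ^+ 3) = 0.
Proof.
rewrite normal_moment_rec /= (_ : mean _ _ = 0) ?mulr0//.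
by rewrite -[RHS]normal_mean; apply: eq_mean => x; rewrite expr1.
Qed.

Lemma normal_moment4 : mean N (fun x => (x - m) ^+ 4) = 3 * (s ^+ 2) ^+ 2.
Proof. by rewrite normal_moment_rec /= normal_moment2; ring. Qed.

(** Integration by parts shows that psi(t), the mean of cos (t (x - m)), satisfies psi' = - s^2 t
    psi; hence psi(t) exp (s^2 t^2 / 2) is constant. *)
Lemma normal_cos : mean N (fun x => cos (x - m)) = expR (- (s ^+ 2 / 2)).
Proof.
pose psi t := mean N (fun x => cos (t * (x - m))).
have mc t : measurable_fun setT (fun x : R => t * (x - m)).
  by apply: measurable_funM => //; exact: measurable_funB.
have E t : mean N (fun x => (x - m) * sin (t * (x - m))) = s ^+ 2 * (t * psi t).
  rewrite /psi -meanZ; last by apply: tame_cos; exact: mc.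
  apply: (@normal_ibp _ m _ s0 _ _ 1) => //.
  - move=> x; apply: drv_eq (drv_sin (drvZ t (drvc x))) _.
    by rewrite mulr1 mulrC.
  - by move=> x; exact: drv_continuous (drvZ t (drv_cos (drvZ t (drvc x)))).
  - move=> x; rewrite mul1r; apply: (@le_trans _ _ 1); first by rewrite ler_norml sin_geN1 sin_le1.
    by rewrite -expR0 ler_expR.
  - by apply: tame_sin; exact: mc.
  - by apply: tameZ; apply: tame_cos; exact: mc.
have dpsi (t : R) : is_derive t 1 psi (- (s ^+ 2 * (t * psi t))).
  rewrite -E -meanN; last by apply: tameM => //; apply: tame_sin; exact: mc.
  apply: (@mean_derive _ _ _ N (fun t x => cos (t * (x - m))) (fun t x => - ((x - m) * sin (t * (x - m)))) (fun x => `|x - m|)).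
  - by move=> u; apply: tame_cos; exact: mc.
  - move=> u x; apply: drv_eq (drv_cos (drvM (drv_id u) (drv_cst (x - m) u))) _.
    by rewrite mulr0 addr0 mul1r mulNr mulrC.
  - exact: tame_norm.
  - move=> u x; rewrite normrN normrM ler_piMr// ler_norml sin_geN1 sin_le1//.
have d0 (t : R) : is_derive t 1 (fun t => psi t * expR (s ^+ 2 / 2 * t ^+ 2)) 0.
  apply: drv_eq (drvM (dpsi t) (drv_expR (drvZ (s ^+ 2 / 2) (drvX 2 (drv_id t))))) _.
  rewrite expr1; lra.
have := drv0_cst d0 1 0; rewrite expr1n expr0n/= !mulr0 mulr1 expR0 mulr1 => H.
have p0 : psi 0 = 1.
  by rewrite /psi -[RHS](mean_cst N); apply: eq_mean => x; rewrite mul0r cos0.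
have p1 : psi 1 = mean N (fun x => cos (x - m)).
  by apply: eq_mean => x; rewrite mul1r.
have e0 : expR (s ^+ 2 / 2) != 0 by rewrite gt_eqF// expR_gt0.
by rewrite -p1 expRN; apply: (mulIf e0); rewrite mulVf// H p0.
Qed.

End NormalMoments.

Section CenteredGaussian.
Context {d : measure_display} {T : measurableType d} {R : realType}.
Variable P : probability T R.
Implicit Types Y Z : T -> R.

(* What the argument uses of a centered Gaussian law: the moments up to order four
   and, through its rescalings, the characteristic function. *)
Definition cgauss Y : Prop := [/\ tame P Y, mean P Y = 0,
  mean P (fun w => Y w ^+ 3) = 0,
  mean P (fun w => Y w ^+ 4) = 3 * mean P (fun w => Y w ^+ 2) ^+ 2 &
  mean P (fun w => cos (Y w)) = expR (- (mean P (fun w => Y w ^+ 2) / 2))].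

Lemma gaussian_rv_center Z : measurable_fun setT Z -> gaussian_rv P Z ->
  tame P Z /\ cgauss (fun w => Z w - mean P Z).
Proof.
move=> mZ [m [s h]]; have [s0|s0] := eqVneq s 0.
  (* Under a point mass the mean of a function is its value at [m], so every condition is checked by
     evaluation. *)
  pose D : probability (measurableTypeR R) R := @dirac _ (measurableTypeR R) m R.
  have Q (A : set R) : measurable A -> P (Z @^-1` A) = D A.
    by move=> /h; rewrite s0 eqxx.
  have tD (g : R -> R) : measurable_fun setT g -> tame D g.
    move=> mg; split=> // k; apply/integrableP; split.
      by apply/measurable_EFinP; apply: measurable_funX; exact: measurableT_comp.
    rewrite integral_dirac// ?diracT ?mul1e ?ltry//.
    apply: measurableT_comp => //; apply/measurable_EFinP; apply: measurable_funX.
    exact: measurableT_comp.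
  have mD (g : R -> R) : measurable_fun setT g -> mean D g = g m.
    move=> mg; rewrite /mean /Rintegral integral_dirac// ?diracT ?mul1e//.
    exact/measurable_EFinP.
  have L (g : R -> R) : measurable_fun setT g -> mean P (fun w => g (Z w)) = g m.
    by move=> mg; rewrite -mD//; exact: (mean_law mZ Q (tD _ mg)).
  have mid : measurable_fun setT (fun x : R => x) by exact: measurable_id.
  have EZ : mean P Z = m by exact: (L id).
  have mc : measurable_fun setT (fun x : R => x - m) by exact: measurable_funB.
  split; first exact: (tame_law mZ Q (tD _ mid)).
  rewrite EZ; split.
  - exact: (tame_law mZ Q (tD _ mc)).
  - by rewrite (L (fun x => x - m)) ?subrr.
  - by rewrite (L (fun x => (x - m) ^+ 3)) ?subrr ?expr0n//; exact: measurable_funX.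
  - rewrite (L (fun x => (x - m) ^+ 4)); last exact: measurable_funX.
    rewrite (L (fun x => (x - m) ^+ 2)); last exact: measurable_funX.
    by rewrite subrr !expr0n/= mulr0.
  - rewrite (L (fun x => cos (x - m))); last first.
      by apply: measurableT_comp => //; apply: continuous_measurable_fun; exact: continuous_cos.
    rewrite (L (fun x => (x - m) ^+ 2)); last exact: measurable_funX.
    by rewrite subrr expr0n/= mul0r oppr0 expR0 cos0.
have Q (A : set R) : measurable A -> P (Z @^-1` A) = normal_prob m s A.
  by move=> /h; rewrite (negbTE s0).
have tc := tame_normal_center m s0.
have tid : tame (normal_prob m s) (fun x => x).
  by apply: eq_tame (tameD tc (tame_cst _ m)) => x; rewrite subrK.
have EZ : mean P Z = m.
  rewrite (mean_law mZ Q tid); apply/eqP; rewrite -subr_eq0 -[X in _ - X](mean_cst (normal_prob m s)).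
  by rewrite -meanB//; [rewrite normal_mean|exact: tame_cst].
split; first exact: (tame_law mZ Q tid).
have L (g : R -> R) : tame (normal_prob m s) g -> mean P (fun w => g (Z w)) = mean (normal_prob m s) g.
  by move=> tg; exact: (mean_law mZ Q tg).
rewrite EZ; split.
- exact: (tame_law mZ Q tc).
- by rewrite (L (fun x => x - m))// normal_mean.
- by rewrite (L (fun x => (x - m) ^+ 3)) ?normal_moment3//; exact: tameX.
- by rewrite (L (fun x => (x - m) ^+ 4)) ?normal_moment4// ?(L (fun x => (x - m) ^+ 2)) ?normal_moment2//; exact: tameX.
- rewrite (L (fun x => cos (x - m))) ?normal_cos//; last exact: tame_cos (tame_measurable tc).
  by rewrite (L (fun x => (x - m) ^+ 2)) ?normal_moment2//; exact: tameX.
Qed.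

End CenteredGaussian.

(** * Taylor bounds and limits of powers of cosines *)

Section Taylor.
Context {R : realType}.
Implicit Types (g : nat -> R -> R).

Lemma drv_sum n (f : nat -> R -> R) (x : R) (f' : nat -> R) :
  (forall k, (k < n)%N -> is_derive x 1 (f k) (f' k)) ->
  is_derive x 1 (fun y => \sum_(k < n) f k y) (\sum_(k < n) f' k).
Proof.
elim: n => [|n IH] h.
  by rewrite big_ord0; apply: (eq_drv _ (drv_cst 0 x)) => y; rewrite big_ord0.
rewrite big_ord_recr /=.
apply: (eq_drv (f := fun y => \sum_(k < n) f k y + f n y)) => [y|].
  by rewrite big_ord_recr.
by apply: (drvD (IH _) (h n (ltnSn n))) => k kn; apply: h; rewrite ltnS ltnW.
Qed.

(** Induction on [p]: the remainder of order p + 1 has as derivative the remainder of order p of the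
    shifted family, and the mean value inequality transfers the bound. The factor 1 / p! is given
    up. The derivatives form an explicit family [g], so that differentiability is required on
    [lo, hi] only. *)
Lemma taylor_bound p g (lo hi B x y : R) :
  (forall k z, (k < p)%N -> lo <= z <= hi -> is_derive z 1 (g k) (g k.+1 z)) ->
  (forall z, lo <= z <= hi -> `|g p z| <= B) ->
  lo <= x <= hi -> lo <= y <= hi ->
  `|g 0%N y - \sum_(k < p) g k x * (y - x) ^+ k / k`!%:R| <= B * `|y - x| ^+ p.
Proof.
elim: p g y => [|p IH] g y dg gB xI yI.
  by rewrite big_ord0 subr0 expr0 mulr1; exact: gB.
pose u z := g 0%N z - \sum_(k < p.+1) g k x * (z - x) ^+ k / k`!%:R.
pose u' z := g 1%N z - \sum_(k < p) g k.+1 x * (z - x) ^+ k / k`!%:R.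
have du z : lo <= z <= hi -> is_derive z 1 u (u' z).
  move=> zI; apply: (drvB (dg 0%N z (ltn0Sn p) zI)).
  rewrite (_ : \sum_(k < p) _ = \sum_(k < p.+1) (g k x * (k%:R * (z - x) ^+ k.-1) / k`!%:R)); last first.
    rewrite big_ord_recl /= mul0r mulr0 mul0r add0r; apply: eq_bigr => k _.
    rewrite /bump/= add1n factS natrM invfM -!mulrA; congr (_ * _).
    by rewrite [RHS]mulrCA; congr (_ * _); rewrite mulrA divff ?mul1r// pnatr_eq0.
  apply: (@drv_sum p.+1 (fun k z => g k x * (z - x) ^+ k / k`!%:R) z
    (fun k => g k x * (k%:R * (z - x) ^+ k.-1) / k`!%:R)) => k _.
  have dz : is_derive z 1 (fun y => y - x) 1.
    by apply: drv_eq (drvB (drv_id z) (drv_cst x z)) _; rewrite subr0.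
  apply: drv_eq (drvM (drvZ (g k x) (drvX k dz)) (drv_cst k`!%:R^-1 z)) _.
  by rewrite mulr0 addr0 mulr1.
have u'B z : lo <= z <= hi -> `|u' z| <= B * `|z - x| ^+ p.
  by move=> zI; apply: (IH (fun k => g k.+1)) => // k t kp; exact: dg.
have ux : u x = 0.
  rewrite /u big_ord_recl/= expr0 fact0 mulr1 divr1 big1; first by rewrite addr0 subrr.
  by move=> k _; rewrite subrr expr0n/= mulr0 mul0r.
have B0 : 0 <= B by exact: le_trans (gB x xI).
rewrite -/(u y) -[u y]subr0 -ux exprSr mulrA.
case/andP : xI => lx xh; case/andP : yI => ly yh.
have [xy|/ltW yx] := leP x y.
  rewrite (ger0_norm (x := y - x)) ?subr_ge0//; apply: (@drv_lipschitz _ _ u') => // z /andP[xz zy].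
    by apply: du; rewrite (le_trans lx)//= (le_trans zy).
  apply: le_trans (u'B _ _) _; first by rewrite (le_trans lx)//= (le_trans zy).
  by rewrite ler_wpM2l// lerXn2r ?nnegrE ?subr_ge0// ger0_norm ?subr_ge0// lerB.
rewrite distrC [in `|y - x|]distrC (ger0_norm (x := x - y)) ?subr_ge0//.
apply: (@drv_lipschitz _ _ u') => // z /andP[yz zx].
  by apply: du; rewrite (le_trans ly)//= (le_trans zx).
apply: le_trans (u'B _ _) _; first by rewrite (le_trans ly)//= (le_trans zx).
by rewrite ler_wpM2l// lerXn2r ?nnegrE ?subr_ge0// distrC ger0_norm ?subr_ge0// lerB.
Qed.

Lemma cos_taylor (t : R) : `|cos t - 1 + t ^+ 2 / 2| <= `|t| ^+ 3.
Proof.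
pose g k : R -> R := match k with 0%N => cos | 1%N => fun x => - sin x
  | 2%N => fun x => - cos x | _ => sin end.
have := @taylor_bound 3 g (- `|t|) `|t| 1 0 t.
rewrite !big_ord_recl big_ord0 /= /bump /= !subr0 cos0 sin0 !expr0 !factS !fact0.
rewrite oppr0 !mul0r mul1r (_ : _ - _ = cos t - 1 + t ^+ 2 / 2); last first.
  by rewrite addr0 add0r invr1 -mulN1r; field.
move=> H; rewrite -[leRHS]mul1r; apply: H.
- move=> [|[|[|//]]] z _ _ /=; first by apply: drv_eq (drv_cos (drv_id z)) _; rewrite mulr1.
    by apply: drv_eq (drvN (drv_sin (drv_id z))) _; rewrite mulr1.
  by apply: drv_eq (drvN (drv_cos (drv_id z))) _; rewrite mulr1 opprK.
- by move=> z _; rewrite ler_norml sin_geN1 sin_le1.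
- by rewrite oppr_le0 normr_ge0.
- by rewrite -ler_norml.
Qed.

Lemma sin_taylor (t : R) : `|sin t - t| <= `|t| ^+ 2.
Proof.
pose g k : R -> R := match k with 0%N => sin | 1%N => cos | _ => fun x => - sin x end.
have := @taylor_bound 2 g (- `|t|) `|t| 1 0 t.
rewrite !big_ord_recl big_ord0 /= /bump /= !subr0 cos0 sin0 !expr0 !factS !fact0.
rewrite !mul0r !mul1r addr0 add0r invr1 mulr1 expr1 => H.
apply: H.
- move=> [|[|//]] z _ _ /=; first by apply: drv_eq (drv_sin (drv_id z)) _; rewrite mulr1.
  by apply: drv_eq (drv_cos (drv_id z)) _; rewrite mulr1.
- by move=> z _; rewrite normrN ler_norml sin_geN1 sin_le1.
- by rewrite oppr_le0 normr_ge0.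
- by rewrite -ler_norml.
Qed.

Lemma expRN_taylor (t : R) : 0 <= t -> `|expR (- t) - 1 + t| <= t ^+ 2.
Proof.
move=> t0; pose g k (x : R) : R := (-1) ^+ k * expR (- x).
have := @taylor_bound 2 g 0 t 1 0 t.
rewrite !big_ord_recl big_ord0 /= /bump /= /g !subr0 !expr0 !factS !fact0 oppr0 expR0.
rewrite (_ : _ - _ = expR (- t) - 1 + t); last by rewrite !addn0 !muln1 invr1 !expr1; ring.
rewrite mul1r (ger0_norm t0) => H; apply: H.
- move=> k z _ _; apply: drv_eq (drvZ _ (drv_expR (drvN (drv_id z)))) _.
  by rewrite exprS mulrN1 mulrN mulN1r mulNr.
- move=> z /andP[z0 _]; rewrite normrM normrX normrN1 expr1n mul1r ger0_norm ?expR_ge0//.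
  by rewrite -[leRHS]expR0 ler_expR oppr_le0.
- by rewrite lexx.
- by rewrite t0 lexx.
Qed.

Lemma exprB_le n (a b : R) : `|a| <= 1 -> `|b| <= 1 ->
  `|a ^+ n - b ^+ n| <= n%:R * `|a - b|.
Proof.
move=> a1 b1; elim: n => [|n IH]; first by rewrite !expr0 subrr normr0 mul0r.
rewrite (_ : _ - _ = a * (a ^+ n - b ^+ n) + (a - b) * b ^+ n); last by rewrite !exprS; ring.
apply: le_trans (ler_normD _ _) _; rewrite -[n.+1]addn1 natrD [leRHS]mulrDl mul1r; apply: lerD.
  by rewrite normrM; apply: le_trans IH; rewrite ler_piMl.
by rewrite normrM ler_piMr// normrX exprn_ile1.
Qed.

Lemma eq_cvgn (u v : nat -> R) (l : R) : u =1 v ->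
  u n @[n --> \oo] --> l -> v n @[n --> \oo] --> l.
Proof. by move=> /funext ->. Qed.

Lemma cvg_le_invn (u : nat -> R) (l c : R) :
  (forall n, `|u n - l| <= c / n.+1%:R) -> u n @[n --> \oo] --> l.
Proof.
move=> h; apply/cvgrPdist_le => e e0.
have cv : c * n.+1%:R^-1 @[n --> \oo] --> c * (0 : R).
  by apply: cvgMr; exact: cvg_harmonic.
rewrite mulr0 in cv; have /cvgr0Pnorm_le/(_ e e0) := cv.
by apply: filterS => n; apply: le_trans; rewrite distrC (le_trans (h n))// ler_norm.
Qed.

(** With N = n + 1, both sides are powers of exponent N^2 of numbers in [-1, 1] that differ by
    O(N^-3). *)
Lemma cvg_cos_pow (y : R) :
  cos (y / n.+1%:R) ^+ (n.+1 ^ 2) @[n --> \oo] --> expR (- (y ^+ 2 / 2)).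
Proof.
apply: (@cvg_le_invn _ _ (`|y| ^+ 3 + y ^+ 4)) => n.
set N : R := n.+1%:R; have N0 : 0 < N by rewrite ltr0n.
have N1 : 1 <= N by rewrite ler1n.
pose t := y / N; have t2 : 0 <= t ^+ 2 / 2 by rewrite divr_ge0 ?sqr_ge0.
have -> : expR (- (y ^+ 2 / 2)) = expR (- (t ^+ 2 / 2)) ^+ (n.+1 ^ 2).
  rewrite -expRM_natl; congr expR; rewrite /t natrX -/N; field; exact: lt0r_neq0.
apply: le_trans (exprB_le _ _ _) _.
- by rewrite ler_norml cos_geN1 cos_le1.
- by rewrite ger0_norm ?expR_ge0// -[leRHS]expR0 ler_expR oppr_le0.
rewrite natrX -/N -/t.
have H : `|cos t - expR (- (t ^+ 2 / 2))| <= `|t| ^+ 3 + t ^+ 4.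
  rewrite (_ : _ - _ = (cos t - 1 + t ^+ 2 / 2) - (expR (- (t ^+ 2 / 2)) - 1 + t ^+ 2 / 2)); last by ring.
  apply: le_trans (ler_normB _ _) _; apply: lerD; first exact: cos_taylor.
  apply: le_trans (expRN_taylor t2) _; rewrite exprMn -exprM ler_piMr//.
    by rewrite exprn_even_ge0.
  by rewrite exprn_ile1// invf_le1// ler1n.
apply: le_trans (ler_wpM2l _ H) _; first exact: sqr_ge0.
have y4 : 0 <= y ^+ 4 by rewrite exprn_even_ge0.
rewrite /t normrM normfV (gtr0_norm N0) !exprMn !exprVn mulrDr mulrDl; apply: lerD.
  by rewrite le_eqVlt; apply/orP; left; apply/eqP; field; exact: lt0r_neq0.
rewrite (_ : N ^+ 2 * _ = y ^+ 4 / N * N^-1); last by field; exact: lt0r_neq0.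
by rewrite ler_piMr ?divr_ge0 ?(ltW N0)// invf_le1.
Qed.

Lemma cvg_sin_mul (y : R) : n.+1%:R * sin (y / n.+1%:R) @[n --> \oo] --> y.
Proof.
apply: (@cvg_le_invn _ _ (`|y| ^+ 2)) => n.
set N : R := n.+1%:R; have N0 : 0 < N by rewrite ltr0n.
rewrite (_ : _ - _ = N * (sin (y / N) - y / N)); last by field; exact: lt0r_neq0.
rewrite normrM (gtr0_norm N0); apply: le_trans (ler_wpM2l (ltW N0) (sin_taylor _)) _.
rewrite normrM normfV (gtr0_norm N0) exprMn exprVn le_eqVlt; apply/orP; left; apply/eqP; field.
exact: lt0r_neq0.
Qed.

Lemma cvg_cos_one (y : R) : cos (y / n.+1%:R) @[n --> \oo] --> (1 : R).
Proof.
rewrite -[X in _ --> X]cos0; apply: continuous_cvg; first exact: continuous_cos.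
have : y * n.+1%:R^-1 @[n --> \oo] --> y * (0 : R).
  by apply: cvgMr; exact: cvg_harmonic.
by rewrite mulr0.
Qed.

(** Tangents arise as logarithmic derivatives of cosines in [dcos_prodE]. *)
Lemma cvg_tan_mul (y : R) : n.+1%:R * tan (y / n.+1%:R) @[n --> \oo] --> y.
Proof.
have H : n.+1%:R * sin (y / n.+1%:R) * (cos (y / n.+1%:R))^-1 @[n --> \oo] --> y * 1^-1.
  by apply: cvgM; [exact: cvg_sin_mul|apply: cvgV; [exact: oner_neq0|exact: cvg_cos_one]].
by rewrite invr1 mulr1 in H; apply: eq_cvgn H => n; rewrite -mulrA.
Qed.

Lemma normr_sin_le (x : R) : `|sin x| <= `|x|.
Proof.
wlog x0 : x / 0 <= x => [H|].
  have [/H//|/ltW x0] := leP 0 x.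
  by have := H (- x); rewrite oppr_ge0 sinN !normrN; exact.
have := @drv_lipschitz _ (@sin R) cos 1 0 x x0.
rewrite sin0 !subr0 mul1r (ger0_norm x0); apply=> // z _.
by rewrite ler_norml cos_geN1 cos_le1.
Qed.

End Taylor.

(** * Gaussian integration by parts *)

Section GaussianSpace.
Context {d : measure_display} {T : measurableType d} {R : realType}.
Variable P : probability T R.
Implicit Types (Y Z U : T -> R).

Definition cov Y Z : R := mean P (fun w => Y w * Z w).

(** A linear space of centered Gaussian variables. Stability under combinations plays the part of
    joint normality, without any joint law. *)
Definition gspace (H : set (T -> R)) : Prop :=
  (forall Y, H Y -> cgauss P Y) /\
  (forall (a b : R) Y Z, H Y -> H Z -> H (fun w => a * Y w + b * Z w)).

Lemma covC Y Z : cov Y Z = cov Z Y.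
Proof. by apply: eq_mean => w; rewrite mulrC. Qed.

Variable H : set (T -> R).
Hypothesis gH : gspace H.

Lemma gspace_tame Y : H Y -> tame P Y.
Proof. by case: gH => h _ /h []. Qed.

Lemma gspaceD Y Z : H Y -> H Z -> H (fun w => Y w + Z w).
Proof.
case: gH => _ h HY HZ; have := h 1 1 _ _ HY HZ.
by congr H; apply/funext => w; rewrite !mul1r.
Qed.

Lemma gspaceZ c Y : H Y -> H (fun w => c * Y w).
Proof.
case: gH => _ h HY; have := h c 0 _ _ HY HY.
by congr H; apply/funext => w; rewrite mul0r addr0.
Qed.

Lemma gspaceB Y Z : H Y -> H Z -> H (fun w => Y w - Z w).
Proof.
move=> HY HZ; have := gspaceD HY (gspaceZ (-1) HZ).
by congr H; apply/funext => w; rewrite mulN1r.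
Qed.

Lemma gspace_mean Y : H Y -> mean P Y = 0.
Proof. by case: gH => h _ /h []. Qed.

(** Polarization of the vanishing third moment: (Y + Z)^3 - (Y - Z)^3 = 6 Y^2 Z + 2 Z^3. *)
Lemma gspace_mean3 Y Z : H Y -> H Z -> mean P (fun w => Y w ^+ 2 * Z w) = 0.
Proof.
move=> HY HZ; have tY := gspace_tame HY; have tZ := gspace_tame HZ.
have E3 U : H U -> mean P (fun w => U w ^+ 3) = 0 by case: gH => h _ /h [].
have h : 6 * mean P (fun w => Y w ^+ 2 * Z w) = mean P (fun w => (Y w + Z w) ^+ 3) -
   mean P (fun w => (Y w - Z w) ^+ 3) - 2 * mean P (fun w => Z w ^+ 3).
  rewrite -!meanZ -?meanB; try by tame_tac.
  by apply: eq_mean => w; ring.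
move: h; rewrite (E3 _ (gspaceD HY HZ)) (E3 _ (gspaceB HY HZ)) (E3 _ HZ); lra.
Qed.

(** Wick's formula, by polarization of the fourth moment. Summing e2 e3 e4 (Y1 + e2 Y2 + e3 Y3 + e4
    Y4)^4 over the eight choices of signs leaves 8 * 24 = 192 times the product. *)
Lemma gspace_mean4 Y1 Y2 Y3 Y4 : H Y1 -> H Y2 -> H Y3 -> H Y4 ->
  mean P (fun w => Y1 w * Y2 w * (Y3 w * Y4 w)) =
  cov Y1 Y2 * cov Y3 Y4 + cov Y1 Y3 * cov Y2 Y4 + cov Y1 Y4 * cov Y2 Y3.
Proof.
move=> H1 H2 H3 H4.
have t1 := gspace_tame H1; have t2 := gspace_tame H2.
have t3 := gspace_tame H3; have t4 := gspace_tame H4.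
pose L (e2 e3 e4 : R) w := Y1 w + e2 * Y2 w + (e3 * Y3 w + e4 * Y4 w).
have HL e2 e3 e4 : H (L e2 e3 e4).
  apply: gspaceD; first by apply: gspaceD => //; exact: gspaceZ.
  by apply: gspaceD; exact: gspaceZ.
have tL e2 e3 e4 := gspace_tame (HL e2 e3 e4).
have E4 e2 e3 e4 : mean P (fun w => L e2 e3 e4 w ^+ 4) =
   3 * (cov Y1 Y1 + e2 ^+ 2 * cov Y2 Y2 + e3 ^+ 2 * cov Y3 Y3 + e4 ^+ 2 * cov Y4 Y4
     + 2 * e2 * cov Y1 Y2 + 2 * e3 * cov Y1 Y3 + 2 * e4 * cov Y1 Y4
     + 2 * e2 * e3 * cov Y2 Y3 + 2 * e2 * e4 * cov Y2 Y4 + 2 * e3 * e4 * cov Y3 Y4) ^+ 2.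
  have -> : mean P (fun w => L e2 e3 e4 w ^+ 4) = 3 * mean P (fun w => L e2 e3 e4 w ^+ 2) ^+ 2.
    by have [_ _ _ ->] := gH.1 _ (HL e2 e3 e4).
  congr (3 * _ ^+ 2); rewrite /cov -!meanZ -?meanD; try by tame_tac.
  by apply: eq_mean => w; rewrite /L; ring.
have h : 192 * mean P (fun w => Y1 w * Y2 w * (Y3 w * Y4 w)) =
    mean P (fun w => L 1 1 1 w ^+ 4) - mean P (fun w => L 1 1 (-1) w ^+ 4)
    - mean P (fun w => L 1 (-1) 1 w ^+ 4) + mean P (fun w => L 1 (-1) (-1) w ^+ 4)
    - mean P (fun w => L (-1) 1 1 w ^+ 4) + mean P (fun w => L (-1) 1 (-1) w ^+ 4)
    + mean P (fun w => L (-1) (-1) 1 w ^+ 4) - mean P (fun w => L (-1) (-1) (-1) w ^+ 4).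
  have t e2 e3 e4 : tame P (fun w => L e2 e3 e4 w ^+ 4) by exact: tameX.
  rewrite -meanZ; last by tame_tac.
  rewrite -![mean P _ - _]meanB -?meanD -?meanB -?meanD -?meanB; try by tame_tac.
  by apply: eq_mean => w; rewrite /L; ring.
move: h; rewrite !E4 => h.
have n0 : (192 : R) != 0 by rewrite pnatr_eq0.
apply: (mulfI n0); rewrite h; ring.
Qed.

Lemma gspace_cos Z : H Z -> mean P (fun w => cos (Z w)) = expR (- (cov Z Z / 2)).
Proof. by move=> HZ; have [_ _ _ _ ->] := gH.1 _ HZ. Qed.

(** Both sides come from the derivative at t = 0 of E cos(Z + tY), computed under the mean and on
    the explicit characteristic function. *)
Lemma gspace_sin Y Z : H Y -> H Z ->
  mean P (fun w => Y w * sin (Z w)) = cov Y Z * mean P (fun w => cos (Z w)).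
Proof.
move=> HY HZ; have tY := gspace_tame HY; have tZ := gspace_tame HZ.
pose F (t : R) w := cos (Z w + t * Y w); pose F' (t : R) w := - (Y w * sin (Z w + t * Y w)).
have HF t : H (fun w => Z w + t * Y w) by apply: gspaceD => //; exact: gspaceZ.
have d1 : is_derive (0 : R) 1 (fun t => mean P (F t)) (mean P (F' 0)).
  apply: (@mean_derive _ _ _ P F F' (fun w => `|Y w|)) => //.
  - by move=> t; apply: tame_cos; exact: tame_measurable (gspace_tame (HF t)).
  - move=> t w; apply: drv_eq (drv_cos (drvD (drv_cst (Z w) t) (drvM (drv_id t) (drv_cst (Y w) t)))) _.
    by rewrite /F'; ring.
  - exact: tame_norm.
  - by move=> t w; rewrite /F' normrN normrM ler_piMr// ler_norml sin_geN1 sin_le1.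
have d2 : is_derive (0 : R) 1 (fun t => mean P (F t)) (expR (- (cov Z Z / 2)) * - cov Y Z).
  have E t : expR (- ((cov Z Z + 2 * t * cov Y Z + t ^+ 2 * cov Y Y) / 2)) = mean P (F t).
    rewrite /F gspace_cos//; congr (expR (- (_ / 2))).
    rewrite /cov -!meanZ -?meanD; try by tame_tac.
    by apply: eq_mean => w; ring.
  apply: (eq_drv E).
  have dq : is_derive (0:R) 1 (fun t : R => - ((cov Z Z + 2 * t * cov Y Z + t ^+ 2 * cov Y Y) / 2)) (- cov Y Z).
    apply: drv_eq (drvN (drvM (drvD (drvD (drv_cst (cov Z Z) 0) (drvM (drvZ 2 (drv_id 0)) (drv_cst (cov Y Z) 0))) (drvM (drvX 2 (drv_id 0)) (drv_cst (cov Y Y) 0))) (drv_cst 2^-1 0))) _.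
    by rewrite expr1; field.
  apply: drv_eq (drv_expR dq) _; congr (expR (- (_ / 2)) * _).
  by rewrite mulr0 mul0r expr0n/= mul0r !addr0.
have := etrans (esym (@derive_val _ _ _ _ _ _ _ d1)) (@derive_val _ _ _ _ _ _ _ d2).
rewrite /F' meanN; last first.
  apply: tameM => //; apply: tame_sin; exact: tame_measurable (gspace_tame (HF 0)).
rewrite mulrN => /oppr_inj; rewrite gspace_cos// mulrC => <-.
by apply: eq_mean => w; rewrite mul0r addr0.
Qed.

(** The previous identity, applied to Z + tY and differentiated at t = 0. *)
Lemma gspace_sqr_cos Y Z : H Y -> H Z ->
  mean P (fun w => Y w ^+ 2 * cos (Z w)) =
  cov Y Y * mean P (fun w => cos (Z w)) - cov Y Z * mean P (fun w => Y w * sin (Z w)).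
Proof.
move=> HY HZ; have tY := gspace_tame HY; have tZ := gspace_tame HZ.
have HF t : H (fun w => Z w + t * Y w) by apply: gspaceD => //; exact: gspaceZ.
have mF t := tame_measurable (gspace_tame (HF t)).
have d1 : is_derive (0 : R) 1 (fun t => mean P (fun w => Y w * sin (Z w + t * Y w)))
    (mean P (fun w => Y w ^+ 2 * cos (Z w + 0 * Y w))).
  apply: (@mean_derive _ _ _ P (fun t w => Y w * sin (Z w + t * Y w)) (fun t w => Y w ^+ 2 * cos (Z w + t * Y w)) (fun w => `|Y w ^+ 2|)) => //.
  - by move=> t; apply: tameM => //; exact: tame_sin.
  - move=> t w; apply: drv_eq (drvZ (Y w) (drv_sin (drvD (drv_cst (Z w) t) (drvM (drv_id t) (drv_cst (Y w) t))))) _.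
    by ring.
  - by apply: tame_norm; exact: tameX.
  - by move=> t w; rewrite normrM ler_piMr// ler_norml cos_geN1 cos_le1.
have d2 : is_derive (0 : R) 1 (fun t => mean P (fun w => cos (Z w + t * Y w)))
    (mean P (fun w => - (Y w * sin (Z w + 0 * Y w)))).
  apply: (@mean_derive _ _ _ P (fun t w => cos (Z w + t * Y w)) (fun t w => - (Y w * sin (Z w + t * Y w))) (fun w => `|Y w|)) => //.
  - by move=> t; exact: tame_cos.
  - move=> t w; apply: drv_eq (drv_cos (drvD (drv_cst (Z w) t) (drvM (drv_id t) (drv_cst (Y w) t)))) _.
    by ring.
  - exact: tame_norm.
  - by move=> t w; rewrite normrN normrM ler_piMr// ler_norml sin_geN1 sin_le1.
have d3 := drvM (drvD (drv_cst (cov Y Z) 0) (drvM (drv_id 0) (drv_cst (cov Y Y) 0))) d2.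
have E t : (cov Y Z + t * cov Y Y) * mean P (fun w => cos (Z w + t * Y w)) =
    mean P (fun w => Y w * sin (Z w + t * Y w)).
  rewrite gspace_sin//; congr (_ * _).
  rewrite /cov -!meanZ -?meanD; try by tame_tac.
  by apply: eq_mean => w; ring.
have d4 := eq_drv E d3.
have := etrans (esym (@derive_val _ _ _ _ _ _ _ d1)) (@derive_val _ _ _ _ _ _ _ d4).
have simp f : (fun w => f (Z w + 0 * Y w)) = (fun w => f (Z w) : R).
  by apply/funext => w; rewrite mul0r addr0.
rewrite (_ : (fun w => Y w ^+ 2 * cos (Z w + 0 * Y w)) = (fun w => Y w ^+ 2 * cos (Z w))); last first.
  by apply/funext => w; rewrite mul0r addr0.
rewrite (_ : (fun w => - (Y w * sin (Z w + 0 * Y w))) = (fun w => - (Y w * sin (Z w)))); last first.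
  by apply/funext => w; rewrite mul0r addr0.
rewrite simp => ->; rewrite meanN; last by apply: tameM => //; apply: tame_sin; exact: (tame_measurable tZ).
by ring.
Qed.

End GaussianSpace.

Lemma cvg_prod_seq {R : realType} (I : Type) (r : seq I) (u : I -> nat -> R) (l : I -> R) :
  (forall i, u i n @[n --> \oo] --> l i) ->
  \prod_(i <- r) u i n @[n --> \oo] --> \prod_(i <- r) l i.
Proof.
move=> h; elim: r => [|i r IH].
  by rewrite big_nil; apply: (@eq_cvgn _ (fun=> 1)) => [n|]; [rewrite big_nil|exact: cvg_cst].
rewrite big_cons; apply: (@eq_cvgn _ (fun n => u i n * \prod_(i <- r) u i n)) => [n|].
  by rewrite big_cons.
exact: cvgM.
Qed.

Lemma cvg_sum_seq {R : realType} (I : Type) (r : seq I) (u : I -> nat -> R) (l : I -> R) :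
  (forall i, u i n @[n --> \oo] --> l i) ->
  \sum_(i <- r) u i n @[n --> \oo] --> \sum_(i <- r) l i.
Proof.
move=> h; elim: r => [|i r IH].
  by rewrite big_nil; apply: (@eq_cvgn _ (fun=> 0)) => [n|]; [rewrite big_nil|exact: cvg_cst].
rewrite big_cons; apply: (@eq_cvgn _ (fun n => u i n + \sum_(i <- r) u i n)) => [n|].
  by rewrite big_cons.
exact: cvgD.
Qed.

Section CosProducts.
Context {d : measure_display} {T : measurableType d} {R : realType}.
Variables (P : probability T R) (H : set (T -> R)).
Hypothesis gH : gspace P H.
Variables (m : nat) (x : 'I_m -> T -> R).
Hypothesis Hx : forall i, H (x i).
Implicit Types (c : R) (s : seq 'I_m).

Let tx i : tame P (x i) := gspace_tame gH (Hx i).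

Definition cos_prod c s w : R := \prod_(i <- s) cos (c * x i w).

(* The derivative of [cos_prod c s], seen as a function of the vector [x], in
   the direction [(cov Y (x i))_i]. *)
Fixpoint dcos_prod (Y : T -> R) c s w : R :=
  if s is i :: s' then
    - (c * cov P Y (x i)) * sin (c * x i w) * cos_prod c s' w +
    cos (c * x i w) * dcos_prod Y c s' w
  else 0.

Lemma cos_prod_cons c i s w : cos_prod c (i :: s) w = cos (c * x i w) * cos_prod c s w.
Proof. by rewrite /cos_prod big_cons. Qed.

Let mcx c i : measurable_fun setT (fun w => c * x i w).
Proof. by apply: measurable_funM => //; exact: tame_measurable (tx i). Qed.

Lemma tame_cos_prod c s : tame P (cos_prod c s).
Proof.
elim: s => [|i s IH].
  by apply: eq_tame (tame_cst P 1) => w; rewrite /cos_prod big_nil.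
apply: eq_tame (tameM (tame_cos P (mcx c i)) IH) => w.
by rewrite cos_prod_cons.
Qed.

Lemma tame_dcos_prod Y c s : tame P (dcos_prod Y c s).
Proof.
elim: s => [|i s IH] /=; first exact: tame_cst.
have tc := tame_cos P (mcx c i); have ts := tame_sin P (mcx c i).
have tp := tame_cos_prod c s; by tame_tac.
Qed.

Lemma normr_cos_prod c s w : `|cos_prod c s w| <= 1.
Proof.
elim: s => [|i s IH]; first by rewrite /cos_prod big_nil normr1.
rewrite cos_prod_cons normrM -[leRHS]mulr1 ler_pM//.
by rewrite ler_norml cos_geN1 cos_le1.
Qed.

(** The square of [c], due to |sin u| <= |u|, compensates the (n + 1)^2 repetitions of each index in
    [gaussian_ibp_expR], where c = t / (n + 1); the bound is then uniform in n. *)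
Lemma normr_dcos_prod Y c s w :
  `|dcos_prod Y c s w| <= \sum_(i <- s) c ^+ 2 * `|cov P Y (x i) * x i w|.
Proof.
elim: s => [|i s IH] /=; first by rewrite big_nil normr0.
rewrite big_cons; apply: le_trans (ler_normD _ _) _; apply: lerD.
  rewrite !normrM normrN normrM -mulrA.
  apply: (@le_trans _ _ (`|c| * `|cov P Y (x i)| * (`|c| * `|x i w|))).
    rewrite ler_wpM2l ?mulr_ge0// -[leRHS]mulr1 ler_pM ?normr_cos_prod//.
    by rewrite -normrM; exact: normr_sin_le.
  by rewrite -(real_normK (num_real c)) le_eqVlt; apply/orP; left; apply/eqP; ring.
by rewrite normrM -[leRHS]mul1r ler_pM// ler_norml cos_geN1 cos_le1.
Qed.

Lemma dcos_prodE Y c s w : (forall i, cos (c * x i w) != 0) ->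
  dcos_prod Y c s w = - cos_prod c s w * \sum_(i <- s) c * cov P Y (x i) * tan (c * x i w).
Proof.
move=> h; elim: s => [|i s IH] /=; first by rewrite big_nil mulr0.
rewrite IH cos_prod_cons big_cons /tan; field.
exact: h.
Qed.

(** Induction on [s] with [Z] arbitrary: product-to-sum formulas absorb the factor cos (c x_i) by
    replacing Z with Z + c x_i and Z - c x_i. The extra cos (Z) exists for the sake of this
    induction. *)
Lemma gspace_cos_prod Y Z c s : H Y -> H Z ->
  mean P (fun w => Y w ^+ 2 * (cos (Z w) * cos_prod c s w)) =
  cov P Y Y * mean P (fun w => cos (Z w) * cos_prod c s w)
  - cov P Y Z * mean P (fun w => Y w * (sin (Z w) * cos_prod c s w))
  + mean P (fun w => Y w * (cos (Z w) * dcos_prod Y c s w)).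
Proof.
move=> HY; have tY := gspace_tame gH HY.
elim: s Z => [|i s IH] Z HZ; have tZ := gspace_tame gH HZ.
  have E f : (fun w => f w * cos_prod c [::] w) = f.
    by apply/funext => w; rewrite /cos_prod big_nil mulr1.
  rewrite (_ : (fun w => Y w ^+ 2 * _) = (fun w => Y w ^+ 2 * cos (Z w))); last first.
    by apply/funext => w; rewrite /cos_prod big_nil mulr1.
  rewrite (_ : (fun w => Y w * (sin (Z w) * _)) = (fun w => Y w * sin (Z w))); last first.
    by apply/funext => w; rewrite /cos_prod big_nil mulr1.
  rewrite (E (fun w => cos (Z w))) (_ : mean P (fun w => Y w * (_ * _)) = 0).
    by rewrite addr0; exact: (gspace_sqr_cos gH).
  by rewrite -(mean_cst P 0); apply: eq_mean => w; rewrite /= !mulr0.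
have Hcx : H (fun w => c * x i w) by exact: (gspaceZ gH).
have HD := gspaceD gH HZ Hcx; have HB := gspaceB gH HZ Hcx.
have eD := IH _ HD; have eB := IH _ HB.
have mZ := tame_measurable tZ.
have tcZ := tame_cos P mZ; have tsZ := tame_sin P mZ.
have tcx := tame_cos P (mcx c i); have tsx := tame_sin P (mcx c i).
have tp := tame_cos_prod c s; have td := tame_dcos_prod Y c s.
have tcD := tame_cos P (tame_measurable (gspace_tame gH HD)).
have tcB := tame_cos P (tame_measurable (gspace_tame gH HB)).
have tsD := tame_sin P (tame_measurable (gspace_tame gH HD)).
have tsB := tame_sin P (tame_measurable (gspace_tame gH HB)).
have cD : cov P Y (fun w => Z w + c * x i w) = cov P Y Z + c * cov P Y (x i).
  have t := tx i; rewrite /cov -!meanZ -?meanD; try by tame_tac.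
  by apply: eq_mean => w; ring.
have cB : cov P Y (fun w => Z w - c * x i w) = cov P Y Z - c * cov P Y (x i).
  have t := tx i; rewrite /cov -!meanZ -?meanB; try by tame_tac.
  by apply: eq_mean => w; ring.
have cc a b : cos a * cos b = 2^-1 * (cos (a + b) + cos (a - b)) :> R.
  by rewrite cosD cosB; field.
have sc a b : sin a * cos b = 2^-1 * (sin (a + b) + sin (a - b)) :> R.
  by rewrite sinD sinB; field.
have cs a b : cos a * sin b = 2^-1 * (sin (a + b) - sin (a - b)) :> R.
  by rewrite sinD sinB; field.
rewrite (_ : mean P (fun w => Y w ^+ 2 * _) =
    2^-1 * (mean P (fun w => Y w ^+ 2 * (cos (Z w + c * x i w) * cos_prod c s w)) +
            mean P (fun w => Y w ^+ 2 * (cos (Z w - c * x i w) * cos_prod c s w)))); last first.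
  rewrite -meanD -?meanZ; try by tame_tac.
  by apply: eq_mean => w; rewrite cos_prod_cons [cos (Z w) * _]mulrA cc; ring.
rewrite eD eB cD cB.
rewrite (_ : mean P (fun w => cos (Z w) * cos_prod c (i :: s) w) =
    2^-1 * (mean P (fun w => cos (Z w + c * x i w) * cos_prod c s w) +
            mean P (fun w => cos (Z w - c * x i w) * cos_prod c s w))); last first.
  rewrite -meanD -?meanZ; try by tame_tac.
  by apply: eq_mean => w; rewrite cos_prod_cons [cos (Z w) * _]mulrA cc; ring.
rewrite (_ : mean P (fun w => Y w * (sin (Z w) * cos_prod c (i :: s) w)) =
    2^-1 * (mean P (fun w => Y w * (sin (Z w + c * x i w) * cos_prod c s w)) +
            mean P (fun w => Y w * (sin (Z w - c * x i w) * cos_prod c s w)))); last first.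
  rewrite -meanD -?meanZ; try by tame_tac.
  by apply: eq_mean => w; rewrite cos_prod_cons [sin _ * _]mulrA sc; ring.
rewrite (_ : mean P (fun w => Y w * (cos (Z w) * dcos_prod Y c (i :: s) w)) =
    - (c * cov P Y (x i)) * 2^-1 *
      (mean P (fun w => Y w * (sin (Z w + c * x i w) * cos_prod c s w)) -
       mean P (fun w => Y w * (sin (Z w - c * x i w) * cos_prod c s w))) +
    2^-1 * (mean P (fun w => Y w * (cos (Z w + c * x i w) * dcos_prod Y c s w)) +
            mean P (fun w => Y w * (cos (Z w - c * x i w) * dcos_prod Y c s w)))); last first.
  rewrite /=; move: (cov P Y (x i)) => k.
  rewrite -meanD -?meanB -?meanZ -?meanD; try by tame_tac.
  apply: eq_mean => w.
  rewrite (_ : Y w * _ = - (c * k) * Y w * (cos (Z w) * sin (c * x i w)) * cos_prod c s w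
    + Y w * (cos (Z w) * cos (c * x i w)) * dcos_prod Y c s w); last by ring.
  by rewrite cc cs; ring.
by ring.
Qed.

Definition sqnorm w : R := \sum_i x i w ^+ 2.

Lemma tame_sqnorm : tame P sqnorm.
Proof. by apply: tame_sum => i; exact: tameX (tx i). Qed.

Lemma sqnorm_ge0 w : 0 <= sqnorm w.
Proof. by apply: sumr_ge0 => i _; exact: sqr_ge0. Qed.

Lemma tame_expR_sqnorm b : 0 <= b -> tame P (fun w => expR (- (b * sqnorm w))).
Proof.
move=> b0; apply: (@tame_bounded _ _ _ _ _ 1) => [|w].
  apply: measurableT_comp => //; apply: measurableT_comp => //.
  by apply: measurable_funM => //; exact: tame_measurable tame_sqnorm.
by rewrite ger0_norm ?expR_ge0// -[leRHS]expR0 ler_expR oppr_le0 mulr_ge0 ?sqnorm_ge0.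
Qed.

Let idx n : seq 'I_m := flatten (nseq n (enum 'I_m)).

Let sum_idx n (F : 'I_m -> R) : \sum_(i <- idx n) F i = n%:R * \sum_i F i.
Proof.
by rewrite big_flatten big_nseq iter_addr addr0 big_enum mulr_natl.
Qed.

Let prod_idx n (F : 'I_m -> R) : \prod_(i <- idx n) F i = (\prod_i F i) ^+ n.
Proof. by rewrite big_flatten big_nseq iter_mulr mulr1 big_enum. Qed.

(* As [n] grows, [cos (t / n * x) ^ (n ^ 2)] tends to [exp (- t ^ 2 * x ^ 2 / 2)]:
   this turns the identity for products of cosines into the Gaussian
   integration by parts formula for [exp (- b * |x| ^ 2)]. *)
Lemma gaussian_ibp_expR Y b : H Y -> 0 <= b ->
  mean P (fun w => Y w ^+ 2 * expR (- (b * sqnorm w))) =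
  cov P Y Y * mean P (fun w => expR (- (b * sqnorm w))) -
  2 * b * mean P (fun w => Y w * expR (- (b * sqnorm w)) * \sum_i cov P Y (x i) * x i w).
Proof.
move=> HY b0; have tY := gspace_tame gH HY.
(* Chosen so that t^2 x^2 / 2 = b x^2 in the limit of the powers of cosines. *)
pose t := Num.sqrt (2 * b).
have t2 : t ^+ 2 = 2 * b by rewrite sqr_sqrtr// mulr_ge0.
pose c n : R := t / n.+1%:R.
pose s n := idx (n.+1 ^ 2).
have tp n := tame_cos_prod (c n) (s n); have td n := tame_dcos_prod Y (c n) (s n).
have H0 : H (fun=> 0).
  by have := gspaceZ gH 0 HY; congr H; apply/funext => w; rewrite mul0r.
have E n : mean P (fun w => Y w ^+ 2 * cos_prod (c n) (s n) w) =
    cov P Y Y * mean P (cos_prod (c n) (s n)) + mean P (fun w => Y w * dcos_prod Y (c n) (s n) w).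
  have := gspace_cos_prod (c n) (s n) HY H0.
  have -> : cov P Y (fun=> 0) = 0.
    by rewrite -[RHS](mean_cst P 0); apply: eq_mean => w; rewrite mulr0.
  rewrite mul0r subr0 cos0 (_ : (fun w => 1 * _) = cos_prod (c n) (s n)); last first.
    by apply/funext => w; rewrite mul1r.
  rewrite (_ : (fun w => Y w ^+ 2 * _) = (fun w => Y w ^+ 2 * cos_prod (c n) (s n) w)); last first.
    by apply/funext => w; rewrite mul1r.
  move=> ->; congr (_ + _); apply: eq_mean => w.
  by rewrite mul1r.
have cvp w : cos_prod (c n) (s n) w @[n --> \oo] --> expR (- (b * sqnorm w)).
  have -> : expR (- (b * sqnorm w)) = \prod_i expR (- ((t * x i w) ^+ 2 / 2)).
    rewrite -expR_sum; congr expR; rewrite /sqnorm mulr_sumr -sumrN.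
    by apply: eq_bigr => i _; rewrite exprMn t2; field.
  apply: (@eq_cvgn _ (fun n => \prod_i cos (t * x i w / n.+1%:R) ^+ (n.+1 ^ 2))).
    move=> n; rewrite /cos_prod prod_idx -prodrXl; apply: eq_bigr => i _.
    by congr (cos _ ^+ _); rewrite /c mulrAC.
  apply: cvg_prod_seq => i; exact: cvg_cos_pow.
have cvd w : dcos_prod Y (c n) (s n) w @[n --> \oo] -->
    - expR (- (b * sqnorm w)) * (2 * b * \sum_i cov P Y (x i) * x i w).
  have c1 : - cos_prod (c n) (s n) w * (t * \sum_i cov P Y (x i) * (n.+1%:R * tan (t * x i w / n.+1%:R)))
      @[n --> \oo] --> - expR (- (b * sqnorm w)) * (2 * b * \sum_i cov P Y (x i) * x i w).
    apply: cvgM; first exact: cvgN.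
    rewrite -t2 expr2 -mulrA; apply: cvgMr; rewrite mulr_sumr.
    apply: (cvg_sum_seq (u := fun i n => cov P Y (x i) * (n.+1%:R * tan (t * x i w / n.+1%:R)))) => i.
    by rewrite mulrCA; apply: cvgMr; exact: cvg_tan_mul.
  (* The arguments tend to 0, so the tangent form of the derivative is legitimate for all large
     n. *)
  have cn0 : \forall n \near \oo, forall i, cos (t * x i w / n.+1%:R) != 0.
    apply: filter_forall => i; have := @cvg_cos_one R (t * x i w).
    by move=> /cvgr_neq0; apply; exact: oner_neq0.
  apply: cvg_trans c1; apply: near_eq_cvg; near=> n.
  rewrite dcos_prodE; last first.
    by move=> i; rewrite /c mulrAC; move: i; near: n.
  congr (_ * _); rewrite sum_idx natrX !mulr_sumr; apply: eq_bigr => i _.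
  rewrite /c [t / _ * x i w]mulrAC; field; exact: lt0r_neq0.
have lim1 : mean P (fun w => Y w ^+ 2 * cos_prod (c n) (s n) w) @[n --> \oo] -->
    mean P (fun w => Y w ^+ 2 * expR (- (b * sqnorm w))).
  apply: (@mean_cvg _ _ _ P _ _ (fun w => Y w ^+ 2)).
  - by move=> n; apply: tame_measurable; apply: (tameM (P := P)) => //; exact: tameX.
  - apply: tame_measurable; apply: (tameM (P := P)); [exact: tameX|exact: tame_expR_sqnorm].
  - exact: tameX.
  - by move=> n w; rewrite normrM (ger0_norm (sqr_ge0 _)) ler_piMr ?sqr_ge0// normr_cos_prod.
  - by move=> w; apply: cvgMr; exact: cvp.
have lim2 : mean P (cos_prod (c n) (s n)) @[n --> \oo] --> mean P (fun w => expR (- (b * sqnorm w))).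
  apply: (@mean_cvg _ _ _ P _ _ (fun=> 1)).
  - by move=> n; exact: tame_measurable (tp n).
  - exact: tame_measurable (tame_expR_sqnorm b0).
  - exact: tame_cst.
  - by move=> n w; exact: normr_cos_prod.
  - exact: cvp.
have tB : tame P (fun w => \sum_i `|cov P Y (x i) * x i w|).
  by apply: tame_sum => i; apply: tame_norm; exact: tameZ (tx i).
have lim3 : mean P (fun w => Y w * dcos_prod Y (c n) (s n) w) @[n --> \oo] -->
    mean P (fun w => Y w * (- expR (- (b * sqnorm w)) * (2 * b * \sum_i cov P Y (x i) * x i w))).
  apply: (@mean_cvg _ _ _ P _ _ (fun w => `|Y w| * (2 * b * \sum_i `|cov P Y (x i) * x i w|))).
  - by move=> n; apply: tame_measurable; exact: (tameM tY (td n)).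
  - apply: (@tame_measurable _ _ _ P); apply: tameM => //; apply: tameM.
      by apply: tameN; exact: tame_expR_sqnorm.
    by apply: tameZ; apply: tame_sum => i; exact: tameZ (tx i).
  - by apply: tameM; [exact: tame_norm|exact: tameZ].
  - move=> n w; rewrite normrM ler_wpM2l//; apply: le_trans (normr_dcos_prod _ _ _ _) _.
    rewrite sum_idx -mulr_sumr mulrA ler_wpM2r ?sumr_ge0//.
    have N0 : (n.+1%:R : R) != 0 by rewrite pnatr_eq0.
    by rewrite -t2 /c natrX exprMn exprVn mulrC divfK// expf_neq0.
  - by move=> w; apply: cvgMr; exact: cvd.
have lim4 : mean P (fun w => Y w ^+ 2 * cos_prod (c n) (s n) w) @[n --> \oo] -->
    cov P Y Y * mean P (fun w => expR (- (b * sqnorm w))) +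
    mean P (fun w => Y w * (- expR (- (b * sqnorm w)) * (2 * b * \sum_i cov P Y (x i) * x i w))).
  apply: eq_cvgn (fun n => esym (E n)) _.
  by apply: cvgD lim3; apply: cvgMr.
rewrite (cvg_unique _ lim1 lim4)//; congr (_ + _).
have t1 : tame P (fun w => Y w * expR (- (b * sqnorm w)) * \sum_i cov P Y (x i) * x i w).
  apply: tameM; first by apply: tameM => //; exact: tame_expR_sqnorm.
  by apply: tame_sum => i; exact: tameZ (tx i).
rewrite -meanZ// -meanN; last exact: tameZ.
by apply: eq_mean => w; ring.
Unshelve. all: by end_near.
Qed.

End CosProducts.

(** * Weierstrass approximation by Bernstein polynomials *)

Section Bernstein.
Context {R : realType}.

Definition bernstein_sum n (t : R) (f : nat -> R) : R :=
  \sum_(i < n.+1) f i * ('C(n, i)%:R * t ^+ i * (1 - t) ^+ (n - i)).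

Lemma bernstein_sum1 n t : bernstein_sum n t (fun=> 1) = 1.
Proof.
rewrite /bernstein_sum -[RHS](expr1n _ n) -[X in X ^+ n](subrK t 1) exprDn.
by apply: eq_bigr => i _; rewrite mul1r -[RHS]mulr_natl; ring.
Qed.

(** From i C(n+1, i) = (n+1) C(n, i-1); it yields the first two moments of the binomial weights. *)
Lemma bernstein_sum_rec n t f :
  bernstein_sum n.+1 t (fun i => i%:R * f i) =
  n.+1%:R * t * bernstein_sum n t (fun i => f i.+1).
Proof.
rewrite /bernstein_sum big_ord_recl /= !mul0r add0r mulr_sumr.
apply: eq_bigr => i _; rewrite /bump /= add1n subSS.
have : (i.+1%:R * 'C(n.+1, i.+1)%:R : R) = n.+1%:R * 'C(n, i)%:R.
  by rewrite -!natrM mul_bin_diag.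
move: (i.+1%:R) (n.+1%:R) ('C(n.+1, i.+1)%:R) ('C(n, i)%:R) => a b c e ace.
rewrite exprS.
transitivity (f i.+1 * ((a * c) * (t * t ^+ i) * (1 - t) ^+ (n - i))); first by ring.
by rewrite ace; ring.
Qed.

Lemma eq_bernstein_sum n t f g : (forall i, f i = g i) -> bernstein_sum n t f = bernstein_sum n t g.
Proof. by move=> fg; apply: eq_bigr => i _; rewrite fg. Qed.

Lemma bernstein_sumD n t f g :
  bernstein_sum n t (fun i => f i + g i) = bernstein_sum n t f + bernstein_sum n t g.
Proof. by rewrite /bernstein_sum -big_split; apply: eq_bigr => i _; rewrite mulrDl. Qed.

Lemma bernstein_sumZ n t c f :
  bernstein_sum n t (fun i => c * f i) = c * bernstein_sum n t f.
Proof. by rewrite /bernstein_sum mulr_sumr; apply: eq_bigr => i _; ring. Qed.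

Lemma bernstein_sum_id n t : bernstein_sum n t (fun i => i%:R) = n%:R * t.
Proof.
case: n => [|n]; first by rewrite /bernstein_sum big_ord1 !mul0r.
transitivity (bernstein_sum n.+1 t (fun i => i%:R * 1)).
  by apply: eq_bernstein_sum => i; rewrite mulr1.
by rewrite bernstein_sum_rec bernstein_sum1 mulr1.
Qed.

Lemma bernstein_variance n t :
  bernstein_sum n.+1 t (fun i => (i%:R / n.+1%:R - t) ^+ 2) = t * (1 - t) / n.+1%:R.
Proof.
have N0 : (n.+1%:R : R) != 0 by rewrite pnatr_eq0.
transitivity (bernstein_sum n.+1 t (fun i => n.+1%:R ^- 2 * (i%:R * i%:R) + (- 2 * t / n.+1%:R * i%:R + t ^+ 2 * 1))).
  by apply: eq_bernstein_sum => i; field.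
rewrite !bernstein_sumD !bernstein_sumZ bernstein_sum1 bernstein_sum_id bernstein_sum_rec.
rewrite (@eq_bernstein_sum n t (fun i => i.+1%:R) (fun i => i%:R + 1)); last by move=> i; rewrite natr1.
rewrite bernstein_sumD bernstein_sum1 bernstein_sum_id; move: N0; rewrite -(natr1 n).
by move=> N0; field; rewrite // addrC.
Qed.

Lemma continuous_unif01 (k : R -> R) e : continuous k -> 0 < e ->
  exists2 n : nat, True & forall x y, 0 <= x <= 1 -> `|x - y| < n.+1%:R^-1 -> `|k x - k y| <= e.
Proof.
move=> ck e0.
have /compact_near_coveringP cc := @segment_compact R 0 1.
pose Q (n : nat) (x : R) := forall y, `|x - y| < n.+1%:R^-1 -> `|k x - k y| <= e.
have : \forall n \near \oo, `[0, 1]%classic `<=` Q n.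
  apply: cc => x _.
  have e2 : 0 < e / 2 by rewrite divr_gt0.
  have /cvgrPdist_lt/(_ (e / 2) e2) := ck x.
  move=> [dl /= dl0 hdl]; have dl2 : 0 < dl / 2 by rewrite divr_gt0.
  have nd : \forall n \near \oo, n.+1%:R^-1 < dl / 2.
    have /cvgr0Pnorm_lt/(_ _ dl2) := @cvg_harmonic R.
    by apply: filterS => n; apply: le_lt_trans; exact: ler_norm.
  near=> z n => /= y zy.
  have xz : `|x - z| < dl / 2 by near: z; exists (dl / 2).
  have nn : n.+1%:R^-1 < dl / 2 by near: n.
  have zy2 := lt_trans zy nn.
  have h1 : `|k x - k z| < e / 2 by apply: hdl => /=; lra.
  have h2 : `|k x - k y| < e / 2.
    apply: hdl => /=; have := ler_normD (x - z) (z - y); rewrite addrA subrK; lra.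
  have := ler_normB (k x - k y) (k x - k z).
  rewrite (_ : k x - k y - (k x - k z) = k z - k y); last by ring.
  lra.
move=> [n _ /(_ n (leqnn n)) h]; exists n => // x y xI; apply: h.
by rewrite /= in_itv.
Unshelve. all: by end_near. Qed.

(** Bernstein's proof: |k(i/N) - k(t)| is at most e/2 + M (i/N - t)^2, and the binomial mean of the
    square is t (1 - t) / N. *)
Lemma weierstrass (k : R -> R) e : continuous k -> 0 < e ->
  exists p : {poly R}, forall t, 0 <= t <= 1 -> `|p.[t] - k t| <= e.
Proof.
move=> ck e0.
have e2 : 0 < e / 2 by rewrite divr_gt0.
have [n _ kn] := continuous_unif01 ck e2.
have [c _ hc] : exists2 c, c \in `[0, 1] & forall t, t \in `[0, 1] -> `|k t| <= `|k c|.
  apply: (@EVT_max R (fun t => `|k t|) 0 1) => //.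
  by apply: continuous_subspaceT => x; apply: cvg_norm; exact: ck.
move: (`|k c|) (normr_ge0 (k c)) hc => B B0 hc.
(* For |x - y| >= 1 / (n + 1) the trivial bound 2 B is below M (x - y)^2. *)
pose M := 2 * B * n.+1%:R ^+ 2.
have M0 : 0 <= M by rewrite /M mulr_ge0 ?exprn_ge0 ?mulr_ge0.
have kM x y : 0 <= x <= 1 -> 0 <= y <= 1 -> `|k x - k y| <= e / 2 + M * (x - y) ^+ 2.
  move=> xI yI; have [xy|xy] := ltP `|x - y| n.+1%:R^-1.
    by apply: le_trans (kn _ _ xI xy) _; rewrite lerDl mulr_ge0 ?sqr_ge0.
  apply: (@le_trans _ _ (2 * B)).
    apply: le_trans (ler_normB _ _) _; rewrite mulr_natl mulr2n.
    by apply: lerD; apply: hc; rewrite in_itv.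
  apply: (@le_trans _ _ (M * (x - y) ^+ 2)); last by rewrite lerDr ltW.
  rewrite /M -mulrA -[leLHS]mulr1; apply: ler_wpM2l; first by rewrite mulr_ge0.
  rewrite -(real_normK (num_real (x - y))) -exprMn.
  by apply: exprn_ege1; rewrite -ler_pdivrMl ?ltr0n// mulr1.
have [N MN] : exists N : nat, M / N.+1%:R <= e / 2.
  exists (Num.truncn (M / (e / 2))).
  rewrite ler_pdivrMr ?ltr0n// mulrC -ler_pdivrMr//.
  exact/ltW/truncnS_gt.
pose p : {poly R} := \sum_(i < N.+2) (k (i%:R / N.+1%:R) * 'C(N.+1, i)%:R)%:P * 'X^i * (1 - 'X) ^+ (N.+1 - i).
exists p => t tI.
have -> : p.[t] = bernstein_sum N.+1 t (fun i => k (i%:R / N.+1%:R)).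
  rewrite /p horner_sum; apply: eq_bigr => i _.
  by rewrite !hornerE /=; ring.
have b0 (i : 'I_N.+2) : 0 <= 'C(N.+1, i)%:R * t ^+ i * (1 - t) ^+ (N.+1 - i).
  by case/andP: tI => t0 t1; rewrite !mulr_ge0 ?exprn_ge0// subr_ge0.
have -> : bernstein_sum N.+1 t (fun i => k (i%:R / N.+1%:R)) - k t =
    bernstein_sum N.+1 t (fun i => k (i%:R / N.+1%:R) - k t * 1).
  rewrite (@eq_bernstein_sum _ _ (fun i => _ - _ * 1) (fun i => k (i%:R / N.+1%:R) + (- k t) * 1)); last first.
    by move=> i; rewrite mulNr.
  by rewrite bernstein_sumD bernstein_sumZ bernstein_sum1 mulr1.
apply: (@le_trans _ _ (bernstein_sum N.+1 t (fun i => e / 2 * 1 + M * (i%:R / N.+1%:R - t) ^+ 2))).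
  apply: le_trans (ler_norm_sum _ _ _) _; apply: ler_sum => i _.
  rewrite normrM (ger0_norm (b0 i)) ler_wpM2r// !mulr1; apply: kM => //.
  rewrite divr_ge0//= ler_pdivrMr ?ltr0n// mul1r ler_nat -ltnS; exact: ltn_ord.
rewrite bernstein_sumD !bernstein_sumZ bernstein_sum1 bernstein_variance mulr1.
rewrite [leRHS](splitr e) lerD2l; apply: le_trans MN; rewrite mulrA ler_wpM2r// ler_piMr//.
by case/andP: tI => t0 t1; rewrite mulr_ile1// ?subr_ge0// gerBl.
Qed.

End Bernstein.

(** * Integration by parts for the squared norm *)

Section QuadraticForm.
Context {d : measure_display} {T : measurableType d} {R : realType}.
Variables (P : probability T R) (H : set (T -> R)).
Hypothesis gH : gspace P H.
Variables (m : nat) (x : 'I_m -> T -> R).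
Hypothesis Hx : forall i, H (x i).

Local Notation G i j := (cov P (x i) (x j)).
Local Notation sq := (sqnorm x).

Let tx i : tame P (x i) := gspace_tame gH (Hx i).
Let tsq : tame P sq := tame_sqnorm gH Hx.

(** With [G] the covariance matrix of the vector Y, these are Y^T G Y, tr G and, since [G] is
    symmetric, tr G^2. *)
Definition quadform w : R := \sum_i \sum_j G i j * (x i w * x j w).
Definition cov_trace : R := \sum_i G i i.
Definition cov_frob : R := \sum_i \sum_j G i j ^+ 2.

Local Notation quad := quadform.
Local Notation tr := cov_trace.

Lemma tame_quadform : tame P quad.
Proof. by apply: tame_sum => i; apply: tame_sum => j; apply: tameZ; exact: tameM. Qed.

Let tq := tame_quadform.

Lemma mean_sqnorm : mean P sq = tr.
Proof. by rewrite mean_sum// => i; exact: tameX. Qed.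

Lemma mean_quadform : mean P quad = cov_frob.
Proof.
rewrite mean_sum; last by move=> i; apply: tame_sum => j; apply: tameZ; exact: tameM.
apply: eq_bigr => i _; rewrite mean_sum; last by move=> j; apply: tameZ; exact: tameM.
by apply: eq_bigr => j _; rewrite meanZ ?expr2//; exact: tameM.
Qed.

Lemma sqnorm_ibp_expR b : 0 <= b ->
  mean P (fun w => (sq w - tr) * expR (- (b * sq w))) =
  - 2 * b * mean P (fun w => quad w * expR (- (b * sq w))).
Proof.
move=> b0; have te := tame_expR_sqnorm gH Hx b0.
have tY i : tame P (fun w => x i w ^+ 2 * expR (- (b * sq w))) by apply: tameM => //; exact: tameX.
have tZ i : tame P (fun w => x i w * expR (- (b * sq w)) * \sum_j G i j * x j w).
  by apply: tameM; [exact: tameM|apply: tame_sum => j; exact: tameZ].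
transitivity (\sum_i (mean P (fun w => x i w ^+ 2 * expR (- (b * sq w))) - G i i * mean P (fun w => expR (- (b * sq w))))).
  rewrite sumrB -mulr_suml -mean_sum// -[X in _ - X]meanZ// -meanB.
  - by apply: eq_mean => w; rewrite mulrBl; congr (_ - _); rewrite -mulr_suml.
  - exact: tame_sum.
  - exact: tameZ.
transitivity (\sum_i (- 2 * b * mean P (fun w => x i w * expR (- (b * sq w)) * \sum_j G i j * x j w))).
  by apply: eq_bigr => i _; rewrite (gaussian_ibp_expR gH Hx (Hx i) b0); ring.
rewrite -mulr_sumr -mean_sum//; congr (_ * _); apply: eq_mean => w.
rewrite /quadform mulr_suml; apply: eq_bigr => i _.
by rewrite mulr_sumr mulr_suml; apply: eq_bigr => j _; ring.
Qed.

Lemma drv_lipschitz_ge0 (f f' : R -> R) B y : 0 <= y ->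
  (forall z : R, is_derive z 1 f (f' z)) -> (forall z, 0 <= z -> `|f' z| <= B) ->
  `|f y - f 0| <= B * y.
Proof.
move=> y0 df fB; rewrite -[X in _ <= _ * X]subr0.
apply: (@drv_lipschitz _ _ f') => // z /andP[z0 _]; exact: fB.
Qed.

(** Under the substitution v = exp(-y), F'(y) becomes - v k(v) with [k] continuous on [0, 1]. A
    polynomial approximation of [k] approximates F' by sums of exponentials within [e], hence F
    within e y, and the identity is already known for exponentials. *)
Lemma sqnorm_ibp (F F' : R -> R) (K B : R) : (forall y : R, is_derive y 1 F (F' y)) ->
  continuous F' -> (forall y, K <= y -> F' y = 0) -> (forall y, `|F' y| <= B) ->
  mean P (fun w => (sq w - tr) * F (sq w)) = 2 * mean P (fun w => quad w * F' (sq w)).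
Proof.
move=> dF cF' F'0 F'B.
have mF : measurable_fun setT F.
  by apply: continuous_measurable_fun => y; exact: drv_continuous (dF y).
have mF' : measurable_fun setT F' by exact: continuous_measurable_fun.
have msq := tame_measurable tsq.
have tF : tame P (fun w => F (sq w)).
  apply: (@tame_le _ _ _ P _ (fun w => `|F 0| + B * sq w)).
  - exact: measurableT_comp.
  - move=> w; have B0 : 0 <= B by exact: le_trans (F'B 0).
    have s0 := sqnorm_ge0 x w.
    rewrite (ger0_norm (x := _ + _)) ?addr_ge0 ?mulr_ge0//.
    have := drv_lipschitz_ge0 s0 dF (fun z _ => F'B z).
    have := ler_normD (F 0) (F (sq w) - F 0); rewrite addrC subrK; lra.
  - by apply: tameD; [exact: tame_cst|exact: tameZ].
have tF' : tame P (fun w => F' (sq w)).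
  by apply: (@tame_bounded _ _ _ _ _ B) => //; exact: measurableT_comp.
(* Because of the division by [v], the approximants of F' involve only exp(-(i+1) y), with no
   constant term, so that their primitives are again exponentials and a constant. *)
pose k v : R := if 0 < v then - F' (- ln v) / v else 0.
have ck : continuous k.
  move=> v; have [v0|v0] := ltP 0 v.
    have ckv : {for v, continuous (fun v => - F' (- ln v) / v)}.
      apply: cvgM; last by apply: cvgV; [rewrite gt_eqF|exact: cvg_id].
      have cFN : continuous (fun u => F' (- u)).
        by move=> u; apply: continuous_comp; [exact: opp_continuous|exact: cF'].
      apply: cvgN; apply: (@continuous_comp _ _ _ (@ln R) (fun u => F' (- u)) v).
        exact: continuous_ln.
      exact: cFN.
    have kv : k v = - F' (- ln v) / v by rewrite /k v0.
    suff : k u @[u --> v] --> - F' (- ln v) / v by rewrite -kv.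
    apply: cvg_trans ckv; apply: near_eq_cvg; near=> u.
    by rewrite /k ifT//; near: u; exact: lt_nbhsr.
  (* Points near a non-positive [v] are below exp(-K); there F' (- ln u) vanishes. *)
  have kv : k v = 0 by rewrite /k ltNge v0.
  suff : k u @[u --> v] --> (0 : R) by rewrite -[X in _ --> X]kv.
  apply: cvg_near_cst; near=> u; rewrite /k; case: ifPn => // u0.
  rewrite F'0 ?oppr0 ?mul0r// lerNr -(expRK (- K)) ler_ln ?posrE ?expR_gt0//.
  apply/ltW; near: u; apply: lt_nbhsl; exact: le_lt_trans (expR_gt0 _).
have kE y : F' y = - (k (expR (- y)) * expR (- y)).
  by rewrite /k expR_gt0 expRK opprK divfK ?opprK// gt_eqF// expR_gt0.
set L := mean P _; set Q := mean P (fun w => quad w * F' (sq w)).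
pose C := mean P (fun w => `|sq w - tr| * sq w) + 2 * mean P (fun w => `|quad w|).
have tst : tame P (fun w => sq w - tr) by apply: tameB => //; exact: tame_cst.
have LQ e : 0 < e -> `|L - 2 * Q| <= e * C.
  move=> e0; have [p pk] := weierstrass ck e0.
  pose n := size p; pose a i := p`_i.
  (* The integration constant for which the approximant [A] agrees with [F] at 0. *)
  pose c0 := F 0 - \sum_(i < n) a i / i.+1%:R.
  pose E i y : R := expR (- (i.+1%:R * y)).
  pose A y := c0 + \sum_(i < n) a i / i.+1%:R * E i y.
  pose A' y := - \sum_(i < n) a i * E i y.
  have A'E y : A' y = - (p.[expR (- y)] * expR (- y)).
    rewrite /A' horner_coef mulr_suml; congr (- _); apply: eq_bigr => i _.
    by rewrite -mulrA; congr (_ * _); rewrite -exprSr -expRM_natl mulrN.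
  have dA (y : R) : is_derive y 1 A (A' y).
    have -> : A' y = 0 + \sum_(i < n) a i / i.+1%:R * (E i y * - (i.+1%:R * 1)).
      rewrite add0r /A' -sumrN; apply: eq_bigr => i _.
      have : (i.+1%:R : R) != 0 by rewrite pnatr_eq0.
      by move: (i.+1%:R) => N N0; field.
    apply: (drvD (drv_cst c0 y)).
    apply: (@drv_sum _ n (fun i y => a i / i.+1%:R * E i y) y (fun i => a i / i.+1%:R * (E i y * - (i.+1%:R * 1)))) => i _.
  have A0 : A 0 = F 0.
    rewrite /A (eq_bigr (fun i : 'I_n => a i / i.+1%:R)); first by rewrite subrK.
    by move=> i _; rewrite /E mulr0 oppr0 expR0 mulr1.
  have tE i : tame P (fun w => E i (sq w)) by exact: (tame_expR_sqnorm gH Hx (ler0n R i.+1)).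
  have tA : tame P (fun w => A (sq w)).
    by apply: tameD; [exact: tame_cst|apply: tame_sum => i; exact: tameZ].
  have tA' : tame P (fun w => A' (sq w)).
    by apply: tameN; apply: tame_sum => i; exact: tameZ.
  have KA : mean P (fun w => (sq w - tr) * A (sq w)) = 2 * mean P (fun w => quad w * A' (sq w)).
    transitivity (c0 * mean P (fun w => sq w - tr) + \sum_(i < n) a i / i.+1%:R * mean P (fun w => (sq w - tr) * E i (sq w))).
      have tEi i : tame P (fun w => (sq w - tr) * E i (sq w)) by exact: tameM.
      rewrite (eq_bigr (fun i : 'I_n => mean P (fun w => a i / i.+1%:R * ((sq w - tr) * E i (sq w))))); last first.
        by move=> i _; rewrite meanZ.
      rewrite -mean_sum; last by move=> i; apply: tameZ; exact: tameM.
      rewrite -meanZ// -meanD; first last.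
      - by apply: tame_sum => i; apply: tameZ; exact: tameM.
      - exact: tameZ.
      apply: eq_mean => w; rewrite /A mulrDr mulr_sumr mulrC; congr (_ + _).
      by apply: eq_bigr => i _; rewrite mulrCA.
    rewrite (meanB tsq (tame_cst P tr)) mean_cst mean_sqnorm subrr mulr0 add0r.
    transitivity (\sum_(i < n) - 2 * a i * mean P (fun w => quad w * E i (sq w))).
      apply: eq_bigr => i _; rewrite (sqnorm_ibp_expR (ler0n R i.+1)).
      have : (i.+1%:R : R) != 0 by rewrite pnatr_eq0.
      by rewrite mulrA => N0; congr (_ * _); move: (i.+1%:R) N0 => N N0; field.
    have tQi i : tame P (fun w => quad w * E i (sq w)) by exact: tameM.
    rewrite (eq_bigr (fun i : 'I_n => mean P (fun w => - 2 * a i * (quad w * E i (sq w))))); last first.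
      by move=> i _; rewrite meanZ.
    rewrite -mean_sum; last by move=> i; apply: tameZ; exact: tameM.
    rewrite -meanZ; last by exact: tameM.
    apply: eq_mean => w; rewrite /A' mulrN mulr_sumr -sumrN mulr_sumr.
    by apply: eq_bigr => i _; ring.
  have eD y : 0 <= y -> `|F' y - A' y| <= e.
    move=> y0; rewrite kE A'E opprK addrC -mulrBl normrM (ger0_norm (expR_ge0 _)).
    rewrite -[leRHS]mulr1 ler_pM//; first by apply: pk; rewrite expR_ge0/= -[leRHS]expR0 ler_expR oppr_le0.
    by rewrite -[leRHS]expR0 ler_expR oppr_le0.
  have eF y : 0 <= y -> `|F y - A y| <= e * y.
    move=> y0; have := @drv_lipschitz_ge0 (fun z => F z - A z) (fun z => F' z - A' z) e y y0.
    rewrite A0 subrr subr0; apply=> //; by move=> z; exact: drvB.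
  have -> : L - 2 * Q = mean P (fun w => (sq w - tr) * (F (sq w) - A (sq w))) -
      2 * mean P (fun w => quad w * (F' (sq w) - A' (sq w))).
    rewrite (eq_mean _ (f := fun w => (sq w - tr) * (F (sq w) - A (sq w)))
      (g := fun w => (sq w - tr) * F (sq w) - (sq w - tr) * A (sq w))); last by move=> w; rewrite mulrBr.
    rewrite (eq_mean _ (f := fun w => quad w * (F' (sq w) - A' (sq w)))
      (g := fun w => quad w * F' (sq w) - quad w * A' (sq w))); last by move=> w; rewrite mulrBr.
    rewrite !meanB; try exact: tameM.
    by rewrite KA -/L -/Q; ring.
  apply: le_trans (ler_normB _ _) _; rewrite mulrDr; apply: lerD.
    rewrite -meanZ; last by apply: tameM => //; exact: tame_norm.
    apply: norm_mean_le.
    - by apply: tameM => //; exact: tameB.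
    - by apply: tameZ; apply: tameM => //; exact: tame_norm.
    - move=> w; rewrite normrM mulrCA ler_wpM2l//; apply: eF; exact: sqnorm_ge0.
  rewrite normrM ger0_norm// mulrCA ler_wpM2l//.
  rewrite -meanZ; last exact: tame_norm.
  apply: norm_mean_le.
  - by apply: tameM => //; exact: tameB.
  - by apply: tameZ; exact: tame_norm.
  - move=> w; rewrite normrM mulrC ler_wpM2r//; apply: eD; exact: sqnorm_ge0.
apply/eqP; rewrite -subr_eq0 -normr_le0; apply/ler_addgt0Pl => e e0; rewrite addr0.
have C0 : 0 <= C.
  by rewrite addr_ge0 ?mulr_ge0// mean_ge0// => w; rewrite mulr_ge0 ?sqnorm_ge0.
apply: le_trans (LQ (e / (C + 1)) _) _; first by rewrite divr_gt0// ltr_wpDl.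
rewrite mulrAC ler_pdivrMr ?ltr_wpDl// ler_wpM2l ?(ltW e0)//; lra.
Unshelve. all: by end_near.
Qed.

End QuadraticForm.

(** The inequality |g_ij g_kl| <= (g_ij^2 + g_kl^2) / 2 breaks the cycle: for fixed i and j, the
    sums over k of |g_ik| and over l of |g_jl| are at most [rho] each. The two halves are equal by
    symmetry. *)
Lemma cycle4_bound {R : realFieldType} m (g : 'I_m -> 'I_m -> R) rho :
  (forall i j, g i j = g j i) -> (forall i, \sum_j `|g i j| <= rho) ->
  \sum_i \sum_j \sum_k \sum_l `|g i j * g k l * (g i k * g j l)| <= rho ^+ 2 * \sum_i \sum_j g i j ^+ 2.
Proof.
move=> gC grho.
have h1 : \sum_i \sum_j \sum_k \sum_l g i j ^+ 2 * (`|g i k| * `|g j l|) <= rho ^+ 2 * \sum_i \sum_j g i j ^+ 2.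
  rewrite mulr_sumr; apply: ler_sum => i _; rewrite mulr_sumr; apply: ler_sum => j _.
  under eq_bigr do rewrite -mulr_sumr -mulr_sumr; rewrite -mulr_sumr -mulr_suml mulrC.
  by rewrite ler_wpM2r ?sqr_ge0// expr2 ler_pM ?sumr_ge0.
have h2 : \sum_i \sum_j \sum_k \sum_l g k l ^+ 2 * (`|g i k| * `|g j l|) =
   \sum_i \sum_j \sum_k \sum_l g i j ^+ 2 * (`|g i k| * `|g j l|).
  transitivity (\sum_k \sum_l \sum_i \sum_j g k l ^+ 2 * (`|g i k| * `|g j l|)).
    under eq_bigr do rewrite exchange_big; rewrite exchange_big; apply: eq_bigr => k _.
    by under eq_bigr do rewrite exchange_big; rewrite exchange_big.
  apply: eq_bigr => i _; apply: eq_bigr => j _; apply: eq_bigr => k _; apply: eq_bigr => l _.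
  by rewrite (gC k i) (gC l j).
apply: (@le_trans _ _ (\sum_i \sum_j \sum_k \sum_l 2^-1 * (g i j ^+ 2 * (`|g i k| * `|g j l|) + g k l ^+ 2 * (`|g i k| * `|g j l|)))).
  apply: ler_sum => i _; apply: ler_sum => j _; apply: ler_sum => k _; apply: ler_sum => l _.
  rewrite -(real_normK (num_real (g i j))) -(real_normK (num_real (g k l))) !normrM.
  have : 0 <= 2^-1 * (`|g i k| * `|g j l| * (`|g i j| - `|g k l|) ^+ 2).
    by rewrite mulr_ge0// mulr_ge0 ?sqr_ge0// mulr_ge0.
  by move=> h; rewrite -subr_ge0; apply: le_trans h _; rewrite le_eqVlt; apply/orP; left; apply/eqP; field.
rewrite (_ : \sum_i _ = 2^-1 * (\sum_i \sum_j \sum_k \sum_l g i j ^+ 2 * (`|g i k| * `|g j l|) +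
    \sum_i \sum_j \sum_k \sum_l g k l ^+ 2 * (`|g i k| * `|g j l|))).
  by rewrite h2; lra.
rewrite -big_split mulr_sumr; apply: eq_bigr => i _.
rewrite -big_split mulr_sumr; apply: eq_bigr => j _.
rewrite -big_split mulr_sumr; apply: eq_bigr => k _.
by rewrite -big_split mulr_sumr.
Qed.

(** * Stein's method for Gaussian quadratic forms *)

Section SteinBound.
Context {d : measure_display} {T : measurableType d} {R : realType}.
Variables (P : probability T R) (H : set (T -> R)).
Hypothesis gH : gspace P H.
Variables (m : nat) (x : 'I_m -> T -> R).
Hypothesis Hx : forall i, H (x i).

Local Notation G i j := (cov P (x i) (x j)).
Local Notation sq := (sqnorm x).
Local Notation quad := (quadform P x).
Local Notation tr := (cov_trace P x).
Local Notation frob := (cov_frob P x).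

Let tx i : tame P (x i) := gspace_tame gH (Hx i).
Let tsq : tame P sq := tame_sqnorm gH Hx.
Let tq : tame P quad := tame_quadform gH Hx.

Lemma mean_sqnorm2 : mean P (fun w => sq w ^+ 2) = tr ^+ 2 + 2 * frob.
Proof.
have t4 i j : tame P (fun w => x i w * x i w * (x j w * x j w)).
  by apply: tameM; exact: tameM.
transitivity (\sum_i \sum_j mean P (fun w => x i w * x i w * (x j w * x j w))).
  rewrite (eq_bigr (fun i => mean P (fun w => \sum_j x i w * x i w * (x j w * x j w)))); last first.
    by move=> i _; rewrite mean_sum.
  rewrite -mean_sum; last by move=> i; apply: tame_sum => j.
  apply: eq_mean => w; rewrite expr2 /sqnorm big_distrlr /=.
  by apply: eq_bigr => i _; apply: eq_bigr => j _; rewrite !expr2.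
rewrite /cov_trace /cov_frob expr2 big_distrlr mulr_sumr -big_split /=.
apply: eq_bigr => i _; rewrite mulr_sumr -big_split /=; apply: eq_bigr => j _.
by rewrite (gspace_mean4 gH) //; ring.
Qed.

Variable rho : R.
Hypothesis Grho : forall i, \sum_j `|G i j| <= rho.

(** Of the three pairings in Wick's formula, one gives the squared mean and the other two are sums
    over cycles of length four, that is tr G^4. *)
Lemma mean_quadform2 : mean P (fun w => quad w ^+ 2) <= frob ^+ 2 + 2 * rho ^+ 2 * frob.
Proof.
have t4 i j k l : tame P (fun w => G i j * G k l * (x i w * x j w * (x k w * x l w))).
  by apply: tameZ; apply: tameM; exact: tameM.
rewrite (_ : mean P _ = \sum_i \sum_j \sum_k \sum_l G i j * G k l *
    mean P (fun w => x i w * x j w * (x k w * x l w))); last first.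
  transitivity (mean P (fun w => \sum_i \sum_j \sum_k \sum_l
      G i j * G k l * (x i w * x j w * (x k w * x l w)))).
    apply: eq_mean => w; rewrite expr2 /quadform big_distrl /=; apply: eq_bigr => i _.
    rewrite big_distrl /=; apply: eq_bigr => j _.
    rewrite big_distrr /=; apply: eq_bigr => k _.
    by rewrite big_distrr /=; apply: eq_bigr => l _; ring.
  rewrite mean_sum; last by move=> i; do 3 (apply: tame_sum => ?).
  apply: eq_bigr => i _; rewrite mean_sum; last by move=> j; do 2 (apply: tame_sum => ?).
  apply: eq_bigr => j _; rewrite mean_sum; last by move=> k; apply: tame_sum => ?.
  apply: eq_bigr => k _; rewrite mean_sum//.
  by apply: eq_bigr => l _; rewrite meanZ//; apply: tameM; exact: tameM.
rewrite (_ : \sum_i _ = \sum_i \sum_j \sum_k \sum_l (G i j ^+ 2 * G k l ^+ 2) +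
   \sum_i \sum_j \sum_k \sum_l (G i j * G k l * (G i k * G j l)) +
   \sum_i \sum_j \sum_k \sum_l (G i j * G k l * (G i l * G j k))); last first.
  rewrite -!big_split; apply: eq_bigr => i _.
  rewrite -!big_split; apply: eq_bigr => j _.
  rewrite -!big_split; apply: eq_bigr => k _.
  rewrite -!big_split; apply: eq_bigr => l _ /=.
  by rewrite (gspace_mean4 gH) //; ring.
have GC i j : G i j = G j i := covC _ _ _.
have b1 := cycle4_bound GC Grho.
rewrite -addrA; apply: lerD.
  rewrite expr2 /cov_frob big_distrl /=; apply: ler_sum => i _.
  rewrite big_distrl /=; apply: ler_sum => j _.
  rewrite big_distrr /=; apply: ler_sum => k _.
  by rewrite big_distrr.
rewrite -mulrA mulr_natl mulr2n; apply: lerD; apply: le_trans b1.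
  apply: ler_sum => i _; apply: ler_sum => j _; apply: ler_sum => k _; apply: ler_sum => l _.
  exact: ler_norm.
apply: ler_sum => i _; apply: ler_sum => j _; rewrite exchange_big.
apply: ler_sum => k _; apply: ler_sum => l _.
by rewrite (GC l k); exact: ler_norm.
Qed.

Definition std_sqnorm w : R := (sq w - tr) / Num.sqrt (2 * frob).

Local Notation S := std_sqnorm.

Lemma tame_std_sqnorm : tame P S.
Proof.
by apply: tameM; [apply: tameB => //; exact: tame_cst|exact: tame_cst].
Qed.

Hypothesis F0 : 0 < frob.

Let v := Num.sqrt (2 * frob).
Let v2 : v ^+ 2 = 2 * frob. Proof. by rewrite sqr_sqrtr// mulr_ge0// ltW. Qed.
Let v0 : 0 < v. Proof. by rewrite sqrtr_gt0 mulr_gt0. Qed.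

Lemma mean_std_sqnorm2 : mean P (fun w => S w ^+ 2) = 1.
Proof.
have tsq2 : tame P (fun w => sq w ^+ 2) by exact: tameX.
rewrite (eq_mean _ (g := fun w => v ^- 2 * (sq w ^+ 2 - (2 * tr * sq w - tr ^+ 2)))); last first.
  by move=> w; rewrite /std_sqnorm exprMn exprVn mulrC; congr (_ * _); ring.
have t2 : tame P (fun w => 2 * tr * sq w - tr ^+ 2).
  by apply: tameB; [exact: tameZ|exact: tame_cst].
rewrite meanZ; last exact: tameB.
rewrite meanB// meanB; [|exact: tameZ|exact: tame_cst].
rewrite meanZ// mean_cst (mean_sqnorm gH Hx) mean_sqnorm2 v2.
field; exact: lt0r_neq0.
Qed.

(** For F(y) = f((y - tr) / v), integration by parts reads E(S f(S)) = E(f'(S) T), where T = 2 Y^T G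
    Y / v^2 has mean 1. By Cauchy-Schwarz and [mean_quadform2], E|1 - T| is at most 2 rho / v. *)
Lemma stein_bound (f f' : R -> R) (K B : R) :
  (forall y : R, is_derive y 1 f (f' y)) -> continuous f' ->
  (forall y, K <= y -> f' y = 0) -> (forall y, `|f' y| <= B) ->
  `|mean P (fun w => f' (S w) - S w * f (S w))| <= 2 * B * rho / v.
Proof.
move=> df cf' f'0 f'B; have B0 : 0 <= B by exact: le_trans (f'B 0).
(* There is at least one row, since [frob] is positive. *)
have rho0 : 0 <= rho.
  case: (pickP 'I_m) => [i _|h0]; first exact: le_trans (sumr_ge0 _ _) (Grho i).
  by move: F0; rewrite /cov_frob big1 ?ltxx// => i; have := h0 i.
have tS := tame_std_sqnorm; have mS := tame_measurable tS.
have mf : measurable_fun setT f.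
  by apply: continuous_measurable_fun => y; exact: drv_continuous (df y).
have tf' : tame P (fun w => f' (S w)).
  apply: (@tame_bounded _ _ _ _ _ B) => //; apply: measurableT_comp => //.
  exact: continuous_measurable_fun.
have tf : tame P (fun w => f (S w)).
  apply: (@tame_le _ _ _ P _ (fun w => `|f 0| + B * `|S w|)).
  - exact: measurableT_comp.
  - move=> w; rewrite (ger0_norm (x := _ + _)) ?addr_ge0 ?mulr_ge0//.
    have : `|f (S w) - f 0| <= B * `|S w|.
      have [s0|/ltW s0] := leP 0 (S w).
        by rewrite (ger0_norm s0); exact: (drv_lipschitz_ge0 s0 df).
      rewrite distrC (ler0_norm s0) -[- S w]add0r; exact: (drv_lipschitz s0).
    have := ler_normD (f 0) (f (S w) - f 0); rewrite addrC subrK; lra.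
  - by apply: tameD; [exact: tame_cst|apply: tameZ; exact: tame_norm].
pose F y := f ((y - tr) / v); pose F' y := f' ((y - tr) / v) * (1 / v).
have K1 : mean P (fun w => (sq w - tr) * F (sq w)) = 2 * mean P (fun w => quad w * F' (sq w)).
  apply: (@sqnorm_ibp _ _ _ P H gH m x Hx F F' (tr + K * v) (B * (1 / v))).
  - move=> y; have dy : is_derive y 1 (fun y => (y - tr) / v) (1 / v).
      apply: drv_eq (drvM (drvB (drv_id y) (drv_cst tr y)) (drv_cst v^-1 y)) _.
      by rewrite subr0 mulr0 addr0.
    exact: (drv_comp (df _) dy).
  - have caff : continuous (fun y => (y - tr) / v).
      by move=> y; exact: drv_continuous (drvM (drvB (drv_id y) (drv_cst tr y)) (drv_cst v^-1 y)).
    move=> y; apply: cvgMl; apply: (@continuous_comp _ _ _ (fun y => (y - tr) / v) f' y).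
      exact: caff.
    exact: cf'.
  - move=> y yK; rewrite /F' f'0 ?mul0r// ler_pdivlMr//; lra.
  - by move=> y; rewrite /F' normrM (ger0_norm (x := 1 / v)) ?divr_ge0 ?(ltW v0)// ler_wpM2r// divr_ge0// ltW.
pose Tq w := 2 / v ^+ 2 * quad w.
have tT : tame P Tq by exact: tameZ.
have E : mean P (fun w => S w * f (S w)) = mean P (fun w => f' (S w) * Tq w).
  transitivity (v^-1 * mean P (fun w => (sq w - tr) * F (sq w))).
    rewrite -meanZ; last by apply: tameM => //; apply: tameB => //; exact: tame_cst.
    by apply: eq_mean => w; rewrite /F /std_sqnorm mulrA [v^-1 * _]mulrC.
  rewrite K1 mulrA -meanZ; last by apply: tameM => //; apply: tameM => //; exact: tame_cst.
  apply: eq_mean => w; rewrite /F' /Tq /std_sqnorm -/v; move: (f' _) => z; field.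
  exact: lt0r_neq0.
have t1 : tame P (fun w => 1 - Tq w) by apply: tameB => //; exact: tame_cst.
rewrite meanB//; last exact: tameM.
rewrite E -meanB//; last exact: tameM.
apply: (@le_trans _ _ (B * mean P (fun w => `|1 - Tq w|))).
  rewrite -meanZ; last exact: tame_norm.
  apply: norm_mean_le.
  - by apply: tameB => //; exact: tameM.
  - by apply: tameZ; exact: tame_norm.
  - by move=> w; rewrite -[X in X - _]mulr1 -mulrBr normrM ler_wpM2r.
rewrite mulrAC -!mulrA [leRHS]mulrCA ler_wpM2l// mulrCA.
have n0 : 0 <= mean P (fun w => `|1 - Tq w|) by exact: mean_ge0.
rewrite -(ler_pXn2r (n := 2)) ?nnegrE ?mulr_ge0 ?invr_ge0 ?(ltW v0)//.
have := mean_CS (tame_norm t1) (tame_cst P 1).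
rewrite (_ : mean P (fun=> 1 ^+ 2) = 1) ?mulr1; last by rewrite expr1n mean_cst.
rewrite (_ : (fun w => `|1 - Tq w| * 1) = (fun w => `|1 - Tq w|)); last first.
  by apply/funext => w; rewrite mulr1.
move=> /le_trans; apply.
have tq2 : tame P (fun w => quad w ^+ 2) by exact: tameX.
rewrite (eq_mean _ (g := fun w => 1 - (2 * (2 / v ^+ 2) * quad w - (2 / v ^+ 2) ^+ 2 * quad w ^+ 2))); last first.
  by move=> w; rewrite real_normK ?num_real// /Tq; ring.
have tt : tame P (fun w => 2 * (2 / v ^+ 2) * quad w - (2 / v ^+ 2) ^+ 2 * quad w ^+ 2).
  by apply: tameB; exact: tameZ.
rewrite meanB//; last exact: tame_cst.
rewrite meanB; [|exact: tameZ|exact: tameZ].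
rewrite !meanZ// mean_cst (mean_quadform gH Hx).
have h := mean_quadform2.
apply: (@le_trans _ _ (1 - (2 * (2 / v ^+ 2) * frob - (2 / v ^+ 2) ^+ 2 * (frob ^+ 2 + 2 * rho ^+ 2 * frob)))).
  by rewrite lerD2l lerN2 lerD2l lerN2 ler_wpM2l// sqr_ge0.
rewrite !exprMn !exprVn v2 le_eqVlt; apply/orP; left; apply/eqP; field.
exact: lt0r_neq0.
Qed.

End SteinBound.

(** * From Stein's bound to convergence in distribution *)

Section TestFunctions.
Context {R : realType}.
Implicit Types (x y K b e : R).

Definition clamp x : R := Num.min 1 (Num.max 0 x).

Lemma clamp_ge0 x : 0 <= clamp x.
Proof. by rewrite /clamp le_min ler01 le_max lexx. Qed.

Lemma clamp_le1 x : clamp x <= 1.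
Proof. by rewrite /clamp ge_min lexx. Qed.

Lemma clamp1 x : 1 <= x -> clamp x = 1.
Proof. by move=> h; apply/min_idPl; rewrite le_max h orbT. Qed.

Lemma clamp0 x : x <= 0 -> clamp x = 0.
Proof. by move=> h; rewrite /clamp (max_idPl h); apply/min_idPr; exact: ler01. Qed.

Lemma clamp_lipschitz x y : `|clamp x - clamp y| <= `|x - y|.
Proof.
wlog xy : x y / x <= y => [H|].
  by have [/H//|/ltW /H] := leP x y; rewrite distrC [in leRHS]distrC.
rewrite distrC [leRHS]distrC (ger0_norm (x := y - x)) ?subr_ge0//.
rewrite /clamp; case: (ltP 0 x) => x0; case: (ltP 0 y) => y0.
- case: (ltP 1 x) => x1; case: (ltP 1 y) => y1; rewrite ler_norml; lra.
- lra.
- case: (ltP 1 y) => y1; case: (ltP 1 0) => // h; rewrite ler_norml; lra.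
- case: (ltP 1 0) => // h; rewrite ler_norml; lra.
Qed.

Lemma lipschitz_continuous (f : R -> R) c : 0 <= c ->
  (forall x y, `|f x - f y| <= c * `|x - y|) -> continuous f.
Proof.
move=> c0 h x; apply/cvgrPdist_le => e e0.
have c1 : 0 < c + 1 by rewrite ltr_wpDl.
near=> y; apply: le_trans (h _ _) _.
have : `|x - y| <= e / (c + 1).
  by near: y; apply: cvgr_dist_le; [exact: cvg_id|rewrite divr_gt0].
rewrite ler_pdivlMr//; have := normr_ge0 (x - y); nra.
Unshelve. all: by end_near. Qed.

(** [plateau] truncates test functions to compact support, as the solution of Stein's equation
    requires; [ramp] is a Lipschitz function squeezed between two indicators of half-lines, for
    comparing distribution functions. *)
Definition plateau K x : R := clamp (K + 1 - `|x|).
Definition ramp b e x : R := clamp ((b + e - x) / e).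

Lemma plateau_continuous K : continuous (plateau K).
Proof.
apply: (@lipschitz_continuous _ 1) => // x y; rewrite mul1r.
apply: le_trans (clamp_lipschitz _ _) _.
rewrite (_ : _ - _ = `|y| - `|x|); last by ring.
by rewrite [leRHS]distrC; exact: ler_dist_dist.
Qed.

Lemma plateau_out K x : K + 1 <= `|x| -> plateau K x = 0.
Proof. by move=> h; rewrite /plateau clamp0// subr_le0. Qed.

(** Chebyshev's inequality in pointwise form: against a variable of second moment 1, truncation
    loses at most K^-2. *)
Lemma plateau_tail K x : 0 < K -> 1 - plateau K x <= K ^- 2 * x ^+ 2.
Proof.
move=> K0; have [h|h] := leP `|x| K.
  rewrite /plateau clamp1; last by lra.
  by rewrite subrr mulr_ge0 ?invr_ge0 ?sqr_ge0.
apply: (@le_trans _ _ 1); first by rewrite gerBl clamp_ge0.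
rewrite mulrC ler_pdivlMr ?exprn_gt0// mul1r -(real_normK (num_real x)).
by rewrite lerXn2r ?nnegrE ?(ltW K0)// ltW.
Qed.

Lemma ramp_lipschitz b e x y : 0 < e -> `|ramp b e x - ramp b e y| <= e^-1 * `|x - y|.
Proof.
move=> e0; apply: le_trans (clamp_lipschitz _ _) _.
rewrite -mulrBl (_ : _ - _ = y - x); last by ring.
by rewrite normrM (gtr0_norm (x := e^-1)) ?invr_gt0// mulrC distrC.
Qed.

Lemma ramp_continuous b e : 0 < e -> continuous (ramp b e).
Proof.
move=> e0; apply: (@lipschitz_continuous _ e^-1); first by rewrite invr_ge0 ltW.
by move=> x y; exact: ramp_lipschitz.
Qed.

Lemma ramp_lb b e x : 0 < e -> (x <= b)%R%:R <= ramp b e x.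
Proof.
move=> e0; case: (leP x b) => h; last by rewrite /= mulr0n clamp_ge0.
rewrite /= mulr1n /ramp clamp1// ler_pdivlMr//; lra.
Qed.

Lemma ramp_ub b e x : 0 < e -> ramp b e x <= (x <= b + e)%R%:R.
Proof.
move=> e0; case: (leP x (b + e)) => h; first by rewrite /= mulr1n clamp_le1.
rewrite /= mulr0n /ramp clamp0// pmulr_lle0 ?invr_gt0//; lra.
Qed.

End TestFunctions.

Section SteinEquation.
Context {R : realType}.
Local Notation N := (normal_prob (0 : R) 1).
Local Notation p := (normal_pdf (0 : R) 1).
Local Notation mu := (@lebesgue_measure R).

Lemma tame_std_normal : tame N (fun x => x).
Proof.
apply: eq_tame (tame_normal_center 0 (oner_neq0 R)) => x.
by rewrite subr0.
Qed.

Lemma continuous_bounded_support (f : R -> R) K : continuous f ->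
  (forall x, K <= `|x| -> f x = 0) -> exists B, forall x, `|f x| <= B.
Proof.
move=> cf f0; have KK : - `|K| <= `|K| by rewrite ge0_cp.
have [c _ hc] : exists2 c, c \in `[- `|K|, `|K|] & forall t, t \in `[- `|K|, `|K|] -> `|f t| <= `|f c|.
  apply: (@EVT_max R (fun t => `|f t|)) => //.
  by apply: continuous_subspaceT => x; apply: cvg_norm; exact: cf.
exists `|f c| => x; have [xK|xK] := leP `|x| `|K|.
  by apply: hc; rewrite in_itv/= -ler_norml.
by rewrite f0 ?normr0// (le_trans (ler_norm K))// ltW.
Qed.

(* Since [h] has compact support and mean zero, the solution vanishes outside
   the support of [h]. *)
Lemma stein_equation (h : R -> R) K : continuous h ->
  (forall x, K <= `|x| -> h x = 0) -> mean N h = 0 ->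
  exists f f' : R -> R, exists B, [/\ forall x : R, is_derive x 1 f (f' x), continuous f',
    forall x, K <= x -> f' x = 0, forall x, `|f' x| <= B &
    forall x, f' x - x * f x = h x].
Proof.
move=> ch h0 mh0; have s0 := oner_neq0 R.
have [Bh hB] := continuous_bounded_support ch h0.
have mh : measurable_fun setT h by exact: continuous_measurable_fun.
have th : tame N h by exact: (@tame_bounded _ (measurableTypeR R) _ N h Bh mh hB).
have int : mu.-integrable setT (EFin \o (fun x => h x * p x)).
  apply: integrable_normal; first exact: mh.
  by have /integrableP[] := tame_integrable th.
(* Variation of constants: 1 / p solves the homogeneous equation f' = x f. *)
pose F x := \int[mu]_(t in [set` `]-oo, x]]) (h t * p t).
have chp : continuous (fun x => h x * p x).
  by move=> x; apply: cvgM; [exact: ch|exact: continuous_normal_pdf].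
have dF (x : R) : is_derive x 1 F (h x * p x).
  have [] := @continuous_FTC1 R (fun x => h x * p x) (BInfty _ true) x (x + 1).
  - by rewrite ltrDl.
  - exact: integrableS int.
  - by rewrite ltNyr.
  - exact: chp.
  by move=> h1 h2; split => //; rewrite -h2 derive1E.
have p0 x : p x != 0.
  rewrite (normal_pdf_expE 0 s0) mulf_neq0 ?gt_eqF ?expR_gt0// invr_gt0 sqrtr_gt0.
  by rewrite mulrn_wgt0// mulr_gt0 ?pi_gt0// expr1n.
(* To the right of the support, [F] is the whole integral, which is the mean of [h]. *)
have FK x : K <= x -> F x = 0.
  move=> Kx; rewrite -mh0 (mean_normal th) /F Rintegral_mkcond.
  apply: eq_Rintegral => t _; rewrite patchE; case: ifPn => // /negP.
  rewrite inE /= in_itv/= => /negP; rewrite -ltNge => xt.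
  by rewrite h0 ?mul0r// (le_trans Kx)// (le_trans (ltW xt))// ler_norm.
have FNK x : x <= - K -> F x = 0.
  move=> Kx; rewrite /F (@eq_Rintegral _ _ _ mu _ (fun=> 0)); first by rewrite Rintegral_cst// mul0r.
  move=> t; rewrite inE /= in_itv/= => tx; rewrite h0 ?mul0r//.
  by rewrite -normrN (le_trans _ (ler_norm _))//; lra.
pose f x := F x / p x; pose f' x := h x + x * f x.
have df (x : R) : is_derive x 1 f (f' x).
  have dp := drv_normal_pdf 0 s0 x.
  have dV : is_derive x 1 (fun y => (p y)^-1) (- (p x) ^- 2 * (- (x - 0) / 1 ^+ 2 * p x)).
    by apply: is_deriveV; first exact: p0.
  apply: drv_eq (drvM (dF x) dV) _; rewrite /f' /f; move: (p0 x) => px; field; exact: px.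
have cf' : continuous f'.
  move=> x; apply: cvgD; first exact: ch.
  by apply: cvgM; [exact: cvg_id|exact: drv_continuous (df x)].
have f'0 x : K <= `|x| -> f' x = 0.
  move=> Kx; rewrite /f' h0// /f add0r; have [x0|x0] := leP 0 x.
    by rewrite FK ?mul0r ?mulr0//; rewrite ger0_norm in Kx.
  by rewrite FNK ?mul0r ?mulr0//; rewrite ltr0_norm// in Kx; lra.
have [B hfB] := continuous_bounded_support cf' f'0.
exists f, f', B; split=> // x.
  by move=> Kx; apply: f'0; rewrite (le_trans Kx)// ler_norm.
by rewrite /f' addrK.
Qed.

End SteinEquation.

Section SteinConvergence.
Context {d : measure_display} {T : measurableType d} {R : realType}.
Variable P : probability T R.
Local Notation N := (normal_prob (0 : R) 1).

Let mN2 : mean N (fun x => x ^+ 2) = 1.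
Proof.
transitivity (mean N (fun x => (x - 0) ^+ 2)).
  by apply: eq_mean => x; rewrite subr0.
by rewrite (normal_moment2 0 (oner_neq0 R)) expr1n.
Qed.

Lemma tame_continuous01 {d' : measure_display} {T' : measurableType d'} (Q : probability T' R)
  (u : R -> R) (Y : T' -> R) : measurable_fun setT Y -> continuous u ->
  (forall x, 0 <= u x <= 1) -> tame Q (fun w => u (Y w)).
Proof.
move=> mY cu u01; apply: (@tame_bounded _ _ _ _ _ 1).
  by apply: measurableT_comp => //; exact: continuous_measurable_fun.
by move=> w; case/andP: (u01 (Y w)) => u0 u1; rewrite ger0_norm.
Qed.

Variable S : nat -> T -> R.
Hypothesis tS : forall n, tame P (S n).
Hypothesis S2 : \forall n \near \oo, mean P (fun w => S n w ^+ 2) = 1.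
Hypothesis steinS : forall (f f' : R -> R) (K B : R),
  (forall y : R, is_derive y 1 f (f' y)) -> continuous f' ->
  (forall y, K <= y -> f' y = 0) -> (forall y, `|f' y| <= B) ->
  mean P (fun w => f' (S n w) - S n w * f (S n w)) @[n --> \oo] --> (0 : R).

Let mS n : measurable_fun setT (S n). Proof. exact: tame_measurable (tS n). Qed.

Let plateau_mean {d' : measure_display} {T' : measurableType d'} (Q : probability T' R)
  (Y : T' -> R) K : 0 < K -> tame Q Y -> mean Q (fun w => Y w ^+ 2) = 1 ->
  mean Q (fun w => 1 - plateau K (Y w)) <= K ^- 2.
Proof.
move=> K0 tY Y2; rewrite -[leRHS]mulr1 -[X in _ <= _ * X]Y2 -meanZ; last exact: tameX.
have mY := tame_measurable tY.
apply: le_mean => [||w]; last exact: plateau_tail.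
- apply: tameB; first exact: tame_cst.
  apply: tame_continuous01 => //; first exact: plateau_continuous.
  by move=> x; rewrite clamp_ge0 clamp_le1.
- by apply: tameZ; exact: tameX.
Qed.

(** The function [u] is replaced by h = u g, with [g] a plateau. Zero mean is then reached by
    subtracting a multiple of [g] instead of a constant, which keeps the support compact; since both
    laws give [g] a mean within K^-2 of 1, the comparison of [h] follows. *)
Lemma stein_cvg (u : R -> R) : continuous u -> (forall x, 0 <= u x <= 1) ->
  mean P (fun w => u (S n w)) @[n --> \oo] --> mean N u.
Proof.
move=> cu u01; apply/cvgrPdist_le => e e0.
(* Four errors of size K^-2 are added: truncation under each law, the difference of the means of
   [g], and Stein's bound. *)
have [K K0 Ke] : exists2 K : R, 1 < K & 4 * K ^- 2 <= e.
  exists (1 + 4 / e); first by rewrite ltrDl divr_gt0.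
  have e4 : 0 < 4 / e by rewrite divr_gt0.
  rewrite ler_pdivrMr ?exprn_gt0 ?addr_gt0//.
  have -> : e * (1 + 4 / e) ^+ 2 = e + 8 + 4 * (4 / e) by field; exact: lt0r_neq0.
  lra.
have K0' : 0 < K by exact: lt_trans K0.
pose g := plateau K; pose h x := u x * g x.
have cg : continuous g by exact: plateau_continuous.
have g01 x : 0 <= g x <= 1 by rewrite clamp_ge0 clamp_le1.
have ch : continuous h by move=> x; apply: cvgM; [exact: cu|exact: cg].
have hb x : 0 <= h x <= g x.
  have /andP[? ?] := u01 x; have /andP[? ?] := g01 x.
  by rewrite mulr_ge0//= ler_piMl.
have h01 x : 0 <= h x <= 1.
  by have /andP[? ?] := g01 x; have /andP[-> /le_trans->] := hb x.
have tN := tame_std_normal (R := R).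
have mid := tame_measurable tN.
have tg := @tame_continuous01 _ _ N g _ mid cg g01.
have th := @tame_continuous01 _ _ N h _ mid ch h01.
have tu := @tame_continuous01 _ _ N u _ mid cu u01.
have tgS n := @tame_continuous01 _ _ P g _ (mS n) cg g01.
have thS n := @tame_continuous01 _ _ P h _ (mS n) ch h01.
have tuS n := @tame_continuous01 _ _ P u _ (mS n) cu u01.
have Kp : 0 < K ^- 2 by rewrite invr_gt0 exprn_gt0.
have K1 : K ^- 2 < 1 by rewrite invf_lt1 ?exprn_gt0// exprn_egt1.
have Ng : 1 - K ^- 2 <= mean N g.
  have := plateau_mean K0' tN mN2; rewrite meanB//; last exact: tame_cst.
  by rewrite mean_cst -/g; lra.
have Ng1 : mean N g <= 1.
  by rewrite -[leRHS](mean_cst N); apply: le_mean => // [|w]; [exact: tame_cst|case/andP: (g01 w)].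
have Nh0 : 0 <= mean N h by apply: mean_ge0 => w; case/andP: (h01 w).
have Nhg : mean N h <= mean N g by apply: le_mean => // w; case/andP: (hb w).
have Ng0 : 0 < mean N g by apply: lt_le_trans Ng; rewrite subr_gt0.
pose c := mean N h / mean N g.
have cE : c * mean N g = mean N h by rewrite divfK// gt_eqF.
have c0 : 0 <= c by rewrite divr_ge0// ltW.
have c1 : c <= 1 by rewrite ler_pdivrMr// mul1r.
have [f [f' [B [df cf' f'0 f'B fE]]]] : exists f f' : R -> R, exists B,
    [/\ forall x : R, is_derive x 1 f (f' x), continuous f',
    forall x, K + 1 <= x -> f' x = 0, forall x, `|f' x| <= B &
    forall x, f' x - x * f x = h x - c * g x].
  apply: stein_equation.
  - by move=> x; apply: cvgB; [exact: ch|apply: cvgMr; exact: cg].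
  - by move=> x Kx; rewrite /h /g plateau_out// !mulr0 subr0.
  - by rewrite meanB//; [rewrite meanZ// cE subrr|exact: tameZ].
have /cvgr0Pnorm_le/(_ _ Kp) H := steinS df cf' f'0 f'B.
have := H; apply: filterS2 S2 => n Sn2.
rewrite (eq_mean _ (g := fun w => h (S n w) - c * g (S n w))); last by move=> w; rewrite fE.
rewrite meanB//; last exact: tameZ.
rewrite meanZ// => Hn.
have Pg : 1 - K ^- 2 <= mean P (fun w => g (S n w)).
  have := plateau_mean K0' (tS n) Sn2; rewrite meanB//; last exact: tame_cst.
  by rewrite mean_cst -/g; lra.
have Pg1 : mean P (fun w => g (S n w)) <= 1.
  by rewrite -[leRHS](mean_cst P); apply: le_mean => // [|w]; [exact: tame_cst|case/andP: (g01 (S n w))].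
have uh x : 0 <= u x - h x <= 1 - g x.
  have /andP[? ?] := u01 x; have /andP[? ?] := g01 x.
  rewrite (_ : u x - h x = u x * (1 - g x)); last by rewrite /h; ring.
  by rewrite mulr_ge0 ?subr_ge0//= ler_piMl// subr_ge0.
have Nu : 0 <= mean N u - mean N h <= K ^- 2.
  rewrite -meanB// mean_ge0 /=; last by move=> w; case/andP: (uh w).
  apply: le_trans (plateau_mean K0' tN mN2); apply: le_mean.
  - exact: tameB.
  - by apply: tameB => //; exact: tame_cst.
  - by move=> w; case/andP: (uh w).
have Pu : 0 <= mean P (fun w => u (S n w)) - mean P (fun w => h (S n w)) <= K ^- 2.
  rewrite -meanB// mean_ge0 /=; last by move=> w; case/andP: (uh (S n w)).
  apply: le_trans (plateau_mean K0' (tS n) Sn2); apply: le_mean.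
  - exact: tameB.
  - by apply: tameB => //; exact: tame_cst.
  - by move=> w; case/andP: (uh (S n w)).
have cg1 : `|c * mean P (fun w => g (S n w)) - c * mean N g| <= K ^- 2.
  rewrite -mulrBr normrM (ger0_norm c0); apply: (@le_trans _ _ `|mean P (fun w => g (S n w)) - mean N g|).
    by rewrite ler_piMl.
  by rewrite ler_norml; clear -Pg Pg1 Ng Ng1; apply/andP; split; lra.
have arith (k nu nh pu ph cpg : R) : `|ph - cpg| <= k -> `|cpg - nh| <= k ->
    0 <= nu - nh <= k -> 0 <= pu - ph <= k -> 4 * k <= e -> `|nu - pu| <= e.
  clear; rewrite !ler_norml => /andP[? ?] /andP[? ?] /andP[? ?] /andP[? ?] ?.
  by apply/andP; split; lra.
by apply: arith Hn _ Nu Pu Ke; rewrite -cE.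
Qed.

(** Closeness in mean passes to Lipschitz functions, so the ramps starting at b - dl and b have
    nearly the same mean under [Y n] as under the normal law; they enclose the indicator of the
    half-line ending at [b]. *)
Lemma stein_clt (Y : nat -> T -> R) : (forall n, tame P (Y n)) ->
  mean P (fun w => `|Y n w - S n w|) @[n --> \oo] --> (0 : R) ->
  cvg_in_distribution P Y N.
Proof.
move=> tY YS b cb.
have mY n := tame_measurable (tY n).
pose I (c : R) : R -> R := fun x => (x <= c)%R%:R.
have IE c : I c = \1_[set` `]-oo, c]].
  by apply/funext => x; rewrite indicE mem_setE in_itv.
have tI (d' : measure_display) (T' : measurableType d') (Q : probability T' R) (Z : T' -> R) c :
    measurable_fun setT Z -> tame Q (fun w => I c (Z w)).
  move=> mZ; apply: (@tame_bounded _ _ _ _ _ 1).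
    by apply: measurableT_comp => //; rewrite IE; exact: measurable_indic.
  by move=> w; rewrite /I ger0_norm ?ler0n// lern1 leq_b1.
have mI (d' : measure_display) (T' : measurableType d') (Q : probability T' R) (Z : T' -> R) c :
    measurable_fun setT Z -> Q (Z @^-1` [set` `]-oo, c]]) = (mean Q (fun w => I c (Z w)))%:E.
  move=> mZ; have mA : measurable (Z @^-1` [set` `]-oo, c]]).
    by rewrite -[X in measurable X]setTI; apply: mZ => //; exact: measurable_itv.
  rewrite (eq_mean _ (g := \1_(Z @^-1` [set` `]-oo, c]]))); last first.
    by move=> w; rewrite IE !indicE.
  by rewrite /mean /Rintegral integral_indic// setIT fineK// fin_num_measure.
have PI n c : P (Y n @^-1` [set` `]-oo, c]]) = (mean P (fun w => I c (Y n w)))%:E.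
  exact: mI.
have NI c : N [set` `]-oo, c]] = (mean N (I c))%:E.
  exact: (mI _ (measurableTypeR R) N (fun x => x) c (@measurable_id _ _ setT)).
have r01 (c e x : R) : 0 <= ramp c e x <= 1 by rewrite clamp_ge0 clamp_le1.
rewrite [X in _ --> X](NI b); apply: cvg_EFin; first by apply: nearW => n; rewrite PI.
rewrite (_ : fine \o _ = (fun n => mean P (fun w => I b (Y n w)))); last first.
  by apply/funext => n /=; rewrite PI.
apply/cvgrPdist_le => e e0.
have e4 : 0 < e / 4 by rewrite divr_gt0.
have cN : {for b, continuous (fun y => mean N (I y))}.
  have : fine \o (fun y => N [set` `]-oo, y]]) @ b --> fine (N [set` `]-oo, b]]).
    apply: fine_cvg; rewrite fineK; first exact: cb.
    by rewrite NI.
  by rewrite NI /=; under eq_fun do rewrite /= NI.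
have [dl dl0 hdl] : exists2 dl : R, 0 < dl & forall y, `|b - y| <= dl -> `|mean N (I b) - mean N (I y)| <= e / 4.
  move/cvgrPdist_le : cN => /(_ _ e4) [dl /= dl0 h]; exists (dl / 2); first by rewrite divr_gt0.
  by move=> y hy; apply: h => /=; lra.
have mid := tame_measurable (tame_std_normal (R := R)).
have rc c : continuous (ramp c dl) := ramp_continuous dl0.
have tr n c := @tame_continuous01 _ _ P (ramp c dl) _ (mY n) (rc c) (r01 c dl).
have trS n c := @tame_continuous01 _ _ P (ramp c dl) _ (mS n) (rc c) (r01 c dl).
have trN c := @tame_continuous01 _ _ N (ramp c dl) _ mid (rc c) (r01 c dl).
have cv c : \forall n \near \oo, `|mean N (ramp c dl) - mean P (fun w => ramp c dl (S n w))| <= e / 4.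
  by move/cvgrPdist_le : (stein_cvg (rc c) (r01 c dl)) => /(_ _ e4).
have cvY : \forall n \near \oo, mean P (fun w => `|Y n w - S n w|) <= dl * (e / 4).
  have de : 0 < dl * (e / 4) by rewrite mulr_gt0.
  move/cvgr0Pnorm_le : YS => /(_ _ de); apply: filterS => n; exact: le_trans (ler_norm _).
have lip n c : mean P (fun w => `|Y n w - S n w|) <= dl * (e / 4) ->
    `|mean P (fun w => ramp c dl (Y n w)) - mean P (fun w => ramp c dl (S n w))| <= e / 4.
  move=> h; have tYS : tame P (fun w => `|Y n w - S n w|) by apply: tame_norm; exact: tameB.
  rewrite -meanB//; apply: (@le_trans _ _ (dl^-1 * mean P (fun w => `|Y n w - S n w|))).
    rewrite -meanZ//; apply: norm_mean_le => [||w]; last exact: ramp_lipschitz.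
      exact: tameB.
    exact: tameZ.
  by rewrite mulrC ler_pdivrMr// mulrC.
have up : mean N (ramp b dl) <= mean N (I (b + dl)).
  by apply: le_mean => [||w]; [exact: trN|exact: tI|exact: ramp_ub].
have lo : mean N (I (b - dl)) <= mean N (ramp (b - dl) dl).
  by apply: le_mean => [||w]; [exact: tI|exact: trN|exact: ramp_lb].
have d1 : `|mean N (I b) - mean N (I (b + dl))| <= e / 4.
  by apply: hdl; rewrite opprD addNKr normrN gtr0_norm.
have d2 : `|mean N (I b) - mean N (I (b - dl))| <= e / 4.
  by apply: hdl; rewrite opprB addrC subrK gtr0_norm.
near=> n.
have h1 : mean P (fun w => I b (Y n w)) <= mean P (fun w => ramp b dl (Y n w)).
  by apply: le_mean => [||w]; [exact: tI|exact: tr|exact: ramp_lb].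
have h2 : mean P (fun w => ramp (b - dl) dl (Y n w)) <= mean P (fun w => I b (Y n w)).
  apply: le_mean => [||w]; [exact: tr|exact: tI|].
  by apply: le_trans (ramp_ub _ _ dl0) _; rewrite subrK.
have hY : mean P (fun w => `|Y n w - S n w|) <= dl * (e / 4) by near: n.
have := lip n b hY; have := lip n (b - dl) hY.
have : `|mean N (ramp b dl) - mean P (fun w => ramp b dl (S n w))| <= e / 4 by near: n; exact: cv.
have : `|mean N (ramp (b - dl) dl) - mean P (fun w => ramp (b - dl) dl (S n w))| <= e / 4 by near: n; exact: cv.
have arith (a1 a2 b1 b2 nb n1 n2 y1 y2 z : R) : `|nb - b1| <= e / 4 -> `|nb - b2| <= e / 4 ->
    n1 <= b1 -> b2 <= n2 -> z <= y1 -> y2 <= z -> `|n2 - a2| <= e / 4 -> `|n1 - a1| <= e / 4 ->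
    `|y2 - a2| <= e / 4 -> `|y1 - a1| <= e / 4 -> `|nb - z| <= e.
  clear; rewrite !ler_norml => /andP[? ?] /andP[? ?] ? ? ? ? /andP[? ?] /andP[? ?] /andP[? ?] /andP[? ?].
  by apply/andP; split; lra.
move=> k1 k2 k3 k4; exact: arith d1 d2 up lo h1 h2 k1 k2 k3 k4.
Unshelve. all: by end_near.
Qed.

End SteinConvergence.

(** * Quadratic variations with a drift *)

Section MeanMoments.
Context {d : measure_display} {T : measurableType d} {R : realType}.
Variable P : probability T R.

Lemma expectation_mean (Y : T -> R) : fine 'E_P[Y] = mean P Y.
Proof. by rewrite unlock. Qed.

Lemma variance_mean (Y : T -> R) :
  fine 'V_P[Y] = mean P (fun w => (Y w - mean P Y) ^+ 2).
Proof.
rewrite /variance unlock expectation_mean expectation_mean.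
by apply: eq_mean => w.
Qed.

Lemma mean_norm_le_sqrt (Y : T -> R) : tame P Y ->
  mean P (fun w => `|Y w|) <= Num.sqrt (mean P (fun w => Y w ^+ 2)).
Proof.
move=> tY; have n0 : 0 <= mean P (fun w => `|Y w|) by exact: mean_ge0.
rewrite -[leLHS](ger0_norm n0) -sqrtr_sqr ler_wsqrtr//.
have := mean_CS (tame_norm tY) (tame_cst P 1).
rewrite (_ : mean P (fun=> 1 ^+ 2) = 1) ?mulr1; last by rewrite expr1n mean_cst.
rewrite (eq_mean _ (f := fun w => `|Y w| * 1) (g := fun w => `|Y w|)); last by move=> w; rewrite mulr1.
by rewrite (eq_mean _ (f := fun w => `|Y w| ^+ 2) (g := fun w => Y w ^+ 2))// => w; rewrite real_normK ?num_real.
Qed.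

End MeanMoments.

Section GaussianQuadraticVariation.
Context {d : measure_display} {T : measurableType d} {R : realType}.
Variables (P : probability T R) (H : set (T -> R)).
Hypothesis gH : gspace P H.
Variables (m : nat) (x : 'I_m -> T -> R) (mu : 'I_m -> R).
Hypothesis Hx : forall i, H (x i).

Local Notation sq := (sqnorm x).
Local Notation tr := (cov_trace P x).
Local Notation frob := (cov_frob P x).

Let tx i : tame P (x i) := gspace_tame gH (Hx i).
Let tsq : tame P sq := tame_sqnorm gH Hx.

Let L w := \sum_i mu i * x i w.
Let M2 := \sum_i mu i ^+ 2.
Let V w := \sum_i (x i w + mu i) ^+ 2.

Let VE w : V w = sq w + 2 * L w + M2.
Proof.
rewrite /V /sqnorm /L /M2 mulr_sumr -!big_split; apply: eq_bigr => i _ /=; ring.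
Qed.

Let tL : tame P L. Proof. by apply: tame_sum => i; exact: tameZ. Qed.

Let tV : tame P V.
Proof. by apply: tame_sum => i; apply: tameX; apply: tameD => //; exact: tame_cst. Qed.

Let L0 : mean P L = 0.
Proof.
rewrite /L mean_sum; last by move=> i; exact: tameZ.
by rewrite big1// => i _; rewrite meanZ// (gspace_mean gH (Hx i)) mulr0.
Qed.

Let mean_V : mean P V = tr + M2.
Proof.
rewrite (eq_mean _ (g := fun w => sq w + 2 * L w + M2)); last exact: VE.
have t2 : tame P (fun w => 2 * L w) by exact: tameZ.
rewrite !meanD ?meanZ ?mean_cst ?L0 ?(mean_sqnorm gH Hx) ?mulr0 ?addr0//.
- exact: tameD.
- exact: tame_cst.
Qed.

Let sqL : mean P (fun w => sq w * L w) = 0.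
Proof.
have t3 i j : tame P (fun w => mu j * (x i w ^+ 2 * x j w)).
  by apply: tameZ; apply: tameM => //; exact: tameX.
rewrite (eq_mean _ (g := fun w => \sum_i \sum_j mu j * (x i w ^+ 2 * x j w))); last first.
  move=> w; rewrite /sqnorm /L big_distrl; apply: eq_bigr => i _ /=.
  by rewrite mulr_sumr; apply: eq_bigr => j _; ring.
rewrite mean_sum; last by move=> i; exact: tame_sum.
rewrite big1// => i _; rewrite mean_sum// big1// => j _.
by rewrite meanZ ?(gspace_mean3 gH) ?mulr0//; apply: tameM => //; exact: tameX.
Qed.

(** The quadratic and linear parts are uncorrelated, their product being a combination of third
    moments. *)
Lemma variance_quadratic_variation :
  mean P (fun w => (V w - mean P V) ^+ 2) = 2 * frob + 4 * mean P (fun w => L w ^+ 2).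
Proof.
have tsq2 : tame P (fun w => sq w ^+ 2) by exact: tameX.
have tL2 : tame P (fun w => L w ^+ 2) by exact: tameX.
have tsL : tame P (fun w => sq w * L w) by exact: tameM.
rewrite mean_V (eq_mean _ (g := fun w => sq w ^+ 2 + (4 * L w ^+ 2 + (4 * (sq w * L w) + (tr ^+ 2 + (- 2 * tr * sq w + - 4 * tr * L w)))))); last first.
  by move=> w; rewrite VE; ring.
have t1 : tame P (fun w => - 2 * tr * sq w + - 4 * tr * L w) by apply: tameD; exact: tameZ.
have t2 : tame P (fun w => tr ^+ 2 + (- 2 * tr * sq w + - 4 * tr * L w)).
  by apply: tameD => //; exact: tame_cst.
have t3 : tame P (fun w => 4 * (sq w * L w) + (tr ^+ 2 + (- 2 * tr * sq w + - 4 * tr * L w))).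
  by apply: tameD => //; exact: tameZ.
rewrite meanD//; last by apply: tameD => //; exact: tameZ.
rewrite meanD//; last exact: tameZ.
rewrite meanD//; last exact: tameZ.
rewrite meanD//; last exact: tame_cst.
rewrite meanD; [|exact: tameZ|exact: tameZ].
rewrite mean_cst !meanZ// (mean_sqnorm gH Hx) (mean_sqnorm2 gH Hx) sqL L0; ring.
Qed.

Variable rho : R.
Hypothesis Grho : forall i, \sum_j `|cov P (x i) (x j)| <= rho.

(** Schur's test: mu^T G mu is at most [rho] times the squared norm of [mu]. *)
Lemma mean_linear2_le : mean P (fun w => L w ^+ 2) <= rho * M2.
Proof.
have t2 i j : tame P (fun w => mu i * mu j * (x i w * x j w)) by apply: tameZ; exact: tameM.
rewrite (eq_mean _ (g := fun w => \sum_i \sum_j mu i * mu j * (x i w * x j w))); last first.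
  move=> w; rewrite expr2 /L big_distrlr /=; apply: eq_bigr => i _; apply: eq_bigr => j _; ring.
rewrite mean_sum; last by move=> i; exact: tame_sum.
pose g i j := `|cov P (x i) (x j)|.
have gC i j : g i j = g j i by rewrite /g covC.
apply: (@le_trans _ _ (\sum_i \sum_j 2^-1 * (mu i ^+ 2 * g i j + mu j ^+ 2 * g i j))).
  apply: ler_sum => i _; rewrite mean_sum//; apply: ler_sum => j _.
  rewrite meanZ; last exact: tameM.
  rewrite -/(cov P (x i) (x j)); apply: le_trans (ler_norm _) _; rewrite !normrM -/(g i j).
  have g0 : 0 <= g i j by exact: normr_ge0.
  rewrite -[mu i ^+ 2](real_normK (num_real _)) -[mu j ^+ 2](real_normK (num_real _)).
  rewrite -subr_ge0 (_ : _ - _ = 2^-1 * (g i j * (`|mu i| - `|mu j|) ^+ 2)); last by field.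
  by rewrite mulr_ge0// mulr_ge0 ?sqr_ge0.
have E1 : \sum_i \sum_j mu i ^+ 2 * g i j <= rho * M2.
  rewrite /M2 mulr_sumr; apply: ler_sum => i _; rewrite -mulr_sumr mulrC.
  by apply: ler_wpM2r; [exact: sqr_ge0|exact: Grho].
have E2 : \sum_i \sum_j mu j ^+ 2 * g i j = \sum_i \sum_j mu i ^+ 2 * g i j.
  by rewrite exchange_big; apply: eq_bigr => i _; apply: eq_bigr => j _; rewrite gC.
rewrite (_ : \sum_i _ = 2^-1 * (\sum_i \sum_j mu i ^+ 2 * g i j + \sum_i \sum_j mu j ^+ 2 * g i j)).
  by rewrite E2; lra.
rewrite -big_split mulr_sumr; apply: eq_bigr => i _.
by rewrite -big_split mulr_sumr.
Qed.

(* [b] and [c] bound the biases due to the means and to the normalization;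
   [a * b] bounds the variance due to the means. *)
Lemma normalized_variation_approx (den C a b c : R) : 0 < frob -> 0 < den ->
  rho <= a * Num.sqrt (2 * frob) -> M2 <= b * Num.sqrt (2 * frob) ->
  `|tr - C * den| <= c * Num.sqrt (2 * frob) ->
  mean P (fun w => `|(V w / den - C) / Num.sqrt (fine 'V_P[fun w => V w / den])
     - std_sqnorm P x w|) <= 4 * (a * b) + 2 * Num.sqrt (a * b) + b + c.
Proof.
move=> F0 den0 ha hb hc; set v := Num.sqrt (2 * frob) in ha hb hc *.
have v0 : 0 < v by rewrite sqrtr_gt0 mulr_gt0.
have v2 : v ^+ 2 = 2 * frob by rewrite sqr_sqrtr// mulr_ge0// ltW.
pose l2 := mean P (fun w => L w ^+ 2).
have l20 : 0 <= l2 by apply: mean_ge0 => w; exact: sqr_ge0.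
pose W := Num.sqrt (2 * frob + 4 * l2).
have W2 : W ^+ 2 = v ^+ 2 + 4 * l2 by rewrite sqr_sqrtr ?v2// addr_ge0 ?mulr_ge0// ltW.
have vW : v <= W by rewrite ler_wsqrtr// lerDl mulr_ge0.
have W0 : 0 < W by exact: lt_le_trans vW.
have M0 : 0 <= M2 by apply: sumr_ge0 => i _; exact: sqr_ge0.
have b0 : 0 <= b by rewrite -(pmulr_lge0 _ v0); exact: le_trans hb.
have rho0 : 0 <= rho.
  case: (pickP 'I_m) => [i _|h0]; first exact: le_trans (sumr_ge0 _ _) (Grho i).
  by move: F0; rewrite /cov_frob big1 ?ltxx// => i; have := h0 i.
have a0 : 0 <= a by rewrite -(pmulr_lge0 _ v0); exact: le_trans ha.
have l2le : l2 <= a * b * v ^+ 2.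
  have l1 : l2 <= rho * M2 by exact: mean_linear2_le.
  have l3 : rho * M2 <= a * v * M2 by rewrite ler_wpM2r.
  apply: le_trans l1 _; apply: le_trans l3 _.
  by rewrite (_ : a * b * v ^+ 2 = a * v * (b * v)); [rewrite ler_wpM2l// mulr_ge0// ltW|ring].
have tVd : tame P (fun w => V w / den) by apply: tameM => //; exact: tame_cst.
have mVd : mean P (fun w => V w / den) = mean P V / den.
  by rewrite mulrC -meanZ//; apply: eq_mean => w; rewrite mulrC.
have var : Num.sqrt (fine 'V_P[fun w => V w / den]) = W / den.
  rewrite variance_mean mVd.
  rewrite (eq_mean _ (g := fun w => den ^- 2 * (V w - mean P V) ^+ 2)); last first.
    by move=> w; rewrite -mulrBl exprMn exprVn mulrC.
  rewrite meanZ; last by apply: tameX; apply: tameB => //; exact: tame_cst.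
  rewrite variance_quadratic_variation -/l2 sqrtrM; last by rewrite invr_ge0 sqr_ge0.
  by rewrite -exprVn sqrtr_sqr ger0_norm ?invr_ge0 ?(ltW den0)// mulrC.
rewrite var; set S := std_sqnorm P x.
have tS : tame P S by exact: (tame_std_sqnorm gH Hx).
(* Three errors: the change of standard deviation from [v] to [W], the linear term of the drift, and
   a deterministic bias. *)
have e w : (V w / den - C) / (W / den) - S w =
    (v / W - 1) * S w + (2 / W * L w + (M2 + (tr - C * den)) / W).
  rewrite VE /S /std_sqnorm -/v; field.
  by rewrite !lt0r_neq0.
rewrite (eq_mean _ (g := fun w => `|(v / W - 1) * S w + (2 / W * L w + (M2 + (tr - C * den)) / W)|)); last first.
  by move=> w; rewrite e.
have tnS := tame_norm tS; have tnL := tame_norm tL.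
(* For t = v / W in [0, 1], 1 - t <= 1 - t^2, which involves only the variances. *)
have vW1 : 0 <= 1 - v / W <= 4 * (a * b).
  rewrite subr_ge0 ler_pdivrMr// mul1r vW /=.
  have h1 : 1 - v / W <= (W ^+ 2 - v ^+ 2) / W ^+ 2.
    have -> : (W ^+ 2 - v ^+ 2) / W ^+ 2 = (1 - v / W) * (1 + v / W) by field; exact: lt0r_neq0.
    by rewrite ler_peMr ?subr_ge0 ?ler_pdivrMr ?mul1r// lerDl divr_ge0// ltW.
  apply: le_trans h1 _; rewrite ler_pdivrMr ?exprn_gt0// W2.
  have ab0 : 0 <= a * b by rewrite -(pmulr_lge0 _ (exprn_gt0 2 v0)); exact: le_trans l2le.
  have := mulr_ge0 ab0 l20; lra.
have ab0 : 0 <= a * b by rewrite -(pmulr_lge0 _ (exprn_gt0 2 v0)); exact: le_trans l2le.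
have cb : `|(M2 + (tr - C * den)) / W| <= b + c.
  rewrite normrM (ger0_norm (x := W^-1)) ?invr_ge0 ?(ltW W0)// ler_pdivrMr//.
  apply: le_trans (ler_normD _ _) _; rewrite (ger0_norm M0).
  have c0 : 0 <= c by rewrite -(pmulr_lge0 _ v0); exact: le_trans hc.
  rewrite mulrDl; apply: lerD.
    by apply: le_trans hb _; rewrite ler_wpM2l.
  by apply: le_trans hc _; rewrite ler_wpM2l.
apply: (@le_trans _ _ (mean P (fun w => 4 * (a * b) * `|S w| + (2 / W * `|L w| + (b + c))))).
  apply: le_mean.
  - apply: tame_norm; apply: tameD; first exact: tameZ.
    by apply: tameD; [exact: tameZ|exact: tame_cst].
  - by apply: tameD; [exact: tameZ|apply: tameD; [exact: tameZ|exact: tame_cst]].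
  - move=> w; apply: le_trans (ler_normD _ _) _; apply: lerD.
      rewrite normrM ler_wpM2r// ler0_norm ?opprB; first by case/andP: vW1.
      by rewrite -oppr_ge0 opprB; case/andP: vW1.
    apply: le_trans (ler_normD _ _) _; apply: lerD => //.
    by rewrite normrM ger0_norm// divr_ge0// ltW.
rewrite meanD; [|exact: tameZ|by apply: tameD; [exact: tameZ|exact: tame_cst]].
rewrite meanD; [|exact: tameZ|exact: tame_cst].
rewrite mean_cst !meanZ//.
have S1 : mean P (fun w => `|S w|) <= 1.
  by rewrite -sqrtr1 -(mean_std_sqnorm2 gH Hx F0); exact: mean_norm_le_sqrt.
have L1 : 2 / W * mean P (fun w => `|L w|) <= 2 * Num.sqrt (a * b).
  rewrite -mulrA ler_wpM2l// mulrC ler_pdivrMr//.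
  apply: le_trans (mean_norm_le_sqrt tL) _; rewrite -/l2.
  apply: (@le_trans _ _ (Num.sqrt (a * b) * v)); last by rewrite ler_wpM2l ?sqrtr_ge0.
  by rewrite -[X in _ * X](ger0_norm (ltW v0)) -sqrtr_sqr -sqrtrM// ler_wsqrtr.
rewrite -[leRHS]addrA -[leRHS]addrA; apply: lerD.
  by rewrite -[leRHS]mulr1 ler_wpM2l// mulr_ge0.
by rewrite lerD2r.
Qed.

End GaussianQuadraticVariation.

Section ArrayCLT.
Context {d : measure_display} {T : measurableType d} {R : realType}.
Variables (P : probability T R) (H : set (T -> R)).
Hypothesis gH : gspace P H.
Variables (m : nat -> nat) (x : forall n, 'I_(m n) -> T -> R) (mu : forall n, 'I_(m n) -> R).
Hypothesis Hx : forall n i, H (@x n i).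
Variables (C : R) (den rho : nat -> R).
Hypothesis Grho : forall n i, \sum_j `|cov P (@x n i) (@x n j)| <= rho n.

Local Notation tr n := (cov_trace P (@x n)).
Local Notation frob n := (cov_frob P (@x n)).
Local Notation F n := (Num.sqrt (2 * frob n)).

Hypothesis frob0 : \forall n \near \oo, 0 < frob n.
Hypothesis den0 : \forall n \near \oo, 0 < den n.
Hypothesis rhoF : rho n / F n @[n --> \oo] --> (0 : R).
Hypothesis muF : (\sum_i @mu n i ^+ 2) / F n @[n --> \oo] --> (0 : R).
Hypothesis trF : (tr n - C * den n) / F n @[n --> \oo] --> (0 : R).

(** The hypothesis on [rho] serves twice: it makes Stein's bound tend to 0, and together with the
    one on [mu] it makes the linear term of the drift negligible. *)
Lemma array_clt : cvg_in_distribution P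
  (fun n w => ((\sum_i (@x n i w + mu i) ^+ 2) / den n - C) /
     Num.sqrt (fine 'V_P[fun w => (\sum_i (@x n i w + mu i) ^+ 2) / den n]))
  (normal_prob 0 1).
Proof.
have tx n i : tame P (@x n i) := gspace_tame gH (Hx i).
have F0 : \forall n \near \oo, 0 < F n.
  by apply: filterS frob0 => n h; rewrite sqrtr_gt0 mulr_gt0.
apply: (@stein_clt _ _ _ P (fun n => std_sqnorm P (@x n))).
- by move=> n; exact: (tame_std_sqnorm gH (@Hx n)).
- by apply: filterS frob0 => n h; exact: (mean_std_sqnorm2 gH (@Hx n)).
- move=> f f' K B df cf' f'0 f'B.
  apply/cvgr0Pnorm_le => e e0.
  have cv : 2 * B * (rho n / F n) @[n --> \oo] --> 2 * B * 0 by apply: cvgMr.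
  rewrite mulr0 in cv; move/cvgr0Pnorm_le : cv => /(_ e e0) h.
  apply: filterS2 frob0 h => n fn; apply: le_trans; apply: le_trans (ler_norm _).
  rewrite mulrA; exact: (stein_bound gH (@Hx n) (@Grho n) fn df cf' f'0 f'B).
- move=> n; apply: tameM; last exact: tame_cst.
  apply: tameB; last exact: tame_cst.
  apply: tameM; last exact: tame_cst.
  by apply: tame_sum => i; apply: tameX; apply: tameD => //; exact: tame_cst.
pose a n := rho n / F n; pose b n := (\sum_i @mu n i ^+ 2) / F n.
pose c n := `|(tr n - C * den n) / F n|.
have ca : a n @[n --> \oo] --> (0 : R) by [].
have cb : b n @[n --> \oo] --> (0 : R) by [].
have cc : c n @[n --> \oo] --> (0 : R) by rewrite -[X in _ --> X](normr0 R); exact: cvg_norm.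
have cab : a n * b n @[n --> \oo] --> (0 : R) by rewrite -[X in _ --> X](mulr0 (0:R)); exact: cvgM.
have csq : Num.sqrt (a n * b n) @[n --> \oo] --> (0 : R).
  rewrite -[X in _ --> X](sqrtr0 R); apply: continuous_cvg => //; exact: sqrt_continuous.
have ct : 4 * (a n * b n) + 2 * Num.sqrt (a n * b n) + b n + c n @[n --> \oo] --> (0 : R).
  rewrite -[X in _ --> X](addr0 (0:R)); apply: cvgD => //.
  rewrite -[X in _ --> X](addr0 (0:R)); apply: cvgD => //.
  rewrite -[X in _ --> X](addr0 (0:R)); apply: cvgD.
    by rewrite -[X in _ --> X](mulr0 (4:R)); exact: cvgMr.
  by rewrite -[X in _ --> X](mulr0 (2:R)); exact: cvgMr.
apply/cvgr0Pnorm_le => e e0; move/cvgr0Pnorm_le : ct => /(_ e e0).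
apply: filterS3 frob0 den0 => n fn dn; apply: le_trans.
have Fn : 0 < F n by rewrite sqrtr_gt0 mulr_gt0.
rewrite ger0_norm ?mean_ge0//; apply: le_trans (ler_norm _).
apply: (normalized_variation_approx gH (@Hx n) (@Grho n) fn dn).
- by rewrite divfK// gt_eqF.
- by rewrite divfK// gt_eqF.
- by rewrite /c normrM (ger0_norm (x := (F n)^-1)) ?invr_ge0 ?(ltW Fn)// divfK// gt_eqF.
Qed.

End ArrayCLT.

(** * Differences of the semi-variogram *)

Section SignedPowers.
Context {R : realType}.
Implicit Types (x y p : R) (k : nat).

(* [spow k p] is proportional to the [k]-th derivative of a power of [|x|]. *)
Definition spow k p x : R := if odd k then x * `|x| `^ (p - 1) else `|x| `^ p.

Lemma spow_gt0 k p x : 0 < x -> spow k p x = x `^ p.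
Proof.
move=> x0; rewrite /spow (gtr0_norm x0); case: ifP => // _.
by rewrite -[X in X * _]powRr1 ?(ltW x0)// -powRD ?(gt_eqF x0) ?implybT// addrC subrK.
Qed.

Lemma spowN k p x : spow k p (- x) = (-1) ^+ k * spow k p x.
Proof.
rewrite /spow normrN -signr_odd; case: (odd k) => /=; last by rewrite expr0 mul1r.
by rewrite expr1 mulN1r mulNr.
Qed.

Lemma drv_powR x p : 0 < x -> is_derive x 1 (fun y => y `^ p) (p * x `^ (p - 1)).
Proof.
move=> x0; split; first by apply: derivable_powR; rewrite in_itv/= andbT.
by rewrite -derive1E powR_derive1// in_itv/= andbT.
Qed.

Lemma drv_near (f g : R -> R) x a : (\forall y \near x, f y = g y) ->
  is_derive x 1 f a -> is_derive x 1 g a.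
Proof. by move=> fg; apply: near_eq_is_derive => //; apply: filterS fg => y ->. Qed.

Lemma drv_spow_gt0 k p x : 0 < x -> is_derive x 1 (spow k p) (p * spow k.+1 (p - 1) x).
Proof.
move=> x0; rewrite spow_gt0//; apply: (drv_near _ (drv_powR p x0)).
near=> y; rewrite spow_gt0//; near: y; exact: lt_nbhsr.
Unshelve. all: by end_near. Qed.

Lemma drv_spow_neq0 k p x : x != 0 -> is_derive x 1 (spow k p) (p * spow k.+1 (p - 1) x).
Proof.
move=> x0; have [xp|xn] := ltP 0 x; first exact: drv_spow_gt0.
have {}xn : 0 < - x by rewrite oppr_gt0 lt_neqAle x0.
apply: (eq_drv (f := fun y => (-1) ^+ k * spow k p (- y))) => [y|].
  by rewrite spowN mulrA -exprMn mulrNN mulr1 expr1n mul1r.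
apply: drv_eq (drvZ _ (drv_comp (drv_spow_gt0 k p xn) (drvN (drv_id x)))) _.
rewrite spowN exprS; have := sqrr_sign R k; move: ((-1) ^+ k) => e e2.
move: (spow _ _ x) => z; transitivity (e ^+ 2 * (p * z)); [ring|by rewrite e2 mul1r].
Qed.

(** The difference quotient at 0 has absolute value |h|^(p - 1). *)
Lemma drv_spow0 k p : 1 < p -> is_derive (0 : R) 1 (spow k p) 0.
Proof.
move=> p1.
have cv : h^-1 *: ((spow k p \o shift 0) (h *: (1 : R)) - spow k p 0) @[h --> 0^'] --> (0 : R).
  apply/cvgr0Pnorm_le => e e0.
  have pp : 0 < p - 1 by rewrite subr_gt0.
  exists (e `^ (p - 1)^-1) => [|h /= he h0]; first exact: powR_gt0.
  have hn : 0 < `|h| by rewrite normr_gt0.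
  rewrite sub0r normrN in he.
  have s0 : spow k p 0 = 0.
    by rewrite /spow normr0 mul0r powR0 ?if_same// gt_eqF// (lt_trans _ p1).
  rewrite s0 subr0 addr0 [h *: 1]mulr1 normrM normfV.
  have -> : `|spow k p h| = `|h| `^ p.
    rewrite /spow; case: ifP => _; last by rewrite ger0_norm ?powR_ge0.
    rewrite normrM (ger0_norm (powR_ge0 _ _)) -[X in X * _]powRr1 ?normr_ge0//.
    by rewrite -powRD ?(gt_eqF hn) ?implybT// addrC subrK.
  rewrite -[X in X^-1]powRr1 ?normr_ge0// -powRN -powRD ?(gt_eqF hn) ?implybT//.
  rewrite addrC; have -> : e = (e `^ (p - 1)^-1) `^ (p - 1).
    by rewrite -powRrM mulVf ?gt_eqF// powRr1// ltW.
  by apply: ge0_ler_powR; rewrite ?nnegrE ?powR_ge0// ltW.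
split; first by apply/cvg_ex; exists 0.
exact/cvg_lim.
Qed.

Lemma drv_spow k p x : x != 0 \/ 1 < p -> is_derive x 1 (spow k p) (p * spow k.+1 (p - 1) x).
Proof.
have [->|x0] := eqVneq x 0; last by move=> _; exact: drv_spow_neq0.
case=> // p1; apply: drv_eq (drv_spow0 k p1) _.
rewrite /spow normr0 mul0r powR0 ?if_same ?mulr0// gt_eqF// subr_gt0//.
Qed.

Lemma spowM k p x c : 0 < c -> spow k p (c * x) = c `^ p * spow k p x.
Proof.
move=> c0; rewrite /spow normrM (gtr0_norm c0) !powRM ?normr_ge0 ?(ltW c0)//.
case: ifP => // _; rewrite mulrACA; congr (_ * _).
by rewrite -[X in X * _]powRr1 ?(ltW c0)// -powRD ?(gt_eqF c0) ?implybT// addrC subrK.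
Qed.

Lemma norm_spow k p x : x != 0 -> `|spow k p x| = `|x| `^ p.
Proof.
rewrite -normr_gt0 => x0; rewrite /spow; case: ifP => _; last by rewrite ger0_norm ?powR_ge0.
rewrite normrM (ger0_norm (powR_ge0 _ _)) -[X in X * _]powRr1 ?normr_ge0//.
by rewrite -powRD ?(gt_eqF x0) ?implybT// addrC subrK.
Qed.

End SignedPowers.

Section SecondDifference.
Context {R : realType}.
Implicit Types (a : seq R) (g h : R -> R) (x y delta B : R) (M p : nat).

(* The covariance of the [a]-differences at [u] and [u + x], as a function of
   the semi-variogram [g]. *)
Definition diff2 a g delta x : R :=
  - \sum_(k < size a) \sum_(l < size a) a`_k * a`_l * g (x + (l%:R - k%:R) * delta).

Definition abs_sum a : R := \sum_(k < size a) `|a`_k|.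

Lemma abs_sum_ge0 a : 0 <= abs_sum a.
Proof. exact: sumr_ge0. Qed.

Lemma eq_diff2 a g h delta x : g =1 h -> diff2 a g delta x = diff2 a h delta x.
Proof. by move=> /funext ->. Qed.

Lemma diff2D a g h delta x :
  diff2 a (fun y => g y + h y) delta x = diff2 a g delta x + diff2 a h delta x.
Proof.
rewrite /diff2 -opprD -big_split /=; congr (- _); apply: eq_bigr => k _.
by rewrite -big_split /=; apply: eq_bigr => l _; rewrite mulrDr.
Qed.

Lemma diff2Z a c g delta x : diff2 a (fun y => c * g y) delta x = c * diff2 a g delta x.
Proof.
rewrite /diff2 mulrN mulr_sumr; congr (- _); apply: eq_bigr => k _.
by rewrite mulr_sumr; apply: eq_bigr => l _; rewrite mulrCA.
Qed.

Lemma diff2_sum a n (g : nat -> R -> R) delta x :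
  diff2 a (fun y => \sum_(i < n) g i y) delta x = \sum_(i < n) diff2 a (g i) delta x.
Proof.
elim: n => [|n IH].
  rewrite big_ord0 /diff2 big1 ?oppr0// => k _.
  by rewrite big1 // => l _; rewrite big_ord0 mulr0.
rewrite big_ord_recr /= -IH -diff2D; apply: eq_diff2 => y; by rewrite big_ord_recr.
Qed.

Definition vanishing_moments a M :=
  forall k : nat, (k < M)%N -> \sum_(j < size a) a`_j * j%:R ^+ k = 0.

Lemma vanishing_moments_shift a M p y delta : vanishing_moments a M -> (p < M)%N ->
  \sum_(j < size a) a`_j * (y + j%:R * delta) ^+ p = 0.
Proof.
move=> va pM.
under eq_bigr do rewrite exprDn mulr_sumr.
rewrite exchange_big big1 //= => i _.
transitivity ((\sum_(j < size a) a`_j * j%:R ^+ i) * (y ^+ (p - i) * delta ^+ i * 'C(p, i)%:R)).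
  by rewrite mulr_suml; apply: eq_bigr => j _; rewrite -[_ *+ _]mulr_natr exprMn; ring.
by rewrite va ?mul0r// (leq_ltn_trans _ pM)// -ltnS.
Qed.

(** Two applications of the sequence double its order: after binomial expansion the exponents are p
    - i and i, and one of them is below [M]. *)
Lemma diff2_poly a M p y x delta : vanishing_moments a M -> (p < 2 * M)%N ->
  diff2 a (fun z => (z - y) ^+ p) delta x = 0.
Proof.
move=> va pM; apply/eqP; rewrite oppr_eq0; apply/eqP.
transitivity (\sum_(k < size a) \sum_(l < size a) \sum_(i < p.+1) a`_k * a`_l *
    ((- (k%:R * delta)) ^+ (p - i) * (x - y + l%:R * delta) ^+ i *+ 'C(p, i))).
  apply: eq_bigr => k _; apply: eq_bigr => l _; rewrite -mulr_sumr -exprDn.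
  by congr (_ * _ ^+ _); ring.
under eq_bigr do rewrite exchange_big.
rewrite exchange_big big1 //= => i _.
have ip : (i <= p)%N by rewrite -ltnS.
transitivity ('C(p, i)%:R * (\sum_(k < size a) a`_k * (0 + k%:R * - delta) ^+ (p - i)) *
  (\sum_(l < size a) a`_l * (x - y + l%:R * delta) ^+ i)).
  rewrite -mulrA big_distrl mulr_sumr; apply: eq_bigr => k _ /=.
  rewrite mulr_sumr mulr_sumr; apply: eq_bigr => l _.
  by rewrite -[_ *+ _]mulr_natr add0r mulrN; ring.
have [iM|Mi] := ltnP i M; first by rewrite (vanishing_moments_shift _ _ va iM) mulr0.
rewrite (vanishing_moments_shift _ _ va (p := p - i)) ?mulr0 ?mul0r//; lia.
Qed.

Lemma diff2_le a g delta x B : 0 <= delta ->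
  (forall y, `|y - x| <= (size a).-1%:R * delta -> `|g y| <= B) ->
  `|diff2 a g delta x| <= abs_sum a ^+ 2 * B.
Proof.
move=> d0 gB; rewrite /diff2 normrN (_ : _ * B = \sum_(k < size a) \sum_(l < size a) `|a`_k| * (`|a`_l| * B)).
  apply: le_trans (ler_norm_sum _ _ _) _; apply: ler_sum => k _.
  apply: le_trans (ler_norm_sum _ _ _) _; apply: ler_sum => l _; rewrite !normrM -mulrA.
  rewrite ler_wpM2l// ler_wpM2l// gB// addrAC subrr add0r normrM (ger0_norm d0) ler_wpM2r//.
  have lt_k := ltn_ord k; have lt_l := ltn_ord l.
  have [kl|/ltnW kl] := leqP k l; last rewrite distrC.
    by rewrite -natrB// ger0_norm ?ler0n// ler_nat; lia.
  by rewrite -natrB// ger0_norm ?ler0n// ler_nat; lia.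
rewrite expr2 -mulrA mulr_suml; apply: eq_bigr => k _.
by rewrite mulr_suml mulr_sumr.
Qed.

(** The Taylor polynomial at [x] has degree below p <= 2M and is annihilated, so only the remainder
    over the window of nodes is left. *)
Lemma diff2_taylor a M p (g : nat -> R -> R) delta x B :
  vanishing_moments a M -> (p <= 2 * M)%N -> 0 <= delta ->
  (forall k y, (k < p)%N -> `|y - x| <= (size a).-1%:R * delta ->
    is_derive y 1 (g k) (g k.+1 y)) ->
  (forall y, `|y - x| <= (size a).-1%:R * delta -> `|g p y| <= B) ->
  `|diff2 a (g 0%N) delta x| <= abs_sum a ^+ 2 * (B * ((size a).-1%:R * delta) ^+ p).
Proof.
move=> va pM d0 dg gB; set rho := (size a).-1%:R * delta.
have rho0 : 0 <= rho by rewrite mulr_ge0.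
have B0 : 0 <= B by apply: le_trans (normr_ge0 _) (gB x _); rewrite subrr normr0.
have I y : (x - rho <= y <= x + rho) = (`|y - x| <= rho) by rewrite ler_distl.
rewrite (@eq_diff2 _ _ (fun y => (g 0%N y - \sum_(k < p) g k x * (y - x) ^+ k / k`!%:R) +
    \sum_(k < p) g k x / k`!%:R * (y - x) ^+ k)); last first.
  move=> y; under [X in _ = _ + X]eq_bigr do rewrite mulrAC.
  by rewrite subrK.
rewrite diff2D (@diff2_sum a p (fun k y => g k x / k`!%:R * (y - x) ^+ k)).
rewrite [X in _ + X]big1 ?addr0 => [|k _]; last first.
  rewrite diff2Z (diff2_poly _ _ _ va) ?mulr0//.
  exact: leq_trans (ltn_ord k) pM.
apply: diff2_le => // y yx.
have : `|y - x| ^+ p <= rho ^+ p by rewrite lerXn2r ?nnegrE.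
move=> /(ler_wpM2l B0); apply: le_trans.
apply: (@taylor_bound _ p g (x - rho) (x + rho)).
- by move=> k z kp; rewrite I; exact: dg.
- by move=> z; rewrite I; exact: gB.
- by rewrite I subrr normr0.
- by rewrite I.
Qed.

End SecondDifference.

(** * The homogeneous model W and the normalizing constant *)

Section AbsolutePowers.
Context {R : realType}.
Implicit Types (x y c s : R) (k D : nat).

(** The second product results from [k] differentiations of |x|^(2D+s); the inverse factor sets the
    coefficient at k = 2D to 1. *)
Definition abspow_coef D s k : R :=
  (\prod_(i < 2 * D) ((2 * D)%:R + s - i%:R))^-1 * \prod_(i < k) ((2 * D)%:R + s - i%:R).

(* [abspow D s k] is the [k]-th derivative of the multiple of
   [`|x| `^ (2 * D + s)] whose derivative of order [2 * D] is [`|x| `^ s]. *)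
Definition abspow D s k x : R := abspow_coef D s k * spow k ((2 * D)%:R + s - k%:R) x.

Lemma abspow_exponent_gt0 D s k : 0 < s -> (k <= 2 * D)%N -> 0 < (2 * D)%:R + s - k%:R.
Proof. by move=> s0 kD; rewrite addrAC -natrB// ltr_wpDl. Qed.

Lemma abspowE D s x : 0 < s -> abspow D s (2 * D) x = `|x| `^ s.
Proof.
move=> s0; rewrite /abspow /abspow_coef mulVf ?mul1r; last first.
  by apply/prodf_neq0 => i _; rewrite gt_eqF// abspow_exponent_gt0// ltnW.
by rewrite addrAC subrr add0r /spow mul2n odd_double.
Qed.

Lemma drv_abspow D s k x : 0 < s -> x != 0 \/ (k < 2 * D)%N ->
  is_derive x 1 (abspow D s k) (abspow D s k.+1 x).
Proof.
move=> s0 xk; rewrite /abspow /abspow_coef big_ord_recr /= !mulrA.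
have h : x != 0 \/ 1 < (2 * D)%:R + s - k%:R.
  case: xk => [|kD]; [by left|right].
  rewrite addrAC -natrB; last exact: ltnW.
  by rewrite (le_lt_trans (y := (2 * D - k)%:R)) ?ltrDl// ler1n subn_gt0.
apply: drv_eq (drvZ _ (drv_spow k h)) _.
by rewrite mulrA -natr1 opprD addrA.
Qed.

Lemma abspow_scale D s k x c : 0 < c ->
  abspow D s k (c * x) = c `^ ((2 * D)%:R + s - k%:R) * abspow D s k x.
Proof. by move=> c0; rewrite /abspow spowM// mulrCA. Qed.

Lemma norm_abspow D s k x : x != 0 ->
  `|abspow D s k x| = `|abspow_coef D s k| * `|x| `^ ((2 * D)%:R + s - k%:R).
Proof. by move=> x0; rewrite /abspow normrM norm_spow. Qed.

Lemma diff2_abspow_scale (a : seq R) D s x c : 0 < c ->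
  diff2 a (abspow D s 0) c (x * c) =
  c `^ ((2 * D)%:R + s) * diff2 a (abspow D s 0) 1 x.
Proof.
move=> c0; rewrite -diff2Z /diff2; congr (- _).
apply: eq_bigr => k _; apply: eq_bigr => l _; congr (_ * _).
by rewrite mulr1 -mulrDl mulrC abspow_scale// subr0.
Qed.

Lemma abspow_at0 D s k : 0 < s -> (k < 2 * D)%N -> abspow D s k 0 = 0.
Proof.
move=> s0 kD; rewrite /abspow /spow normr0 mul0r powR0 ?if_same ?mulr0//.
by rewrite gt_eqF// abspow_exponent_gt0// ltnW.
Qed.

Lemma continuous_norm_powR s : 0 < s -> continuous (fun x : R => `|x| `^ s).
Proof.
move=> s0 x; have [->|x0] := eqVneq x 0; last exact: drv_continuous (drv_spow_neq0 0 s x0).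
rewrite /continuous_at normr0 powR0 ?gt_eqF//; apply/cvgr0Pnorm_le => e e0.
near=> y; rewrite ger0_norm ?powR_ge0//.
rewrite (_ : e = (e `^ s^-1) `^ s); last by rewrite -powRrM mulVf ?gt_eqF// powRr1// ltW.
rewrite ge0_ler_powR ?nnegrE ?powR_ge0// ?(ltW s0)//.
near: y; have := @nbhs0_le R R (e `^ s^-1) (powR_gt0 _ e0); exact.
Unshelve. all: by end_near. Qed.

(** Taylor's formula at 0 with integral remainder: the derivatives of W of order below 2D vanish
    there. *)
Lemma integral_abspow D s (j : R) : 0 < s -> (0 < D)%N ->
  j ^+ (2 * D) * (\int[lebesgue_measure]_(eta in `[0, 1])
     ((1 - eta) ^+ (2 * D).-1 / (2 * D).-1`!%:R * `|j * eta| `^ s)) = abspow D s 0 j.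
Proof.
move=> s0 D0.
(* Differentiating the Taylor sum in [eta] telescopes to the single term [f]. *)
pose F (q : nat) (eta : R) := \sum_(m < q) ((1 - eta) ^+ m / m`!%:R * j ^+ m * abspow D s m (j * eta)).
pose f q (eta : R) := (1 - eta) ^+ q / q`!%:R * j ^+ q.+1 * abspow D s q.+1 (j * eta).
have dW m (eta : R) : (m < 2 * D)%N -> is_derive eta 1 (fun e => abspow D s m (j * e)) (abspow D s m.+1 (j * eta) * j).
  move=> mD; apply: drv_comp; first by apply: drv_abspow => //; right.
  by apply: drv_eq (drvZ _ (drv_id eta)) _; rewrite mulr1.
have dF q (eta : R) : (q < 2 * D)%N -> is_derive eta 1 (F q.+1) (f q eta).
  elim: q => [|q IH] qD.
    apply: (eq_drv (f := fun e => abspow D s 0 (j * e))) => [e|].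
      by rewrite /F big_ord1 expr0 expr0 fact0 invr1 !mul1r.
    by apply: drv_eq (dW _ _ qD) _; rewrite /f expr0 fact0 invr1 !mul1r expr1 mulrC.
  apply: (eq_drv (f := fun e => F q.+1 e + (1 - e) ^+ q.+1 * ((q.+1)`!%:R^-1 * j ^+ q.+1 * abspow D s q.+1 (j * e)))) => [e|].
    by rewrite /F [RHS]big_ord_recr /= !mulrA.
  apply: drv_eq (drvD (IH (ltnW qD)) (drvM (drvX q.+1 (drvB (drv_cst 1 eta) (drv_id eta)))
     (drvZ _ (dW _ _ qD)))) _.
  rewrite /f factS natrM /= !exprS.
  have := fact_gt0 q; rewrite -(ltr_nat R) => /gt_eqF/negbT n1.
  have n2 : q.+1%:R != 0 :> R by rewrite pnatr_eq0.
  have e1 : (q`!%:R : R)^-1 = q.+1%:R * (q.+1%:R * q`!%:R)^-1 by rewrite invfM mulrA divff// mul1r.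
  rewrite e1; move: (_ * _)^-1 => u; ring.
have [q qD] : exists q, (2 * D)%N = q.+1 by exists (2 * D).-1; rewrite prednK// muln_gt0.
pose g (eta : R) := (1 - eta) ^+ (2 * D).-1 / (2 * D).-1`!%:R * `|j * eta| `^ s.
have fq eta : f q eta = j ^+ (2 * D) * g eta.
  by rewrite /f /g -(abspowE D)// qD /=; ring.
have cg : continuous g.
  move=> x; apply: cvgM.
    apply: drv_continuous (drvM (drvX (2 * D).-1 (drvB (drv_cst 1 x) (drv_id x))) (drv_cst _ x)).
  apply: (@continuous_comp _ _ _ (fun e => j * e) (fun y => `|y| `^ s)).
    exact: drv_continuous (drvZ _ (drv_id x)).
  exact: continuous_norm_powR.
have cf : continuous (f q) by rewrite (funext fq) => x; apply: cvgM; [exact: cvg_cst|exact: cg].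
have dFq (eta : R) : is_derive eta 1 (F q.+1) (f q eta) by apply: dF; rewrite qD.
have := drv_FTC2 ltr01 dFq cf.
rewrite -RintegralZl//; last first.
  apply: continuous_compact_integrable; first exact: segment_compact.
  exact: continuous_subspaceT.
move=> I; rewrite /Rintegral (_ : (\int[_]_(x in _) _)%E = (F q.+1 1 - F q.+1 0)%:E); last first.
  by rewrite -I; apply: eq_integral => x _; rewrite fq.
rewrite /= /F [X in _ - X]big1 => [|m _]; last by rewrite mulr0 abspow_at0 ?mulr0// qD.
rewrite subr0 big_ord_recl big1 => [|m _]; last by rewrite subrr expr0n /= !mul0r.
by rewrite expr0 expr0 fact0 invr1 !mul1r mulr1 addr0.
Qed.

Lemma sum_autoconv (a : seq R) (h : int -> R) :
  \sum_(j \in [set: int]) (autoconv a j * h j) =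
  \sum_(k < size a) \sum_(l < size a) a`_k * a`_l * h (k%:Z - l%:Z).
Proof.
(* This list contains the support of [autoconv a], which makes the sum over all integers finite. *)
set r := undup [seq p.1%:Z - p.2%:Z | p : 'I_(size a) * 'I_(size a)].
rewrite (@fsbigE _ _ _ _ _ r) ?undup_uniq//; last first.
  move=> j _; rewrite mem_undup => jr; rewrite /autoconv big1 ?mul0r// => k _.
  rewrite big1// => l /eqP kl; case/negP: jr; apply/mapP; exists (k, l) => //.
  exact: mem_enum.
under eq_bigl do rewrite in_setT.
under eq_bigr do rewrite mulr_suml.
rewrite exchange_big; apply: eq_bigr => k _ /=.
under eq_bigr do rewrite mulr_suml.
rewrite (exchange_big_dep predT)//=; apply: eq_bigr => l _.
rewrite -big_filter (_ : [seq _ <- _ | _] = [:: k%:Z - l%:Z]) ?big_seq1//.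
under eq_filter => j do rewrite eq_sym.
rewrite filter_pred1_uniq ?undup_uniq// mem_undup.
apply/mapP; exists (k, l) => //; exact: mem_enum.
Qed.

(** Identifies the constant in the denominator of the estimator with the a-covariance of W at lag 0
    and unit step. *)
Lemma remainder_abspow (a : seq R) D s : 0 < s ->
  remainder 0 1 (2 * D) (fun x => `|x| `^ s) (autoconv a) = diff2 a (abspow D s 0) 1 0.
Proof.
move=> s0.
transitivity (- \sum_(j \in [set: int]) (autoconv a j * abspow D s 0 j%:~R)).
  have [->|D0] := posnP D.
    rewrite muln0 /remainder; congr (- _); apply: eq_fsbigr => j _.
    by rewrite mulr1 add0r -(abspowE 0).
  have [q qD] : exists q, (2 * D)%N = q.+1 by exists (2 * D).-1; rewrite prednK// muln_gt0.
  rewrite qD /remainder; congr (- _); apply: eq_fsbigr => j _.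
  rewrite -mulrA -(integral_abspow j%:~R s0 D0) qD /=; congr (_ * (_ * _)).
  by apply: eq_Rintegral => x _; rewrite add0r mulr1.
rewrite /diff2; congr (- _); rewrite (sum_autoconv a (fun j => abspow D s 0 j%:~R)).
rewrite exchange_big /=; apply: eq_bigr => k _; apply: eq_bigr => l _.
by rewrite [a`_l * _]mulrC add0r mulr1 rmorphB.
Qed.

End AbsolutePowers.

(** * Expansion of the semi-variogram *)

Section Expansion.
Context {R : realType}.
Variables (V r : R -> R) (D : nat) (C s : R).
Hypothesis s_gt0 : 0 < s.
Hypothesis V_smooth : smooth_on [set x : R | 0 < x] V.
Hypothesis V_derivable : times_derivable (2 * D) V.
Hypothesis V_expansion : forall h : R,
  derive1n (2 * D) V h = derive1n (2 * D) V 0 + C * (-1) ^+ D * `|h| `^ s + r h.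

(** The derivatives of y^(2D) / (2D)!, which carries the constant V^(2D)(0). *)
Definition monomial_drv k (y : R) : R :=
  if (k <= 2 * D)%N then y ^+ (2 * D - k) / (2 * D - k)`!%:R else 0.

(** The derivatives of Q. The Taylor terms of [V] of degree below 2D are left inside Q: only Q^(2D)
    = r and higher derivatives enter the estimates. *)
Definition expansion_rest k (y : R) : R :=
  derive1n k V y + (- (C * (-1) ^+ D) * abspow D s k y +
    - derive1n (2 * D) V 0 * monomial_drv k y).

Lemma drv_monomial_drv k (y : R) : is_derive y 1 (monomial_drv k) (monomial_drv k.+1 y).
Proof.
rewrite /monomial_drv; case: (ltngtP k (2 * D)%N) => [kD|kD|->].
- apply: drv_eq (drvM (drvX (2 * D - k) (drv_id y)) (drv_cst _ y)) _.
  have -> : (2 * D - k)%N = (2 * D - k.+1).+1 by lia.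
  rewrite factS natrM mulr0 addr0 mulr1 /=.
  have e1 : ((2 * D - k.+1)`!%:R : R)^-1 =
      (2 * D - k.+1).+1%:R * ((2 * D - k.+1).+1%:R * (2 * D - k.+1)`!%:R)^-1.
    by rewrite invfM mulrA divff// mul1r.
  rewrite e1; move: (_ * _)^-1 => u; ring.
- exact: drv_cst.
- by rewrite subnn; apply: (eq_drv _ (drv_cst 1 y)) => z; rewrite expr0 fact0 divr1.
Qed.

Lemma drv_expansion_rest k (y : R) : 0 < y \/ (k < 2 * D)%N ->
  is_derive y 1 (expansion_rest k) (expansion_rest k.+1 y).
Proof.
move=> h; have dV : is_derive y 1 (derive1n k V) (derive1n k.+1 V y).
  rewrite derive1nS derive1E; apply: DeriveDef => //.
  by case: h => [y0|kD]; [exact: V_smooth|exact: V_derivable].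
have dW : is_derive y 1 (abspow D s k) (abspow D s k.+1 y).
  by apply: drv_abspow => //; case: h => [/gt_eqF/negbT|]; [left|right].
exact: drvD dV (drvD (drvZ _ dW) (drvZ _ (drv_monomial_drv k y))).
Qed.

Lemma expansion_restE y : expansion_rest (2 * D) y = r y.
Proof.
rewrite /expansion_rest V_expansion abspowE// /monomial_drv leqnn subnn expr0 fact0 divr1; ring.
Qed.

Lemma expansion_rest_derive j (y : R) : 0 < y ->
  expansion_rest (2 * D + j) y = derive1n j r y.
Proof.
elim: j y => [|j IH] y y0; first by rewrite addn0 expansion_restE.
rewrite derive1nS derive1E addnS.
have h : is_derive y 1 (derive1n j r) (expansion_rest (2 * D + j).+1 y).
  have d0 := drv_expansion_rest (k := 2 * D + j) (or_introl y0).
  apply: (@drv_near R (expansion_rest (2 * D + j)) (derive1n j r) y _ _ d0).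
  by near=> z; apply: IH; near: z; exact: lt_nbhsr.
by case: h.
Unshelve. all: by end_near. Qed.

Section Differences.
Variables (a : seq R) (M : nat).
Hypothesis a_moments : vanishing_moments a M.
Hypothesis lt_D_M : (D < M)%N.

Lemma diff2_expansion delta x :
  diff2 a V delta x = C * ((-1) ^+ D * diff2 a (abspow D s 0) delta x) +
    diff2 a (expansion_rest 0) delta x.
Proof.
rewrite [X in _ + X]diff2D (diff2D _ (fun y => - (C * (-1) ^+ D) * abspow D s 0 y)
  (fun y => - derive1n (2 * D) V 0 * monomial_drv 0 y)) !diff2Z.
have -> : diff2 a (monomial_drv 0) delta x = 0.
  rewrite (@eq_diff2 _ _ _ (fun y => (2 * D - 0)`!%:R^-1 * (y - 0) ^+ (2 * D))).
    by rewrite diff2Z (diff2_poly _ _ _ a_moments) ?mulr0//; lia.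
  by move=> y; rewrite /monomial_drv leq0n subn0 subr0 mulrC.
rewrite mulr0 addr0 /=; ring.
Qed.

(** For windows that may contain 0, where only 2D derivatives of [V] are given. *)
Lemma expansion_rest_near delta x B : 0 <= delta ->
  (forall y, `|y - x| <= (size a).-1%:R * delta -> `|r y| <= B) ->
  `|diff2 a (expansion_rest 0) delta x| <=
    abs_sum a ^+ 2 * (B * ((size a).-1%:R * delta) ^+ (2 * D)).
Proof.
move=> d0 rB; apply: (diff2_taylor a_moments) => //; first by lia.
  by move=> k y kD _; apply: drv_expansion_rest; right.
by move=> y /rB; rewrite expansion_restE.
Qed.

(** For windows inside the positive half-line, where [q] further derivatives of [V] exist. *)
Lemma expansion_rest_far q delta x B : 0 <= delta -> (2 * D + q <= 2 * M)%N ->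
  (size a).-1%:R * delta < x ->
  (forall y, 0 < y -> `|y - x| <= (size a).-1%:R * delta -> `|derive1n q r y| <= B) ->
  `|diff2 a (expansion_rest 0) delta x| <=
    abs_sum a ^+ 2 * (B * ((size a).-1%:R * delta) ^+ (2 * D + q)).
Proof.
move=> d0 qM dx rB; have pos y : `|y - x| <= (size a).-1%:R * delta -> 0 < y.
  by rewrite ler_distl => /andP[+ _]; apply: lt_le_trans; rewrite subr_gt0.
apply: (diff2_taylor a_moments) => // [k y _ /pos y0|y yx].
  by apply: drv_expansion_rest; left.
by rewrite expansion_rest_derive ?rB// pos.
Qed.

End Differences.
End Expansion.

Lemma abspow_far {R : realType} (a : seq R) M D s delta (x B : R) :
  0 < s -> vanishing_moments a M -> 0 <= delta -> (size a).-1%:R * delta < x ->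
  (forall y, 0 < y -> `|y - x| <= (size a).-1%:R * delta ->
     y `^ ((2 * D)%:R + s - (2 * M)%:R) <= B) ->
  `|diff2 a (abspow D s 0) delta x| <=
    abs_sum a ^+ 2 * (`|abspow_coef D s (2 * M)| * B * ((size a).-1%:R * delta) ^+ (2 * M)).
Proof.
move=> s0 va d0 dx rB; have pos y : `|y - x| <= (size a).-1%:R * delta -> 0 < y.
  by rewrite ler_distl => /andP[+ _]; apply: lt_le_trans; rewrite subr_gt0.
apply: (diff2_taylor va) => // [k y _ /pos y0|y yx].
  by apply: drv_abspow => //; left; rewrite gt_eqF.
have y0 := pos _ yx; rewrite norm_abspow ?gt_eqF// ler_wpM2l// gtr0_norm//.
exact: rB.
Qed.

(** * Nondegeneracy of the homogeneous model *)

Section Nondegeneracy.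
Context {R : realType}.
Implicit Types (a : seq R) (g : R -> R) (x y t s : R).

Lemma drv_diff2 a g (g' : R -> R) (delta x : R) : (forall y, is_derive y 1 g (g' y)) ->
  is_derive x 1 (diff2 a g delta) (diff2 a g' delta x).
Proof.
move=> dg; apply: drvN.
apply: (drv_sum (f := fun k y => \sum_(l < size a) a`_k * a`_l * g (y + (l%:R - k%:R) * delta))
  (f' := fun k => \sum_(l < size a) a`_k * a`_l * g' (x + (l%:R - k%:R) * delta))) => k _.
apply: (drv_sum (f := fun l y => a`_k * a`_l * g (y + (l%:R - k%:R) * delta))
  (f' := fun l => a`_k * a`_l * g' (x + (l%:R - k%:R) * delta))) => l _.
apply: drvZ; apply: drv_eq (drv_comp (dg _) (drvD (drv_id x) (drv_cst _ x))) _.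
by rewrite addr0 mulr1.
Qed.

(** Differentiate the vanishing function 2D times: the a-difference commutes with the derivative. *)
Lemma diff2_abspow_order0 a D s : 0 < s ->
  (forall x, diff2 a (abspow D s 0) 1 x = 0) -> forall x, diff2 a (fun y => `|y| `^ s) 1 x = 0.
Proof.
move=> s0 h0.
have hk k : (k <= 2 * D)%N -> forall x, diff2 a (abspow D s k) 1 x = 0.
  elim: k => // k IH kD x.
  have := drv_diff2 a 1 x (fun y => drv_abspow s0 (or_intror kD) : is_derive y 1 _ (abspow D s k.+1 y)).
  rewrite (_ : diff2 a (abspow D s k) 1 = fun=> 0); last by apply/funext => y; rewrite IH// ltnW.
  by move=> h; rewrite -(@derive_val _ _ _ _ _ _ _ h) derive_cst.
by move=> x; rewrite -(hk _ (leqnn _) x); apply: eq_diff2 => y; rewrite abspowE.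
Qed.

(** With y >= 1 and t <= 1/2 the three points stay above 1/2, where the second derivative is bounded
    because s < 2. *)
Lemma second_difference_powR s y t : 0 < s -> s < 2 -> 1 <= y -> 0 < t <= 1 / 2 ->
  `| `|y + t| `^ s + `|y - t| `^ s - 2 * `|y| `^ s| <=
    2 * (`|s * (s - 1)| * (1 / 2) `^ (s - 2)) * t ^+ 2.
Proof.
move=> s0 s2 y1 /andP[t0 t1].
pose g k x := if k is k'.+1 then (if k' is _.+1 then s * ((s - 1) * spow 2 (s - 1 - 1) x)
  else s * spow 1 (s - 1) x) else spow 0 s x.
set B := _ * (1 / 2) `^ _.
have T z : 1 / 2 <= z -> `|g 0%N z - (g 0%N y + g 1%N y * (z - y))| <= B * `|z - y| ^+ 2.
  move=> z1.
  have dg k x : (k < 2)%N -> 1 / 2 <= x <= y + z -> is_derive x 1 (g k) (g k.+1 x).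
    move=> k2 /andP[x1 _]; have xn : x != 0 by rewrite gt_eqF//; lra.
    case: k k2 => [|[|//]] _; first exact: (drv_spow_neq0 0 s xn).
    by apply: drvZ; exact: (drv_spow_neq0 1 (s - 1) xn).
  have gB x : 1 / 2 <= x <= y + z -> `|g 2%N x| <= B.
    move=> /andP[x1 _]; have x0 : 0 < x by lra.
    rewrite /g spow_gt0// mulrA normrM ler_wpM2l// ger0_norm ?powR_ge0//.
    have -> : s - 1 - 1 = - (2 - s) by ring.
    have -> : s - 2 = - (2 - s) by ring.
    rewrite !powRN lef_pV2 ?posrE ?powR_gt0//.
    have s2' : 0 <= 2 - s by rewrite subr_ge0 ltW.
    by rewrite ge0_ler_powR ?nnegrE//; lra.
  have := taylor_bound dg gB (x := y) (y := z); rewrite !big_ord_recl big_ord0 /=.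
  rewrite !expr0 fact0 mulr1 divr1 expr1 divr1 addr0; apply; lra.
have hp := T (y + t) ltac:(lra); have hm := T (y - t) ltac:(lra).
have e1 : y + t - y = t by ring.
have e2 : y - t - y = - t by ring.
move: hp hm; rewrite e1 e2 normrN (gtr0_norm t0) /g /spow /= => hp hm.
rewrite (_ : _ - _ = (`|y + t| `^ s - (`|y| `^ s + s * (y * `|y| `^ (s - 1 - 1)) * t)) +
  (`|y - t| `^ s - (`|y| `^ s + s * (y * `|y| `^ (s - 1 - 1)) * - t))); last by ring.
apply: le_trans (ler_normD _ _) _.
rewrite (_ : 2 * B * t ^+ 2 = B * t ^+ 2 + B * t ^+ 2); last by ring.
exact: lerD.
Qed.

(** Take the second difference of step [t] at J = L - 1. Among the shifts J + l - k, only (k, l) =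
    (J, 0) meets the singularity, contributing 2 t^s times a product of the two end terms; the other
    shifts are at least 1 and contribute O(t^2). Vanishing would give t^s = O(t^2). *)
Lemma diff2_powR_neq0 a s : 0 < s -> s < 2 -> diff_seq a -> (1 < size a)%N ->
  ~ (forall x, diff2 a (fun y => `|y| `^ s) 1 x = 0).
Proof.
move=> s0 s2 [a0 aL] a1 h0.
set J := (size a).-1 in aL.
set B := `|s * (s - 1)| * (1 / 2) `^ (s - 2).
have key t : 0 < t <= 1 / 2 -> 2 * t `^ s * `|a`_J * a`_0| <= abs_sum a ^+ 2 * (2 * B * t ^+ 2).
  move=> t01; have t0 : 0 < t by case/andP: t01.
  pose u (k l : nat) := `|J%:R + t + (l%:R - k%:R) * 1| `^ s +
    `|J%:R - t + (l%:R - k%:R) * 1| `^ s - 2 * `|J%:R + (l%:R - k%:R) * 1| `^ s.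
  have su : \sum_(k < size a) \sum_(l < size a) a`_k * a`_l * u k l = 0.
    pose S z : R := \sum_(k < size a) \sum_(l < size a) a`_k * a`_l * `|z + (l%:R - k%:R) * 1| `^ s.
    have S0 z : S z = 0 by apply/eqP; rewrite -oppr_eq0; apply/eqP; exact: h0.
    transitivity (S (J%:R + t) + S (J%:R - t) + (-2) * S J%:R); last by rewrite !S0; ring.
    rewrite /S mulr_sumr -!big_split; apply: eq_bigr => k _ /=.
    rewrite mulr_sumr -!big_split; apply: eq_bigr => l _ /=.
    by rewrite /u; ring.
  (* The part of [u] due to the singular pair. *)
  pose v (k l : nat) := if (k == J) && (l == 0)%N then 2 * t `^ s else 0.
  have sv : \sum_(k < size a) \sum_(l < size a) a`_k * a`_l * v k l = 2 * t `^ s * (a`_J * a`_0).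
    have J1 : (J < size a)%N by rewrite /J; lia.
    have J2 : (0 < size a)%N by lia.
    rewrite (bigD1 (Ordinal J1))//= [X in _ + X]big1 ?addr0 => [|k kJ]; last first.
      have {}kJ : (k == J :> nat) = false by apply/negbTE.
      by rewrite big1// => l _; rewrite /v kJ mulr0.
    rewrite (bigD1 (Ordinal J2))//= [X in _ + X]big1 ?addr0 => [|l l0]; last first.
      have {}l0 : (l == 0 :> nat)%N = false by apply/negbTE.
      by rewrite /v l0 andbF mulr0.
    by rewrite /v !eqxx mulrC.
  have uv k l : (k < size a)%N -> (l < size a)%N -> `|u k l - v k l| <= 2 * B * t ^+ 2.
    move=> kL lL; rewrite /u /v mulr1.
    have [/andP[/eqP-> /eqP->]|kl] := ifPn.
      have -> : J%:R + t + (0%:R - J%:R) = t :> R by ring.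
      have -> : J%:R - t + (0%:R - J%:R) = - t :> R by ring.
      have -> : J%:R + (0%:R - J%:R) = 0 :> R by ring.
      rewrite normrN normr0 powR0 ?gt_eqF// (gtr0_norm t0) (_ : _ - _ = 0); last by ring.
      by rewrite normr0 mulr_ge0 ?sqr_ge0// !mulr_ge0 ?powR_ge0.
    rewrite subr0 [J%:R + t + _]addrAC [J%:R - t + _]addrAC.
    apply: second_difference_powR => //.
    rewrite addrA -natrD lerBrDr nat1r ler_nat; move: kl; rewrite /J; lia.
  rewrite (_ : 2 * t `^ s * _ = `|2 * t `^ s * (a`_J * a`_0)|); last first.
    by rewrite [RHS]normrM [`|2 * _|]ger0_norm// mulr_ge0 ?powR_ge0.
  have -> : 2 * t `^ s * (a`_J * a`_0) =
      \sum_(k < size a) \sum_(l < size a) a`_k * a`_l * (v k l - u k l).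
    rewrite -sv -[LHS]subr0 -[X in _ - X = _]su -sumrB; apply: eq_bigr => k _.
    by rewrite -sumrB; apply: eq_bigr => l _; rewrite [RHS]mulrBr.
  rewrite (_ : abs_sum a ^+ 2 * _ = \sum_(k < size a) \sum_(l < size a) `|a`_k| * (`|a`_l| * (2 * B * t ^+ 2))); last first.
    rewrite expr2 -mulrA mulr_suml; apply: eq_bigr => k _.
    by rewrite mulr_suml mulr_sumr.
  apply: le_trans (ler_norm_sum _ _ _) _; apply: ler_sum => k _.
  apply: le_trans (ler_norm_sum _ _ _) _; apply: ler_sum => l _.
  rewrite !normrM -mulrA ler_wpM2l// ler_wpM2l// distrC.
  exact: uv.
have c0 : 0 < `|a`_J * a`_0| by rewrite normr_gt0 mulf_neq0.
set c := `|a`_J * a`_0| in key c0.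
have B0 : 0 <= B by rewrite mulr_ge0 ?powR_ge0.
set K := abs_sum a ^+ 2 * B.
have K0 : 0 <= K by rewrite mulr_ge0 ?sqr_ge0.
have s2' : 0 < 2 - s by rewrite subr_gt0.
(* The intended value of t^(2 - s): the first bound ensures t <= 1/2, the second contradicts
   [key]. *)
pose w : R := Num.min ((1 / 2) `^ (2 - s)) (c / (K + 1)).
have w0 : 0 < w by rewrite lt_min powR_gt0//= divr_gt0// ltr_wpDl.
pose t := w `^ (2 - s)^-1.
have t0 : 0 < t by exact: powR_gt0.
have tw : t `^ (2 - s) = w by rewrite -powRrM mulVf ?gt_eqF// powRr1// ltW.
have t1 : t <= 1 / 2.
  rewrite leNgt; apply/negP => ht.
  have : (1 / 2) `^ (2 - s) < t `^ (2 - s) by rewrite gt0_ltr_powR ?nnegrE// ?ltW//; lra.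
  by rewrite tw lt_min ltxx.
have := key t; rewrite t0 t1 => /(_ isT).
have -> : t ^+ 2 = t `^ s * w by rewrite -tw -powRD ?(gt_eqF t0) ?implybT// addrC subrK powR_mulrn// ltW.
have ts : 0 < t `^ s by exact: powR_gt0.
apply/negP; rewrite -ltNge.
rewrite (_ : _ * _ = (2 * t `^ s) * (K * w)); last by rewrite /K; ring.
rewrite ltr_pM2l ?mulr_gt0//.
have : w <= c / (K + 1) by rewrite ge_min lexx orbT.
rewrite ler_pdivlMr; last by rewrite ltr_wpDl.
by move: K0 w0; clear; move: K w => K w; rewrite mulrDr mulr1 mulrC; lra.
Qed.

End Nondegeneracy.

Lemma le_powRN {R : realType} (x y p : R) : 0 < x -> x <= y -> p <= 0 -> y `^ p <= x `^ p.
Proof.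
move=> x0 xy p0; have y0 := lt_le_trans x0 xy.
rewrite -[p]opprK; move: (- p) (oppr_ge0 p) => q; rewrite p0 => q0.
rewrite !powRN lef_pV2 ?posrE ?powR_gt0//.
by rewrite ge0_ler_powR ?nnegrE ?(ltW x0) ?(ltW y0).
Qed.

(** * Behaviour at short and long lags *)

Section Asymptotics.
Context {R : realType}.
Variables (V r : R -> R) (D M : nat) (C s : R) (a : seq R).
Hypothesis s_gt0 : 0 < s.
Hypothesis V_smooth : smooth_on [set x : R | 0 < x] V.
Hypothesis V_derivable : times_derivable (2 * D) V.
Hypothesis V_expansion : forall h : R,
  derive1n (2 * D) V h = derive1n (2 * D) V 0 + C * (-1) ^+ D * `|h| `^ s + r h.
Hypothesis a_moments : vanishing_moments a M.
Hypothesis lt_D_M : (D < M)%N.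

Let J : R := (size a).-1%:R.

(** At lags of order delta, the window lies in a ball of radius (K + J) delta, where r is o(|h|^t),
    and 2D derivatives bring delta^(2D). The case t = s serves the variance, t = s + 1/(2 alpha) the
    bias. *)
Lemma expansion_rest_littleo (t K e : R) : 0 < t -> 0 <= K -> 0 < e ->
  r =o_ (nbhs (0 : R)) (fun h : R => `|h| `^ t) ->
  exists2 rho, 0 < rho & forall delta x, 0 < delta < rho -> `|x| <= K * delta ->
    `|diff2 a (expansion_rest V D C s 0) delta x| <= e * delta `^ ((2 * D)%:R + t).
Proof.
move=> t0 K0 e0 /eqoP ro.
set c := abs_sum a ^+ 2 * ((K + J) `^ t * J ^+ (2 * D)).
have c0 : 0 <= c by rewrite mulr_ge0 ?sqr_ge0// mulr_ge0 ?powR_ge0 ?exprn_ge0.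
have e'0 : 0 < e / (c + 1) by rewrite divr_gt0// ltr_wpDl.
have [rho0 /= rho00 hrho] := ro _ e'0.
exists (rho0 / (K + J + 1)) => [|delta x /andP[d0 dr] xK].
  by rewrite divr_gt0// ltr_wpDl// addr_ge0.
have dr' : (K + J) * delta < rho0.
  move: dr; rewrite ltr_pdivlMr ?ltr_wpDl ?addr_ge0//; apply: le_lt_trans.
  by rewrite mulrC ler_wpM2l ?(ltW d0)// lerDl.
apply: (le_trans (expansion_rest_near s_gt0 V_smooth V_derivable V_expansion a_moments lt_D_M
  (B := e / (c + 1) * ((K + J) * delta) `^ t) (ltW d0) _)).
  move=> y yx; have yK : `|y| <= (K + J) * delta.
    by rewrite mulrDl -(subrK x y) addrC; apply: le_trans (ler_normD _ _) _; rewrite lerD.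
  have := hrho y; rewrite /= sub0r normrN (ger0_norm (powR_ge0 _ _)).
  have KJ0 : 0 <= (K + J) * delta by exact: le_trans (normr_ge0 y) yK.
  move=> /(_ (le_lt_trans yK dr')) hy; apply: le_trans hy _.
  by rewrite ler_wpM2l ?(ltW e'0)// ge0_ler_powR ?nnegrE ?(ltW t0).
rewrite -/J (_ : _ * _ = e * (c / (c + 1)) * delta `^ ((2 * D)%:R + t)); last first.
  rewrite powRM ?addr_ge0// ?(ltW d0)// exprMn powRD ?(gt_eqF d0) ?implybT//.
  rewrite powR_mulrn ?(ltW d0)// /c.
  move: (c + 1)^-1 => u; ring.
rewrite ler_wpM2r ?powR_ge0// ler_piMr ?(ltW e0)// ler_pdivrMr ?ltr_wpDl//.
by rewrite mul1r lerDl.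
Qed.

(** Maximality at lag 0 is known for [V]; at lag x delta, dividing by C delta^(2D+s) transfers it to
    W, since Q is of smaller order as delta tends to 0. *)
Lemma abspow_variance_gt0 : 0 < C -> s < 2 -> diff_seq a -> (1 < size a)%N ->
  r =o_ (nbhs (0 : R)) (fun h : R => `|h| `^ s) ->
  (forall delta x, 0 < delta -> `|diff2 a V delta x| <= diff2 a V delta 0) ->
  0 < (-1) ^+ D * diff2 a (abspow D s 0) 1 0.
Proof.
move=> C0 s2 ha a1 ro CS.
pose psi x := (-1) ^+ D * diff2 a (abspow D s 0) 1 x.
have psi_le x : `|psi x| <= psi 0.
  apply/ler_addgt0Pr => e e0.
  (* One half for the error at lag x delta, one half for the error at lag 0. *)
  have Ce0 : 0 < C * e / 2 by rewrite divr_gt0// mulr_gt0.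
  have [rho rho0 hrho] := expansion_rest_littleo s_gt0 (normr_ge0 x) Ce0 ro.
  set delta := rho / 2.
  have dr : 0 < delta < rho by rewrite divr_gt0//= /delta; lra.
  have d0 : 0 < delta by case/andP: dr.
  have scal y : (-1) ^+ D * diff2 a (abspow D s 0) delta (y * delta) = delta `^ ((2 * D)%:R + s) * psi y.
    by rewrite diff2_abspow_scale// mulrCA.
  have h1 := hrho delta (x * delta) dr; have h2 := hrho delta (0 * delta) dr.
  rewrite normrM (gtr0_norm d0) lexx in h1.
  rewrite mul0r normr0 mulr_ge0 ?(ltW d0)// in h2.
  have {}h1 := h1 isT; have {}h2 := h2 isT.
  have := CS delta (x * delta) d0; rewrite -[X in _ <= diff2 a V delta X](mul0r delta).
  rewrite !(diff2_expansion V C s_gt0 a_moments lt_D_M) !scal mul0r.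
  move: h1 h2; set w := delta `^ _; have w0 : 0 < w by exact: powR_gt0.
  set u := diff2 _ _ _ _; set v := diff2 _ _ _ _ => h1 h2 h3.
  have h4 : C * w * `|psi x| <= C * w * (psi 0 + e).
    have -> : C * w * `|psi x| = `|C * (w * psi x)|.
      by rewrite !normrM (gtr0_norm C0) (gtr0_norm w0) mulrA.
    have h5 := ler_norm v.
    have := ler_normB (C * (w * psi x) + u) u; rewrite addrK.
    move: h1 h2 h3 h5; clear.
    move: (psi 0) (`|C * (w * psi x)|) (`|C * (w * psi x) + u|) (`|u|) (`|v|) => p A1 A2 A3 A4.
    by move=> h1 h2 h3 h5 h6; lra.
  by rewrite -(ler_pM2l (mulr_gt0 C0 w0)).
rewrite lt_neqAle (le_trans _ (psi_le 0)) ?normr_ge0// andbT eq_sym; apply/eqP => p0.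
apply: (diff2_powR_neq0 s_gt0 s2 ha a1); apply: (diff2_abspow_order0 (D := D) s_gt0) => x.
have := psi_le x; rewrite [psi 0]p0 normr_le0 /psi mulf_eq0 signr_eq0 => /eqP.
exact.
Qed.

End Asymptotics.

Section Decay.
Context {R : realType}.
Variables (V r : R -> R) (D M : nat) (C s : R) (a : seq R).
Hypothesis s_gt0 : 0 < s.
Hypothesis C_gt0 : 0 < C.
Hypothesis V_smooth : smooth_on [set x : R | 0 < x] V.
Hypothesis V_derivable : times_derivable (2 * D) V.
Hypothesis V_expansion : forall h : R,
  derive1n (2 * D) V h = derive1n (2 * D) V 0 + C * (-1) ^+ D * `|h| `^ s + r h.
Hypothesis a_moments : vanishing_moments a M.
Hypothesis lt_D_M : D%:R + s / 2 + 1 / 4 < M%:R.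

Let J : R := (size a).-1%:R.

Let ltDM : (D < M)%N.
Proof. by rewrite -(ltr_nat R); move: lt_D_M s_gt0; lra. Qed.

(** From lag 2L on, the nodes keep a distance from 0 proportional to the lag. Using i + 1 instead of
    i makes the decay meaningful at i = 0 too. *)
Let window (i : nat) (delta y : R) : (2 * size a <= i)%N -> (0 < size a)%N -> 0 < delta -> `|y - i%:R * delta| <= J * delta ->
  i.+1%:R / 4 * delta <= y.
Proof.
move=> Li a0 d0; rewrite ler_distl => /andP[+ _]; apply: le_trans.
rewrite -mulrBl ler_wpM2r ?(ltW d0)// /J.
have : (4 * (size a).-1)%:R + i.+1%:R <= (4 * i)%:R :> R by rewrite -natrD ler_nat; lia.
by rewrite !natrM; lra.
Qed.

Let window0 (i : nat) (delta : R) : (2 * size a <= i)%N -> (0 < size a)%N -> 0 < delta ->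
  J * delta < i%:R * delta.
Proof. by move=> Li a0 d0; rewrite ltr_pM2r// ltr_nat; lia. Qed.

Lemma diff2_abspow_decay (i : nat) : (2 * size a <= i)%N -> (0 < size a)%N ->
  `|diff2 a (abspow D s 0) 1 i%:R| <=
    abs_sum a ^+ 2 * (`|abspow_coef D s (2 * M)| * (1 / 4) `^ ((2 * D)%:R + s - (2 * M)%:R) * J ^+ (2 * M)) *
    i.+1%:R `^ ((2 * D)%:R + s - (2 * M)%:R).
Proof.
move=> Li a0; set p := _ - (2 * M)%:R.
have p0 : p <= 0.
  by rewrite /p !natrM; move: lt_D_M s_gt0; lra.
have := @abspow_far R a M D s 1 i%:R ((1 / 4) `^ p * i.+1%:R `^ p) s_gt0 a_moments ler01.
rewrite mulr1 -[X in _ < X -> _]mulr1 -/J -[X in X < _]mulr1 => /(_ (window0 Li a0 ltr01)) h.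
rewrite (_ : _ * _ * _ = abs_sum a ^+ 2 * (`|abspow_coef D s (2 * M)| *
  ((1 / 4) `^ p * i.+1%:R `^ p) * J ^+ (2 * M))); last by ring.
apply: h => y y0 yi; rewrite -powRM//; apply: (le_powRN _ _ p0).
  by rewrite mulr_gt0 ?divr_gt0.
have := window Li a0 ltr01 (y := y); rewrite !mulr1 (_ : _ / 4 = 1 / 4 * i.+1%:R); last by ring.
exact.
Qed.

Lemma expansion_rest_decay q (beta K' delta : R) (i : nat) :
  s - q%:R < beta -> beta < 0 -> (2 * D + q <= 2 * M)%N -> 0 <= K' ->
  (2 * size a <= i)%N -> (0 < size a)%N -> 0 < delta <= 1 ->
  (forall y, 0 < y -> `|y - i%:R * delta| <= J * delta -> `|derive1n q r y| <= K' * y `^ beta) ->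
  `|diff2 a (expansion_rest V D C s 0) delta (i%:R * delta)| <=
    abs_sum a ^+ 2 * (K' * (1 / 4) `^ beta * J ^+ (2 * D + q)) *
    delta `^ ((2 * D)%:R + s) * i.+1%:R `^ beta.
Proof.
move=> sb b0 qM K0 Li a0 /andP[d0 d1] hr.
have i0 : 0 < i.+1%:R / 4 :> R by rewrite divr_gt0.
apply: (le_trans (expansion_rest_far s_gt0 V_smooth V_derivable V_expansion a_moments
  (q := q) (B := K' * (i.+1%:R / 4 * delta) `^ beta) (ltW d0) qM (window0 Li a0 d0) _)).
  move=> y y0 yi; apply: le_trans (hr y y0 yi) _.
  rewrite ler_wpM2l//; apply: le_powRN (ltW b0); first by rewrite mulr_gt0.
  exact: window Li a0 d0 yi.
rewrite -/J.
have -> : abs_sum a ^+ 2 * (K' * (i.+1%:R / 4 * delta) `^ beta * (J * delta) ^+ (2 * D + q)) =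
    abs_sum a ^+ 2 * (K' * (1 / 4) `^ beta * J ^+ (2 * D + q)) *
    (delta `^ beta * delta ^+ (2 * D + q)) * i.+1%:R `^ beta.
  rewrite (_ : i.+1%:R / 4 * delta = 1 / 4 * i.+1%:R * delta); last by rewrite mul1r mulrC mulrA [_^-1 * _]mulrC -mulrA mulrC.
  by rewrite !powRM ?mulr_ge0 ?(ltW d0)// exprMn; ring.
rewrite ler_wpM2r ?powR_ge0// ler_wpM2l//.
  by rewrite mulr_ge0 ?sqr_ge0// !mulr_ge0 ?powR_ge0 ?exprn_ge0.
(* The exponent beta + 2D + q exceeds 2D + s and delta is at most 1. *)
rewrite -powR_mulrn ?(ltW d0)// -powRD ?(gt_eqF d0) ?implybT//.
apply: ger_powR; rewrite ?d0 ?d1//.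
by rewrite natrD; move: sb; lra.
Qed.

(** Long lags combine the decays of W and Q; the finitely many short lags are absorbed in the
    constant. The derivative bound is a premise for each pair of step and lag, because for alpha = 1
    it is only available at points below 1. *)
Lemma semivariogram_decay q (beta K' : R) : s - q%:R < beta -> beta < - (1 / 2) ->
  (2 * D + q <= 2 * M)%N -> (0 < size a)%N -> 0 <= K' ->
  r =o_ (nbhs (0 : R)) (fun h : R => `|h| `^ s) ->
  exists A kappa rho : R, [/\ 0 <= A, 1 / 2 < kappa, kappa < 1, 0 < rho &
    forall delta (i : nat), 0 < delta < rho -> delta <= 1 ->
      (forall y, 0 < y -> `|y - i%:R * delta| <= J * delta -> `|derive1n q r y| <= K' * y `^ beta) ->
      `|diff2 a V delta (i%:R * delta)| <= A * delta `^ ((2 * D)%:R + s) * i.+1%:R `^ (- kappa)].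
Proof.
move=> sb b2 qM a0 K0 ro.
pose p : R := (2 * D)%:R + s - (2 * M)%:R.
(* The slower of the two decays, capped at 3/4 to stay below 1, as the summation of powers
   requires. *)
pose kappa : R := Num.min (- beta) (Num.min (- p) (3 / 4)).
have k1 : 1 / 2 < kappa.
  rewrite !lt_min; apply/and3P; split; [lra| |lra].
  by rewrite /p !natrM; move: lt_D_M; lra.
have k2 : kappa < 1 by rewrite !gt_min; apply/or3P; apply: Or33; lra.
have kb : beta <= - kappa by rewrite lerNr ge_min lexx.
have kp : p <= - kappa by rewrite lerNr !ge_min lexx orbT.
have [rho rho0 hrho] := expansion_rest_littleo s_gt0 V_smooth V_derivable V_expansion
  a_moments ltDM s_gt0 (ler0n _ (2 * size a)) ltr01 ro.
pose AW := abs_sum a ^+ 2 * (`|abspow_coef D s (2 * M)| * (1 / 4) `^ p * J ^+ (2 * M)).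
pose AQ := abs_sum a ^+ 2 * (K' * (1 / 4) `^ beta * J ^+ (2 * D + q)).
pose S := \sum_(i < 2 * size a) (C * `|diff2 a (abspow D s 0) 1 i%:R| + 1).
(* For i < 2L, (i + 1)^(-kappa) is at least (2L)^(-kappa). *)
pose AN := S * (2 * size a)%:R `^ kappa.
have AW0 : 0 <= AW by rewrite mulr_ge0 ?sqr_ge0// !mulr_ge0 ?powR_ge0 ?exprn_ge0.
have AQ0 : 0 <= AQ by rewrite mulr_ge0 ?sqr_ge0// !mulr_ge0 ?powR_ge0 ?exprn_ge0.
have S0 : 0 <= S by apply: sumr_ge0 => i _; rewrite addr_ge0// mulr_ge0// ltW.
have AN0 : 0 <= AN by rewrite mulr_ge0 ?powR_ge0.
exists (C * AW + AQ + AN), kappa, rho; split => //.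
  by rewrite !addr_ge0// mulr_ge0// ltW.
move=> delta i /andP[d0 dr] d1 hr; rewrite (diff2_expansion V C s_gt0 a_moments ltDM).
rewrite diff2_abspow_scale//; set w := delta `^ _.
have w0 : 0 < w by exact: powR_gt0.
set z := i.+1%:R `^ (- kappa); have z0 : 0 <= z by exact: powR_ge0.
apply: le_trans (ler_normD _ _) _.
rewrite !normrM normrX normrN1 expr1n mul1r (gtr0_norm C_gt0) (gtr0_norm w0).
have i1 : 1 <= i.+1%:R :> R by rewrite ler1n.
have [Li|iL] := leqP (2 * size a) i.
  have h1 : `|diff2 a (abspow D s 0) 1 i%:R| <= AW * z.
    apply: le_trans (diff2_abspow_decay Li a0) _; rewrite -/p -/AW ler_wpM2l//.
    exact: ler_powR.
  have h2 : `|diff2 a (expansion_rest V D C s 0) delta (i%:R * delta)| <= AQ * w * z.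
    apply: le_trans (@expansion_rest_decay q beta K' delta i sb _ qM K0 Li a0 _ hr) _; first lra.
      by rewrite d0 d1.
    by rewrite -/AQ -/w ler_wpM2l ?ler_powR// mulr_ge0// ltW.
  apply: le_trans (lerD (ler_wpM2l (ltW C_gt0) (ler_wpM2l (ltW w0) h1)) h2) _.
  have -> : C * (w * (AW * z)) + AQ * w * z = (C * AW + AQ) * w * z by ring.
  by rewrite ler_wpM2r// ler_wpM2r ?(ltW w0)// lerDl.
have h2 : `|diff2 a (expansion_rest V D C s 0) delta (i%:R * delta)| <= w.
  rewrite -[w]mul1r; apply: hrho; first by rewrite d0 dr.
  by rewrite normrM (gtr0_norm d0) ler_wpM2r ?(ltW d0)// ger0_norm// ler_nat ltnW.
have h3 : C * `|diff2 a (abspow D s 0) 1 i%:R| + 1 <= S.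
  rewrite /S (bigD1 (Ordinal iL))//= lerDl; apply: sumr_ge0 => j _.
  by rewrite addr_ge0// mulr_ge0// ltW.
have h4 : S <= AN * z.
  rewrite -mulrA ler_peMr// /z powRN ler_pdivlMr ?powR_gt0// mul1r.
  by rewrite ge0_ler_powR ?nnegrE ?ler_nat//; lra.
apply: le_trans (lerD (lexx _) h2) _.
rewrite mulrCA -[X in _ + X]mulr1 -mulrDr -mulrA mulrCA ler_wpM2l ?(ltW w0)//.
apply: le_trans h3 (le_trans h4 _); rewrite ler_wpM2r// lerDr.
by rewrite addr_ge0// mulr_ge0// ltW.
Qed.

End Decay.

(** * Covariances and means of the increments *)

Section ProcessSpace.
Context {d : measure_display} {T : measurableType d} {R : realType}.
Variables (P : probability T R) (X : R -> {RV P >-> R}).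
Hypothesis X_gauss : gaussian_process X.

(** A list entry holds a coefficient and a time. *)
Definition process_space : set (T -> R) :=
  [set Y | exists S : seq (R * R), Y = fun w => \sum_(p <- S) p.1 * centered X p.2 w].

Lemma tame_process t : tame P (X t).
Proof.
have gX : gaussian_rv P (X t).
  have -> : (X t : T -> R) = fun w => \sum_(i < 1) 1 * X t w.
    by apply/funext => w; rewrite big_ord1 mul1r.
  exact: X_gauss.
have [] := gaussian_rv_center _ gX; last by [].
exact: measurable_funPT.
Qed.

Lemma tame_centered t : tame P (centered X t).
Proof. by apply: tameB; [exact: tame_process|exact: tame_cst]. Qed.

Lemma gspace_process : gspace P process_space.
Proof.
split=> [_ [S ->]|a b _ _ [S ->] [S' ->]].
  pose Z w := \sum_(p <- S) p.1 * X p.2 w.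
  have [mZ gZ] : measurable_fun setT Z /\ gaussian_rv P Z.
    split; first by apply: tame_measurable; apply: tame_sum => p; apply: tameZ; exact: tame_process.
    have -> : Z = fun w => \sum_(i < size S) (nth (0, 0) S i).1 * X (nth (0, 0) S i).2 w.
      by apply/funext => w; rewrite /Z (big_nth (0, 0)) big_mkord.
    exact: X_gauss.
  have [_] := gaussian_rv_center mZ gZ.
  rewrite (_ : (fun w => Z w - _) = fun w => \sum_(p <- S) p.1 * centered X p.2 w)//; apply/funext => w.
  rewrite mean_sum => [|p]; last by apply: tameZ; exact: tame_process.
  rewrite /Z -sumrB; apply: eq_bigr => p _.
  rewrite meanZ; last exact: tame_process.
  by rewrite -mulrBr /centered expectation_mean.
exists ([seq (a * p.1, p.2) | p <- S] ++ [seq (b * p.1, p.2) | p <- S']).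
apply/funext => w; rewrite big_cat !big_map !mulr_sumr.
by congr (_ + _); apply: eq_bigr => p _; rewrite mulrA.
Qed.

Lemma process_space_sum (a : seq R) (t : nat -> R) :
  process_space (fun w => \sum_(k < size a) a`_k * centered X (t k) w).
Proof.
exists [seq (a`_k, t k) | k <- index_iota 0 (size a)]; apply/funext => w.
by rewrite big_map big_mkord.
Qed.

Variable V : R -> R.
Hypothesis X_semivariogram : is_semivariogram P (centered X) V.

Lemma semivariogram_mean t h :
  V h = mean P (fun w => (centered X (t + h) w - centered X t w) ^+ 2) / 2.
Proof.
have tY : tame P (fun w => (centered X (t + h) w - centered X t w) ^+ 2).
  by apply: tameX; apply: tameB; exact: tame_centered.
have := congr1 fine (X_semivariogram t h); rewrite /= fineM//; last first.
  by rewrite unlock; apply: integrable_fin_num => //; exact: tame_integrable.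
by rewrite expectation_mean mulrC.
Qed.

Lemma cov_centered u v : cov P (centered X u) (centered X v) =
  (cov P (centered X u) (centered X u) + cov P (centered X v) (centered X v)) / 2 - V (v - u).
Proof.
have tu := tame_centered u; have tv := tame_centered v.
rewrite (semivariogram_mean u) (addrC u) subrK /cov.
have -> : mean P (fun w => (centered X v w - centered X u w) ^+ 2) =
    mean P (fun w => centered X v w * centered X v w) +
    -2 * mean P (fun w => centered X u w * centered X v w) +
    mean P (fun w => centered X u w * centered X u w).
  rewrite -meanZ; last exact: tameM.
  rewrite -meanD; [|exact: tameM|by apply: tameZ; exact: tameM].
  rewrite -meanD; [|by apply: tameD; [|apply: tameZ]; apply: tameM|exact: tameM].
  by apply: eq_mean => w; ring.
by field.
Qed.

(** The covariance at times u and v is a function of u plus a function of v minus V(v - u); the zero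
    sum of [a] removes the first two. *)
Lemma cov_difference (a : seq R) delta u v : \sum_(j < size a) a`_j = 0 ->
  cov P (fun w => \sum_(k < size a) a`_k * centered X (u + k%:R * delta) w)
        (fun w => \sum_(k < size a) a`_k * centered X (v + k%:R * delta) w) =
  diff2 a V delta (v - u).
Proof.
move=> a0; rewrite /cov.
rewrite (eq_mean _ (g := fun w => \sum_(k < size a) \sum_(l < size a)
   a`_k * a`_l * (centered X (u + k%:R * delta) w * centered X (v + l%:R * delta) w))); last first.
  move=> w; rewrite mulr_suml; apply: eq_bigr => k _.
  by rewrite mulr_sumr; apply: eq_bigr => l _; ring.
have tt k l := tameM (tame_centered (u + k%:R * delta)) (tame_centered (v + l%:R * delta)).
pose c t := cov P (centered X t) (centered X t) / 2.
transitivity (\sum_(k < size a) \sum_(l < size a) a`_k * a`_l * (c (u + k%:R * delta) +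
   c (v + l%:R * delta) - V (v - u + (l%:R - k%:R) * delta))).
  rewrite mean_sum => [|k]; last by apply: tame_sum => l; apply: tameZ.
  apply: eq_bigr => k _; rewrite mean_sum => [|l]; last exact: tameZ.
  apply: eq_bigr => l _; rewrite meanZ//; congr (_ * _); rewrite -[LHS]/(cov _ _ _) cov_centered /c.
  by rewrite mulrDl; congr (_ - V _); ring.
transitivity ((\sum_(k < size a) a`_k * c (u + k%:R * delta)) * (\sum_(l < size a) a`_l) +
  (\sum_(k < size a) a`_k) * (\sum_(l < size a) a`_l * c (v + l%:R * delta)) + diff2 a V delta (v - u)).
  rewrite /diff2 !mulr_suml -sumrN -!big_split; apply: eq_bigr => k _ /=.
  rewrite !mulr_sumr -sumrN -!big_split; apply: eq_bigr => l _ /=; ring.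
by rewrite a0 mulr0 mul0r !add0r.
Qed.

(** Cauchy-Schwarz for two differences a distance [x] apart, which have the same variance. *)
Lemma norm_diff2_semivariogram_le (a : seq R) delta x : \sum_(j < size a) a`_j = 0 ->
  `|diff2 a V delta x| <= diff2 a V delta 0.
Proof.
move=> a0; pose Y u w := \sum_(k < size a) a`_k * centered X (u + k%:R * delta) w.
have tY u : tame P (Y u) by apply: tame_sum => k; apply: tameZ; exact: tame_centered.
have c u v : mean P (fun w => Y u w * Y v w) = diff2 a V delta (v - u) by exact: cov_difference.
have sq u : mean P (fun w => Y u w ^+ 2) = diff2 a V delta 0 by rewrite -(subrr u) -c.
have := mean_CS (tY 0) (tY x); rewrite c !sq subr0 -expr2.
rewrite -[in X in X <= _ -> _]real_normK ?num_real//.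
rewrite ler_pXn2r ?nnegrE// -(sq 0); apply: mean_ge0 => w; exact: sqr_ge0.
Qed.

End ProcessSpace.

(** * Sums of powers, and differences of the mean function *)

Section PowerSums.
Context {R : realType}.

Lemma cvg_natpowRN (p : R) : 0 < p -> n%:R `^ (- p) @[n --> \oo] --> (0 : R).
Proof.
move=> p0; apply/cvgr0Pnorm_le => e e0.
near=> n; rewrite ger0_norm ?powR_ge0//.
have -> : e = (e `^ (- p^-1)) `^ (- p).
  by rewrite -powRrM mulNr mulrN opprK mulVf ?gt_eqF// powRr1// ltW.
apply: le_powRN; [exact: powR_gt0| |by rewrite oppr_le0 ltW].
by near: n; exact: nbhs_infty_ger.
Unshelve. all: by end_near. Qed.

(** By the mean value theorem, y^(1 - kappa) grows by at least (1 - kappa) (n + 2)^(-kappa) between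
    n + 1 and n + 2. *)
Lemma sum_natpowRN_le (kappa : R) n : 0 < kappa < 1 ->
  \sum_(i < n) i.+1%:R `^ (- kappa) <= n%:R `^ (1 - kappa) / (1 - kappa).
Proof.
move=> /andP[k0 k1]; have k2 : 0 < 1 - kappa by rewrite subr_gt0.
elim: n => [|n IH]; first by rewrite big_ord0 divr_ge0 ?powR_ge0// ltW.
rewrite big_ord_recr /=; apply: le_trans (lerD IH (lexx _)) _.
rewrite -lerBrDl -mulrBl ler_pdivlMr//.
case: n {IH} => [|n].
  by rewrite powR0 ?gt_eqF// subr0 !powR1 mul1r lerBlDr lerDl ltW.
have [|x y|c /andP[c0 c1] ->] := @drv_MVT R (fun y => y `^ (1 - kappa)) (fun y => (1 - kappa) * y `^ (- kappa)) n.+1%:R n.+2%:R.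
- by rewrite ler_nat.
- have x0 : 0 < x by apply: lt_le_trans (_ : n.+1%:R <= x); rewrite ?ltr0n//; case/andP: y.
  by apply: drv_eq (drv_powR _ x0) _; rewrite addrAC subrr add0r.
have -> : n.+2%:R - n.+1%:R = 1 :> R by rewrite -natrB// subSnn.
rewrite mulr1 mulrC ler_wpM2l ?(ltW k2)//; apply: le_powRN => //.
  by apply: lt_le_trans c0; rewrite ltr0n.
by rewrite oppr_le0 ltW.
Qed.

Lemma sum_nat_widen_le (g : nat -> R) (i m : nat) : (forall k, 0 <= g k) -> (i <= m)%N ->
  \sum_(0 <= j < i) g j <= \sum_(0 <= j < m) g j.
Proof. by move=> g0 im; rewrite [leRHS](big_cat_nat (n := i))//= lerDl sumr_ge0. Qed.

(** With truncated subtraction the argument is |i - j|, and each distance occurs at most twice. *)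
Lemma sum_dist_le (g : nat -> R) (i m : nat) : (forall k, 0 <= g k) -> (i < m)%N ->
  \sum_(j < m) g ((i - j) + (j - i))%N <= 2 * \sum_(k < m) g k.
Proof.
move=> g0 im; rewrite mulr_natl mulr2n.
rewrite -(big_mkord xpredT (fun j => g ((i - j) + (j - i))%N)) -(big_mkord xpredT g).
rewrite (big_cat_nat (n := i))//= ?(ltnW im)//.
apply: lerD.
  rewrite big_nat_rev /=.
  rewrite (eq_big_nat _ _ (F2 := fun j => g j.+1)) => [|j /andP[_ ji]]; last first.
    by congr g; lia.
  case: m im => // m im; rewrite big_nat_recl// -[leLHS]add0r; apply: lerD => //.
  exact: (sum_nat_widen_le (g := fun j => g j.+1)).
rewrite -[X in \sum_(X <= _ < _) _]add0n big_addn.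
rewrite (eq_big_nat _ _ (F2 := g)) => [|j _]; last by congr g; lia.
by apply: sum_nat_widen_le => //; lia.
Qed.

End PowerSums.

Section Means.
Context {R : realType}.

(** [sup] is an upper bound only for a set that is bounded above; here continuity on a compact
    interval ensures it. *)
Lemma norm_derive_le_mean_sup (f : R -> R) alpha M n (t : R) : smooth_on [set: R] f ->
  0 <= t <= n%:R `^ (1 - alpha) -> `|derive1n M f t| <= mean_sup f alpha M n.
Proof.
move=> sf tI; have n0 : 0 <= n%:R `^ (1 - alpha) by exact: powR_ge0.
have cf : continuous (fun x => `|derive1n M f x|).
  move=> x; apply: (@continuous_comp _ _ _ (derive1n M f) (fun y => `|y|)); last exact: norm_continuous.
  by apply: differentiable_continuous; apply/derivable1_diffP; exact: sf.
have [|c cI cmax] := @EVT_max R (fun x => `|derive1n M f x|) 0 _ n0.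
  exact: continuous_subspaceT.
rewrite /mean_sup; apply: ub_le_sup; last by exists t => //=; rewrite in_itv.
by exists `|derive1n M f c| => _ [x xI <-]; exact: cmax.
Qed.

Lemma norm_difference_le (f : R -> R) (a : seq R) M (B t delta hi : R) :
  smooth_on [set: R] f -> vanishing_moments a M -> 0 <= delta ->
  0 <= t -> t + (size a).-1%:R * delta <= hi ->
  (forall y, 0 <= y <= hi -> `|derive1n M f y| <= B) ->
  `|\sum_(k < size a) a`_k * f (t + k%:R * delta)| <=
    abs_sum a * (B * ((size a).-1%:R * delta) ^+ M).
Proof.
move=> sf va d0 t0 thi fB.
have nodes (k : 'I_(size a)) : 0 <= t + k%:R * delta <= hi.
  rewrite addr_ge0 ?mulr_ge0//=; apply: le_trans thi; rewrite lerD2l ler_wpM2r// ler_nat.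
  by have := ltn_ord k; lia.
have t1 : 0 <= t <= hi by rewrite t0; apply: le_trans thi; rewrite lerDl mulr_ge0.
have B0 : 0 <= B by apply: le_trans (normr_ge0 _) (fB t t1).
pose T y := \sum_(p < M) derive1n p f t * (y - t) ^+ p / p`!%:R.
have T0 : \sum_(k < size a) a`_k * T (t + k%:R * delta) = 0.
  under eq_bigr do rewrite mulr_sumr.
  rewrite exchange_big big1//= => p _.
  transitivity (derive1n p f t / p`!%:R * \sum_(k < size a) a`_k * (0 + k%:R * delta) ^+ p).
    rewrite mulr_sumr; apply: eq_bigr => k _; rewrite addrAC subrr; ring.
  by rewrite (vanishing_moments_shift _ _ va (ltn_ord p)) mulr0.
rewrite -[X in `|X|]subr0 -[X in _ - X]T0 -sumrB.
apply: le_trans (ler_norm_sum _ _ _) _; rewrite mulr_suml; apply: ler_sum => k _.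
rewrite -mulrBr normrM ler_wpM2l//.
have := @taylor_bound R M (fun p => derive1n p f) 0 hi B t (t + k%:R * delta).
rewrite -/(T _) => /(_ _ fB t1 (nodes k)) h; apply: le_trans (h _) _.
  move=> p y _ _; rewrite derive1nS derive1E; apply: DeriveDef => //; exact: sf.
rewrite ler_wpM2l// lerXn2r ?nnegrE ?mulr_ge0//.
rewrite addrAC subrr add0r ger0_norm ?mulr_ge0// ler_wpM2r// ler_nat.
by have := ltn_ord k; lia.
Qed.

End Means.

Lemma half_le_add {R : realFieldType} (u y t : R) : - y <= t -> t <= u / 2 -> u / 2 <= u + y.
Proof. by lra. Qed.

Section WindowCount.
Variables (n L : nat).
Hypothesis L_gt1 : (1 < L)%N.

Lemma window_count_le : (n.+1 - L <= n)%N. Proof. lia. Qed.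

Lemma window_count_ge : (2 * L <= n)%N -> (n <= 2 * (n.+1 - L))%N. Proof. lia. Qed.

Lemma window_count_defect : (n - (n.+1 - L) <= L)%N. Proof. lia. Qed.

Lemma window_last i : (i < n.+1 - L)%N -> (i.+1 + L.-1 <= n)%N. Proof. lia. Qed.

(** Strictness matters when alpha = 1: the step is then 1/n, and the points of the window must be
    below 1. *)
Lemma window_dist i j : (i < n.+1 - L)%N -> (j < n.+1 - L)%N ->
  (i - j + (j - i) + L.-1 < n)%N.
Proof. lia. Qed.

End WindowCount.

(** * The central limit theorem for the estimator *)

Section Assembly.
Context {d : measure_display} {T : measurableType d} {R : realType}.
Variables (P : probability T R) (X : R -> {RV P >-> R}).
Hypothesis X_gauss : gaussian_process X.
Variables (f V r : R -> R) (alpha C s : R) (D M : nat) (a : seq R).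
Hypothesis f_smooth : smooth_on [set: R] f.
Hypothesis f_mean : forall t : R, 0 <= t -> ('E_P[X t] = (f t)%:E)%E.
Hypothesis X_semivariogram : is_semivariogram P (centered X) V.
Hypothesis alpha_gt0 : 0 < alpha.
Hypothesis alpha_le1 : alpha <= 1.
Hypothesis V_smooth : smooth_on [set x : R | 0 < x] V.
Hypothesis V_derivable : times_derivable (2 * D) V.
Hypothesis C_gt0 : 0 < C.
Hypothesis s_gt0 : 0 < s.
Hypothesis s_lt2 : s < 2.
Hypothesis V_expansion : forall h : R,
  derive1n (2 * D) V h = derive1n (2 * D) V 0 + C * (-1) ^+ D * `|h| `^ s + r h.
Hypothesis r_littleo : r =o_ (nbhs (0 : R)) (fun h : R => `|h| `^ s).
Variables (q : nat) (beta K' : R).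
Hypothesis beta_gt : s - q%:R < beta.
Hypothesis beta_lt : beta < - (1 / 2).
Hypothesis q_le : (2 * D + q <= 2 * M)%N.
Hypothesis K'_ge0 : 0 <= K'.
Hypothesis r_drv_bound : forall y : R, 0 < y -> alpha < 1 \/ y < 1 ->
  `|derive1n q r y| <= K' * y `^ beta.
Hypothesis r_bias : r =o_ (nbhs (0 : R)) (fun h : R => `|h| `^ (s + 1 / (2 * alpha))).
Hypothesis a_diff : diff_seq a.
Hypothesis a_sum0 : \sum_(j < size a) a`_j = 0.
Hypothesis a_moments : vanishing_moments a M.
Hypothesis lt_D_M : D%:R + s / 2 + 1 / 4 < M%:R.
Hypothesis f_littleo : mean_sup f alpha M =o_\oo
  (fun n : nat => n%:R `^ (- (1 / 4)) * step alpha n `^ (D%:R - M%:R + s / 2)).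

Local Notation del n := (step alpha n).
Local Notation nu n := (step alpha n `^ ((2 * D)%:R + s)).
Local Notation m n := (n.+1 - size a)%N.
Local Notation scale n := (n%:R `^ (1 / 2) * nu n).

Let ltDM : (D < M)%N.
Proof. by rewrite -(ltr_nat R); move: lt_D_M s_gt0; lra. Qed.

Let size_gt1 : (1 < size a)%N.
Proof.
rewrite ltnNge; apply/negP => a1; case: a_diff => a0 _; move: a_sum0 a0 a1.
by case: (a) => [|x [|//]] /=; rewrite ?big_ord1 ?eqxx//= => ->; rewrite eqxx.
Qed.

(** Differences are numbered from 1 and ordinals from 0, hence [i.+1]. *)
Definition increment n (i : nat) : T -> R :=
  fun w => \sum_(k < size a) a`_k * centered X (i.+1%:R * del n + k%:R * del n) w.

Definition drift n (i : nat) : R :=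
  \sum_(k < size a) a`_k * f (i.+1%:R * del n + k%:R * del n).

Lemma step_gt0 n : (0 < n)%N -> 0 < del n.
Proof. by move=> n0; rewrite powR_gt0// ltr0n. Qed.

Lemma step_le1 n : (0 < n)%N -> del n <= 1.
Proof.
move=> n0; rewrite /step powRN invf_le1 ?powR_gt0 ?ltr0n//.
by rewrite -[leLHS](powRr0 n%:R) ler_powR ?ler1n// ltW.
Qed.

Lemma natmul_step n : (0 < n)%N -> n%:R * del n = n%:R `^ (1 - alpha).
Proof.
move=> n0; rewrite -[X in X * _ = _]powRr1// /step -powRD// pnatr_eq0 -lt0n n0 implybT//.
Qed.

Lemma a_differenceE n i w : (0 < n)%N ->
  a_difference X a alpha n i.+1 w = increment n i w + drift n i.
Proof.
move=> n0; rewrite /a_difference /increment /drift -big_split; apply: eq_bigr => k _ /=.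
rewrite -mulrDr -mulrDl -natrD /centered f_mean ?mulr_ge0 ?(ltW (step_gt0 n0))//=.
by rewrite subrK.
Qed.

Let den n : R := n%:R * (-1) ^+ D * nu n *
     remainder 0 1 (2 * D) (fun x => `|x| `^ s) (autoconv a).

Lemma estimatorE n : estimator X a alpha D s n =
  fun w => (\sum_(i < m n) (increment n i w + drift n i) ^+ 2) / den n.
Proof.
apply/funext => w; rewrite /estimator -/(den n); congr (_ / _).
rewrite /a_variation big_add1 big_mkord; apply: eq_bigr => i _.
rewrite a_differenceE//; apply: (leq_ltn_trans (leq0n i)).
exact: leq_trans (ltn_ord i) (window_count_le n size_gt1).
Qed.

Lemma cov_increment n i j : cov P (increment n i) (increment n j) =
  diff2 a V (del n) (((i - j) + (j - i))%N%:R * del n).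
Proof.
have wlog_le i' j' : (i' <= j')%N -> cov P (increment n i') (increment n j') =
    diff2 a V (del n) ((j' - i')%:R * del n).
  move=> ij; rewrite (cov_difference X_gauss X_semivariogram _ _ _ a_sum0).
  by rewrite -mulrBl -natrB// subSS.
have [ij|/ltnW ij] := leqP i j.
  by rewrite wlog_le// (eqP (_ : (i - j)%N == 0%N)) ?subn_eq0// add0n.
by rewrite covC wlog_le// (eqP (_ : (j - i)%N == 0%N)) ?subn_eq0// addn0.
Qed.

(** The sign (-1)^D makes this constant positive; C psi is the leading coefficient in the variance
    of a difference. *)
Let psi : R := (-1) ^+ D * diff2 a (abspow D s 0) 1 0.

Let psi_gt0 : 0 < psi.
Proof.
apply: (abspow_variance_gt0 s_gt0 V_smooth V_derivable V_expansion a_moments ltDM) => //.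
by move=> delta x _; exact: (norm_diff2_semivariogram_le X_gauss X_semivariogram).
Qed.

Lemma denE n : den n = n%:R * nu n * psi.
Proof. by rewrite /den remainder_abspow// /psi; ring. Qed.

Let excess n : R := diff2 a (expansion_rest V D C s 0) (del n) 0.

Lemma varianceE n : (0 < n)%N -> diff2 a V (del n) 0 = nu n * (C * psi) + excess n.
Proof.
move=> n0; rewrite (diff2_expansion V C s_gt0 a_moments ltDM) /excess; congr (_ + _).
rewrite -[X in diff2 _ _ _ X](mul0r (del n)) diff2_abspow_scale ?step_gt0//.
rewrite /psi; ring.
Qed.

Lemma cvg_step : del n @[n --> \oo] --> (0 : R).
Proof. exact: cvg_natpowRN. Qed.

Lemma step_lt_near (rho : R) : 0 < rho -> \forall n \near \oo, 0 < del n < rho.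
Proof.
move=> rho0; near=> n; rewrite step_gt0 /=; last by near: n; exact: nbhs_infty_gt.
by near: n; apply: (cvgr_lt _ cvg_step).
Unshelve. all: by end_near. Qed.

Lemma excess_le (t e : R) : 0 < t -> 0 < e ->
  r =o_ (nbhs (0 : R)) (fun h : R => `|h| `^ t) ->
  \forall n \near \oo, `|excess n| <= e * del n `^ ((2 * D)%:R + t).
Proof.
move=> t0 e0 ro.
have [rho rho0 h] := expansion_rest_littleo s_gt0 V_smooth V_derivable V_expansion
  a_moments ltDM t0 ler01 e0 ro.
apply: filterS (step_lt_near rho0) => n dn; apply: h => //.
by rewrite normr0 mul1r ltW//; case/andP: dn.
Qed.

Lemma scale_gt0 n : (0 < n)%N -> 0 < scale n.
Proof. by move=> n0; rewrite mulr_gt0 ?powR_gt0 ?ltr0n// step_gt0. Qed.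

Let F n : R := Num.sqrt (2 * cov_frob P (fun i : 'I_(m n) => increment n i)).

(** Only the diagonal of [G] is kept: eventually each variance is at least half of its leading term,
    and twice the number of windows is at least n. *)
Lemma cov_frob_ge : \forall n \near \oo,
  (C * psi / 2 * scale n) ^+ 2 <= 2 * cov_frob P (fun i : 'I_(m n) => increment n i).
Proof.
have e0 : 0 < C * psi / 2 by rewrite divr_gt0// mulr_gt0.
have := excess_le s_gt0 e0 r_littleo; apply: filter_app; near=> n => ex.
have n0 : (0 < n)%N by near: n; exact: nbhs_infty_gt.
have nL : (2 * size a <= n)%N by near: n; exact: nbhs_infty_ge.
have var_ge : C * psi / 2 * nu n <= diff2 a V (del n) 0.
  rewrite varianceE//; have := ler_norm (- excess n); rewrite normrN.
  move=> h.
  have -> : C * psi / 2 * nu n = nu n * (C * psi) / 2 by ring.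
  apply: half_le_add h _; apply: le_trans ex _; rewrite le_eqVlt; apply/orP; left; apply/eqP; ring.
have c0 : 0 <= C * psi / 2 * nu n by rewrite mulr_ge0 ?powR_ge0// ltW.
have -> : (C * psi / 2 * scale n) ^+ 2 = n%:R * (C * psi / 2 * nu n) ^+ 2.
  rewrite mulrCA exprMn; congr (_ * _).
  by rewrite -powR_mulrn ?powR_ge0// -powRrM mul1r mulVf// powRr1.
apply: (@le_trans _ _ (2 * \sum_(i < m n) (C * psi / 2 * nu n) ^+ 2)).
  rewrite sumr_const card_ord -[_ *+ (m n)]mulr_natl mulrA ler_wpM2r ?sqr_ge0//.
  by rewrite -natrM ler_nat window_count_ge.
rewrite ler_wpM2l//; apply: ler_sum => i _.
rewrite (bigD1 i)//= -[leLHS]addr0; apply: lerD; last by apply: sumr_ge0 => j _; exact: sqr_ge0.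
by rewrite cov_increment subnn mul0r ler_pXn2r ?nnegrE// (le_trans c0).
Unshelve. all: by end_near. Qed.

(** [F n] is bounded below by a multiple of [scale n], so being negligible against the latter
    suffices. *)
Lemma ratio_cvg0 (u : nat -> R) :
  (forall e : R, 0 < e -> \forall n \near \oo, `|u n| <= e * scale n) ->
  u n / F n @[n --> \oo] --> (0 : R).
Proof.
move=> hu; apply/cvgr0Pnorm_le => e e0.
have c0 : 0 < C * psi / 2 by rewrite divr_gt0// mulr_gt0.
have ec0 : 0 < e * (C * psi / 2) by rewrite mulr_gt0.
have := hu _ ec0; apply: filter_app; have := cov_frob_ge; apply: filter_app.
near=> n => hF un.
have n0 : (0 < n)%N by near: n; exact: nbhs_infty_gt.
have Fge : C * psi / 2 * scale n <= F n.
  apply: le_trans (ler_wsqrtr hF); rewrite sqrtr_sqr ger0_norm//.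
  by rewrite mulr_ge0 ?(ltW c0)// ltW// scale_gt0.
have F0 : 0 < F n by apply: lt_le_trans Fge; rewrite mulr_gt0// scale_gt0.
rewrite normrM normfV (gtr0_norm F0) ler_pdivrMr//.
by apply: le_trans un _; rewrite -(mulrA e) ler_wpM2l// ltW.
Unshelve. all: by end_near. Qed.

Lemma powR_near_le (p c e : R) : 0 < p -> 0 < e -> \forall n \near \oo, c * n%:R `^ (- p) <= e.
Proof.
move=> p0 e0; have cv : c * n%:R `^ (- p) @[n --> \oo] --> c * 0.
  by apply: cvgMr; exact: cvg_natpowRN.
rewrite mulr0 in cv; exact: (cvgr_le _ cv).
Qed.

Let row n : R := \big[Num.max/0]_(i < m n) \sum_(j < m n) `|cov P (increment n i) (increment n j)|.

(** A row sum is at most a constant times nu n^(1 - kappa), which is n^(1/2 - kappa) times the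
    scale. *)
Lemma row_ratio : row n / F n @[n --> \oo] --> (0 : R).
Proof.
have size0 : (0 < size a)%N by exact: ltnW.
have [A [kappa [rho [A0 k1 k2 rho0 dec]]]] := semivariogram_decay s_gt0 C_gt0 V_smooth V_derivable
  V_expansion a_moments lt_D_M beta_gt beta_lt q_le size0 K'_ge0 r_littleo.
have k3 : 0 < 1 - kappa by rewrite subr_gt0.
apply: ratio_cvg0 => e e0.
have k4 : 0 < kappa - 1 / 2 by rewrite subr_gt0.
have := @powR_near_le _ (2 * A / (1 - kappa)) _ k4 e0; apply: filter_app.
have := step_lt_near rho0; apply: filter_app.
near=> n => dn ne.
have n0 : (0 < n)%N by near: n; exact: nbhs_infty_gt.
have nu0 : 0 <= nu n by exact: powR_ge0.
pose g (k : nat) : R := A * nu n * k.+1%:R `^ (- kappa).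
have g0 k : 0 <= g k by rewrite !mulr_ge0 ?powR_ge0.
have cov_le i j : (i < m n)%N -> (j < m n)%N ->
    `|cov P (increment n i) (increment n j)| <= g ((i - j) + (j - i))%N.
  move=> im jm; rewrite cov_increment; set k := ((i - j) + (j - i))%N.
  have km : (k + (size a).-1 < n)%N by exact: window_dist.
  apply: dec => //; first exact: step_le1.
  move=> y y0 yk; apply: r_drv_bound => //.
  (* For alpha = 1 the derivative of [r] is controlled below 1 only, and n times the step is 1. *)
  have [a1|a1] := ltP alpha 1; [by left|right].
  have {}a1 : alpha = 1 by apply: le_anti; rewrite alpha_le1.
  move: yk; rewrite ler_distl => /andP[_ yk]; apply: le_lt_trans yk _.
  rewrite -mulrDl -natrD.
  have nd : n%:R * del n = 1 by rewrite natmul_step// a1 subrr powRr0.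
  by rewrite -[ltRHS]nd ltr_pM2r ?ltr_nat// step_gt0.
have row_le : row n <= 2 * A / (1 - kappa) * n%:R `^ (1 - kappa) * nu n.
  apply: bigmax_le => [|i _].
    by rewrite !mulr_ge0 ?powR_ge0// invr_ge0 ltW.
  apply: (@le_trans _ _ (\sum_(j < m n) g ((i - j) + (j - i))%N)).
    by apply: ler_sum => j _; apply: cov_le.
  apply: le_trans (sum_dist_le g0 (ltn_ord i)) _.
  have gn : \sum_(k < m n) g k <= \sum_(k < n) g k.
    rewrite -!(big_mkord xpredT g); by apply: sum_nat_widen_le => //; exact: window_count_le.
  apply: le_trans (ler_wpM2l _ gn) _ => //.
  rewrite -mulr_sumr.
  have kk : 0 < kappa < 1 by rewrite k2 andbT (lt_trans _ k1)// divr_gt0.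
  have := ler_wpM2l (mulr_ge0 A0 nu0) (sum_natpowRN_le n kk).
  move: (\sum_(i < n) _) (n%:R `^ _) (1 - kappa)^-1 => x y z h.
  have -> : 2 * A * z * y * nu n = 2 * (A * nu n * (y * z)) by ring.
  by rewrite ler_wpM2l.
have row0 : 0 <= row n by exact: bigmax_ge_id.
rewrite ger0_norm//; apply: le_trans row_le _; rewrite mulrA ler_wpM2r//.
have -> : n%:R `^ (1 - kappa) = n%:R `^ (- (kappa - 1 / 2)) * n%:R `^ (1 / 2) :> R.
  rewrite -powRD; last by rewrite pnatr_eq0 -lt0n n0 implybT.
  by congr (_ `^ _); field.
by rewrite mulrA ler_wpM2r ?powR_ge0.
Unshelve. all: by end_near. Qed.

(** Vanishing moments make each drift O(K delta^M), so its square is o(n^(-1/2) nu); at most n of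
    them are summed. *)
Lemma drift_ratio : (\sum_(i < m n) drift n i ^+ 2) / F n @[n --> \oo] --> (0 : R).
Proof.
apply: ratio_cvg0 => e e0.
pose J : R := (size a).-1%:R.
have J0 : 0 <= J by exact: ler0n.
pose c := (abs_sum a * J ^+ M) ^+ 2.
have c0 : 0 <= c by exact: sqr_ge0.
(* The cap at 1 gives e1^2 <= e1. *)
pose e1 : R := Num.min 1 (e / (c + 1)).
have c1 : 0 < c + 1 by rewrite ltr_wpDl.
have e10 : 0 < e1 by rewrite lt_min ltr01 divr_gt0.
have e1c : c * e1 ^+ 2 <= e.
  have h1 : e1 ^+ 2 <= e1 by rewrite expr2 ler_piMl ?(ltW e10)// ge_min lexx.
  have h2 : e1 <= e / (c + 1) by rewrite ge_min lexx orbT.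
  apply: le_trans (ler_wpM2l c0 (le_trans h1 h2)) _.
  by rewrite mulrA ler_pdivrMr// mulrC ler_wpM2l ?(ltW e0)// lerDl.
have /eqoP/(_ _ e10) := f_littleo; apply: filter_app.
near=> n => /= hK.
have n0 : (0 < n)%N by near: n; exact: nbhs_infty_gt.
have d0 := step_gt0 n0.
set K := mean_sup f alpha M n in hK.
have hD (i : 'I_(m n)) : drift n i ^+ 2 <= c * e1 ^+ 2 * (n%:R `^ (- (1 / 2)) * nu n).
  have h : `|drift n i| <= abs_sum a * (`|K| * (J * del n) ^+ M).
    apply: (norm_difference_le f_smooth a_moments (ltW d0) (hi := n%:R `^ (1 - alpha))).
    - by rewrite mulr_ge0// ltW.
    - rewrite -mulrDl -natrD -natmul_step// ler_wpM2r ?(ltW d0)// ler_nat.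
      exact: window_last.
    - by move=> y yI; apply: le_trans (norm_derive_le_mean_sup _ f_smooth yI) (ler_norm _).
  have {}h : `|drift n i| <= abs_sum a * J ^+ M * (e1 * (n%:R `^ (- (1 / 4)) * del n `^ (D%:R - M%:R + s / 2))) * del n ^+ M.
    apply: le_trans h _; rewrite exprMn.
    have -> : abs_sum a * (`|K| * (J ^+ M * del n ^+ M)) = abs_sum a * J ^+ M * `|K| * del n ^+ M by ring.
    rewrite ler_wpM2r ?exprn_ge0 ?(ltW d0)// ler_wpM2l ?mulr_ge0 ?abs_sum_ge0 ?exprn_ge0//.
    apply: le_trans hK _; rewrite ger0_norm// mulr_ge0 ?powR_ge0//.
  rewrite -real_normK ?num_real//.
  have h2 : `|drift n i| ^+ 2 <= (abs_sum a * J ^+ M * (e1 * (n%:R `^ (- (1 / 4)) * del n `^ (D%:R - M%:R + s / 2))) * del n ^+ M) ^+ 2.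
    by rewrite ler_pXn2r ?nnegrE// (le_trans _ h).
  apply: le_trans h2 _; rewrite le_eqVlt; apply/orP; left; apply/eqP.
  have p1 : n%:R `^ (- (1 / 2)) = (n%:R `^ (- (1 / 4))) ^+ 2 :> R.
    by rewrite -powR_mulrn ?powR_ge0// -powRrM; congr (_ `^ _); field.
  have p2 : nu n = (del n `^ (D%:R - M%:R + s / 2) * del n ^+ M) ^+ 2.
    rewrite -[del n ^+ M]powR_mulrn ?(ltW d0)// -powRD ?(gt_eqF d0) ?implybT//.
    rewrite -[RHS]powR_mulrn ?powR_ge0// -powRrM; congr (_ `^ _).
    by rewrite natrM; field.
  rewrite p1 p2 /c; ring.
rewrite ger0_norm; last by apply: sumr_ge0 => i _; exact: sqr_ge0.
apply: le_trans (ler_sum _ (fun i _ => hD i)) _.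
rewrite sumr_const card_ord -[_ *+ (m n)]mulr_natl.
apply: (@le_trans _ _ (n%:R * (c * e1 ^+ 2 * (n%:R `^ (- (1 / 2)) * nu n)))).
  apply: ler_wpM2r; last by rewrite ler_nat window_count_le.
  exact: mulr_ge0 (mulr_ge0 c0 (sqr_ge0 _)) (mulr_ge0 (powR_ge0 _ _) (powR_ge0 _ _)).
have -> : n%:R * (c * e1 ^+ 2 * (n%:R `^ (- (1 / 2)) * nu n)) =
    c * e1 ^+ 2 * (n%:R * n%:R `^ (- (1 / 2)) * nu n) by ring.
have -> : n%:R * n%:R `^ (- (1 / 2)) = n%:R `^ (1 / 2) :> R.
  rewrite -[X in X * _ = _]powRr1// -powRD ?pnatr_eq0 -?lt0n ?n0 ?implybT//.
  by congr (_ `^ _); field.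
by rewrite ler_wpM2r// ltW// scale_gt0.
Unshelve. all: by end_near. Qed.

(** Two sources: the denominator counts n windows instead of n - L + 1, an error O(nu), and the
    contributions of Q add up to o(n nu delta^(1/(2 alpha))), where the power of delta is
    n^(-1/2). *)
Lemma bias_ratio : (cov_trace P (fun i : 'I_(m n) => increment n i) - C * den n) / F n @[n --> \oo] --> (0 : R).
Proof.
apply: ratio_cvg0 => e e0.
have e2 : 0 < e / 2 by rewrite divr_gt0.
have t0 : 0 < s + 1 / (2 * alpha) by rewrite addr_gt0// divr_gt0// mulr_gt0.
have h2 : 0 < 1 / 2 :> R by rewrite divr_gt0.
have := excess_le t0 e2 r_bias; apply: filter_app.
have := @powR_near_le _ ((size a)%:R * (C * psi)) _ h2 e2; apply: filter_app.
near=> n => hn ex.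
have n0 : (0 < n)%N by near: n; exact: nbhs_infty_gt.
have nL : (size a <= n)%N by near: n; exact: nbhs_infty_ge.
have d0 := step_gt0 n0.
have nn0 : n%:R != 0 :> R by rewrite pnatr_eq0 -lt0n.
have hp : n%:R * n%:R `^ (- (1 / 2)) = n%:R `^ (1 / 2) :> R.
  rewrite -[X in X * _ = _]powRr1// -powRD ?pnatr_eq0 -?lt0n ?n0 ?implybT//.
  by congr (_ `^ _); field.
have dp : del n `^ ((2 * D)%:R + (s + 1 / (2 * alpha))) = nu n * n%:R `^ (- (1 / 2)).
  rewrite addrA powRD ?(gt_eqF d0) ?implybT//; congr (_ * _).
  by rewrite /step -powRrM; congr (_ `^ _); field; rewrite gt_eqF.
have -> : cov_trace P (fun i : 'I_(m n) => increment n i) = (m n)%:R * (nu n * (C * psi) + excess n).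
  rewrite /cov_trace (eq_bigr (fun=> nu n * (C * psi) + excess n)) => [|i _].
    by rewrite sumr_const card_ord -[_ *+ (m n)]mulr_natl.
  by rewrite cov_increment subnn mul0r varianceE.
rewrite denE.
have -> : (m n)%:R * (nu n * (C * psi) + excess n) - C * (n%:R * nu n * psi) =
    - ((n - m n)%:R * (nu n * (C * psi))) + (m n)%:R * excess n.
  by rewrite (natrB _ (window_count_le n size_gt1)); ring.
apply: le_trans (ler_normD _ _) _.
have Cp0 : 0 <= C * psi by rewrite ltW// mulr_gt0.
have w0 : 0 <= nu n * (C * psi) by rewrite mulr_ge0 ?powR_ge0.
rewrite normrN (ger0_norm (mulr_ge0 (ler0n _ _) w0)) [X in _ + X <= _]normrM normr_nat.
have b1 : (n - m n)%:R * (nu n * (C * psi)) <= e / 2 * scale n.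
  apply: (@le_trans _ _ ((size a)%:R * (nu n * (C * psi)))).
    by rewrite ler_wpM2r// ler_nat window_count_defect.
  have := ler_wpM2r (ltW (scale_gt0 n0)) hn; apply: le_trans.
  have hq : n%:R `^ (- (1 / 2)) * n%:R `^ (1 / 2) = 1 :> R.
    by rewrite -powRD ?addNr ?powRr0// nn0 implybT.
  have -> : (size a)%:R * (C * psi) * n%:R `^ (- (1 / 2)) * scale n =
    (n%:R `^ (- (1 / 2)) * n%:R `^ (1 / 2)) * ((size a)%:R * (nu n * (C * psi))) by ring.
  by rewrite hq mul1r.
have b2 : (m n)%:R * `|excess n| <= e / 2 * scale n.
  apply: (@le_trans _ _ (n%:R * (e / 2 * (nu n * n%:R `^ (- (1 / 2)))))).
    by apply: ler_pM => //; [rewrite ler_nat window_count_le|rewrite -dp].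
  rewrite -hp le_eqVlt; apply/orP; left; apply/eqP; ring.
by rewrite [e in leRHS](_ : e = e / 2 + e / 2); [rewrite mulrDl lerD|field].
Unshelve. all: by end_near. Qed.

Lemma normalized_estimator_clt :
  cvg_in_distribution P (normalized_estimator X a alpha D s C) (normal_prob 0 1).
Proof.
rewrite (_ : normalized_estimator X a alpha D s C = fun n w =>
    ((\sum_(i < m n) (increment n i w + drift n i) ^+ 2) / den n - C) /
    Num.sqrt (fine 'V_P[fun w => (\sum_(i < m n) (increment n i w + drift n i) ^+ 2) / den n])); last first.
  by apply/funext => n; rewrite /normalized_estimator estimatorE.
apply: (@array_clt _ _ _ P _ (gspace_process X_gauss) (fun n => m n) (fun n i => increment n i)
  (fun n i => drift n i) _ C den row).
- by move=> n i; exact: (process_space_sum X a (fun k => i.+1%:R * del n + k%:R * del n)).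
- by move=> n i; rewrite /row; apply: (le_bigmax _ (fun i : 'I_(m n) =>
    \sum_(j < m n) `|cov P (increment n i) (increment n j)|)).
- near=> n.
  have n0 : (0 < n)%N by near: n; exact: nbhs_infty_gt.
  have h : (C * psi / 2 * scale n) ^+ 2 <= 2 * cov_frob P (fun i : 'I_(m n) => increment n i).
    by near: n; exact: cov_frob_ge.
  have h0 : 0 < (C * psi / 2 * scale n) ^+ 2.
    by rewrite exprn_gt0// mulr_gt0 ?scale_gt0// divr_gt0// mulr_gt0.
  by have := lt_le_trans h0 h; rewrite pmulr_rgt0.
- near=> n; have n0 : (0 < n)%N by near: n; exact: nbhs_infty_gt.
  have n1 : 0 < n%:R :> R by rewrite ltr0n.
  by rewrite denE; exact: mulr_gt0 (mulr_gt0 n1 (powR_gt0 _ (step_gt0 n0))) psi_gt0.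
- exact: row_ratio.
- exact: drift_ratio.
- exact: bias_ratio.
Unshelve. all: by end_near. Qed.

End Assembly.

Unset Implicit Arguments.

Theorem corollary3p9 (d : measure_display) (T : measurableType d)
  (R : realType) (P : probability T R) (X : R -> {RV P >-> R})
  (hgauss : gaussian_process X)
  (f : R -> R) (hf : smooth_on [set: R] f)
  (hmean : forall t : R, 0 <= t -> ('E_P[X t] = (f t)%:E)%E)
  (hstat : stationary_increments P (centered X))
  (V : R -> R) (hV : is_semivariogram P (centered X) V)
  (alpha : R) (halpha0 : 0 < alpha) (halpha1 : alpha <= 1)
  (* (i) *)
  (hVsmooth : smooth_on [set x : R | 0 < x] V)
  (* (ii) *)
  (D : nat) (hVD : times_derivable (2 * D) V)
  (C s : R) (hC : 0 < C) (hs0 : 0 < s) (hs2 : s < 2)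
  (r : R -> R)
  (hexp : forall h : R,
     derive1n (2 * D) V h = derive1n (2 * D) V 0 + C * (-1) ^+ D * `|h| `^ s + r h)
  (hr0 : r =o_ (nbhs (0 : R)) (fun h : R => `|h| `^ s))
  (hrinf : alpha < 1 ->
     exists K : R, forall h : R, 1 < `|h| -> `|r h| <= K * `|h| `^ s)
  (* (iii) *)
  (hrd : let q := if s < 3 / 2 then 2%N else 3%N in
     exists beta K' : R,
       [/\ s - q%:R < beta, beta < - (1 / 2),
           alpha = 1 -> forall h : R, 0 < `|h| < 1 ->
             `|derive1n q r h| <= K' * `|h| `^ beta
         & alpha < 1 -> forall h : R, h != 0 ->
             `|derive1n q r h| <= K' * `|h| `^ beta])
  (* (iv) *)
  (hrbias : r =o_ (nbhs (0 : R)) (fun h : R => `|h| `^ (s + 1 / (2 * alpha))))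
  (a : seq R) (ha : diff_seq a) (hasum : \sum_(j < size a) a`_j = 0)
  (M : nat) (hM : has_order a M) (hMD : D%:R + s / 2 + 1 / 4 < M%:R)
  (hK : mean_sup f alpha M =o_\oo
     (fun n : nat => n%:R `^ (- (1 / 4)) *
        step alpha n `^ (D%:R - M%:R + s / 2))) :
  cvg_in_distribution P (normalized_estimator X a alpha D s C)
    (normal_prob 0 1).
Proof.
have [beta [K' [b1 b2 rd1 rd2]]] := hrd.
set q := (if s < 3 / 2 then 2%N else 3%N) in b1 rd1 rd2.
(* For q = 2, M > D is enough. For q = 3, s >= 3/2 gives s/2 + 1/4 >= 1, hence M > D + 1. *)
have q_le : (2 * D + q <= 2 * M)%N.
  have DM : (D < M)%N by rewrite -(ltr_nat R); lra.
  rewrite /q; case: ltP => [_|s3]; first by move: DM; clear; lia.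
  have DM' : (D.+1 < M)%N by rewrite -(ltr_nat R) -natr1; lra.
  by move: DM'; clear; lia.
(* The constant [K'] may be negative a priori; its absolute value is used instead. *)
apply: (normalized_estimator_clt hgauss hf hmean hV halpha0 halpha1 hVsmooth hVD hC hs0 hs2
  hexp hr0 b1 b2 q_le (normr_ge0 K') _ hrbias ha hasum hM.1 hMD hK).
move=> y y0 hy.
have y1 : 0 < `|y| by rewrite normr_gt0 gt_eqF.
have hy' : `|derive1n q r y| <= K' * `|y| `^ beta.
  have [a1|a1] := ltP alpha 1; first by apply: rd2 => //; rewrite gt_eqF.
  have {}a1 : alpha = 1 by apply: le_anti; rewrite halpha1.
  apply: rd1 => //; rewrite y1 /= gtr0_norm//.
  by case: hy => //; rewrite a1 ltxx.
apply: le_trans hy' _; rewrite (gtr0_norm y0) ler_wpM2r ?powR_ge0//.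
exact: ler_norm.
Qed.
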